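(* Let $p$ be an atoral stable polynomial on $\mathbb{D}^2$ with zeros $\tau^1,\dots,\tau^m\in\mathbb{T}^2$ (these being all the zeros of $p$ on $\mathbb{T}^2$) and respective contact orders $K_{\tau^1},\dots,K_{\tau^m}$. Further assume that $p$ vanishes to order $1$ at each $\tau^j$. Then the $z_1$-derivative integrability indices of $p$ are exactly $$\frac{K_{\tau^j}+1}{K_{\tau^j}},\ \frac{K_{\tau^j}+1}{K_{\tau^j}-1},\ \frac{K_{\tau^j}+1}{K_{\tau^j}-2},\ \dots,\ \frac{K_{\tau^j}+1}{1}$$ for $j=1,\dots,m$, and $\infty$.
   Context: $\mathbb{D}$ is the open unit disk, $\mathbb{T}$ the unit circle. For $p\in\mathbb{C}[z_1,z_2]$ of bidegree $(n_1,n_2)$, $\tilde p(z)=z_1^{n_1}z_2^{n_2}\overline{p(1/\bar z_1,1/\bar z_2)}$. $p$ is atoral stable on $\mathbb{D}^2$ if it has no zeros in $\mathbb{D}^2$ and no nonconstant factor in common with $\tilde p$; such $p$ has finitely many zeros on $\mathbb{T}^2$. The contact order of $p$ at a zero $\tau=(\tau_1,\tau_2)\in\mathbb{T}^2$ is the (positive even) integer $K_\tau$ such that, restricting to the zeros of $\tilde p$ near $\tau$, for $z_1\in\mathbb{T}$ close to $\tau_1$, $$\inf\{1-|z_2|:\tilde p(z_1,z_2)=0,\ z_2\text{ in a fixed small neighborhood of }\tau_2\}\approx|z_1-\tau_1|^{K_\tau},$$ where $\approx$ means bounded above and below by positive constant multiples. A rational Schur function on $\mathbb{D}^2$ is a rational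 function analytic on $\mathbb{D}^2$ and bounded by $1$ in modulus there. A number $\mathfrak{p}\in(0,\infty]$ is a $z_1$-derivative integrability index of $p$ if there is $q\in\mathbb{C}[z_1,z_2]$ such that $q/p$ is a rational Schur function and $\mathfrak{p}=\sup\{\mathfrak{p}'>0:\partial_{z_1}(q/p)\in L^{\mathfrak{p}'}(\mathbb{T}^2)\}$. *)

(* Defs.v *)
From HB Require Import structures.
From mathcomp Require Import all_boot all_order all_algebra.
From mathcomp Require Import all_classical all_reals all_analysis.
From mathcomp Require Import polyXY complex.
Set Implicit Arguments.
Unset Strict Implicit.
Unset Printing Implicit Defensive.
Import Order.TTheory GRing.Theory Num.Theory.
Import numFieldNormedType.Exports.
Local Open Scope classical_set_scope.
Local Open Scope ring_scope.

(* C[z1, z2] is {poly {poly R[i]}}: z1 is the outer variable 'X and z2 the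
   inner variable 'Y, so that the value of p at (z1, z2) is p.[z1, z2], the
   coefficient of z1^i z2^j is p`_i`_j, and the bidegree of p != 0 is
   ((size p).-1, (sizeY p).-1). *)

Section Definitions.
Variable R : realType.
Local Notation C := (R[i]).
Implicit Types (p q : {poly {poly C}}) (z tau : C * C).

Definition bidisk : set (C * C) := [set z | `|z.1| < 1 /\ `|z.2| < 1].

Definition torus : set (C * C) := [set z | `|z.1| = 1 /\ `|z.2| = 1].

(* The polynomial z1^n1 z2^n2 conj(p(1/conj z1, 1/conj z2)), with (n1, n2) the
   bidegree of p, given by its coefficients; see [reflection_horner]. *)
Definition reflection p : {poly {poly C}} :=
  \poly_(i < size p) \poly_(j < sizeY p)
    (p`_((size p).-1 - i)`_((sizeY p).-1 - j))^*.

Lemma reflection_horner p (z1 z2 : C) : z1 != 0 -> z2 != 0 ->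
  (reflection p).[z1, z2] =
  z1 ^+ (size p).-1 * z2 ^+ (sizeY p).-1 * (p.[1 / z1^*, 1 / z2^*])^*.
Proof.
move=> z1_neq0 z2_neq0.
have rev_exp (w : C) n (k : 'I_n) : w != 0 ->
    w ^+ (n - k.+1) = w ^+ n.-1 * w^-1 ^+ k.
  by case: n k => [[]|n] // k w0; rewrite subSS exprVn expfB_cond // (negPf w0) leq_ord.
have rev_sub n (k : 'I_n) : (n.-1 - (n - k.+1) = k)%N.
  by case: n k => [[]|n] // k; rewrite subSS subKn // leq_ord.
rewrite /reflection horner_poly horner_sum (reindex_inj rev_ord_inj) /=.
rewrite [p.[_]]horner_coef horner_sum rmorph_sum mulr_sumr.
apply: eq_bigr => i _; rewrite rev_sub -!polyC_exp !hornerM !hornerC.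
rewrite horner_poly (reindex_inj rev_ord_inj) /= rev_exp //.
rewrite (@horner_coef_wide _ (sizeY p) p`_i) ?max_size_coefXY //.
rewrite rmorphM rmorph_sum rmorphXn !div1r fmorphV /= conjCK.
rewrite [z1 ^+ _ * z2 ^+ _]mulrC [RHS]mulrACA; congr (_ * _).
rewrite mulr_sumr; apply: eq_bigr => j _.
by rewrite rev_sub rev_exp // rmorphM rmorphXn fmorphV /= conjCK mulrCA.
Qed.

(* Divisibility is spelled out because [%|] of polydiv is pseudo-divisibility
   when the coefficients do not form a field. *)
Definition atoral_stable p : Prop :=
  (forall z, bidisk z -> p.[z.1, z.2] <> 0) /\
  (forall r s t : {poly {poly C}},
     p = r * s -> reflection p = r * t -> exists c : C, r = c%:P%:P).

Definition mixed_deriv (i j : nat) p : {poly {poly C}} :=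
  map_poly (derivn j) p^`(i).

Definition vanishes_to_order p tau (M : nat) : Prop :=
  (forall i j, (i + j < M)%N -> (mixed_deriv i j p).[tau.1, tau.2] = 0) /\
  (exists i j, (i + j = M)%N /\ (mixed_deriv i j p).[tau.1, tau.2] <> 0).

Local Notation normc := (@ComplexField.Normc.normc R).

Definition fiber_gap p tau (r : R) (z1 : C) : \bar R :=
  ereal_inf [set (1 - normc z2)%:E | z2 in
    [set z2 : C | (reflection p).[z1, z2] = 0 /\ normc (z2 - tau.2) < r]].

(* The neighbourhood of tau.2 has to be small enough to isolate tau.2 from the
   other zeros of z2 |-> p~(tau.1, z2); the constants may depend on it. *)
Definition is_contact_order p tau (K : nat) : Prop :=
  exists2 r0 : R, 0 < r0 & forall r : R, 0 < r <= r0 ->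
  exists d a b : R, [/\ 0 < d, 0 < a, 0 < b &
    forall z1 : C, `|z1| = 1 -> normc (z1 - tau.1) < d ->
      ((a * normc (z1 - tau.1) ^+ K)%:E <= fiber_gap p tau r z1)%E /\
      (fiber_gap p tau r z1 <= (b * normc (z1 - tau.1) ^+ K)%:E)%E].

(* [^o] selects the structure of normed space of C over itself, so that
   [differentiable] and [derive1] are taken in the complex sense. *)
Definition holomorphic_on (D : set (C * C)) (f : C * C -> C) : Prop :=
  forall z : C^o * C^o, D z -> differentiable (f : C^o * C^o -> C^o) z.

(* [f] is the function on the bidisk that the rational function q/p defines:
   p may have zeros in the bidisk that are cancelled by q. *)
Definition quotient_is_rational_schur q p : Prop :=
  p <> 0 /\
  exists f : C * C -> C,
    [/\ forall z, bidisk z -> f z * p.[z.1, z.2] = q.[z.1, z.2],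
        holomorphic_on bidisk f
      & forall z, bidisk z -> `|f z| <= 1].

(* Arbitrary on the zeros of p, which form a null subset of the torus. *)
Definition dz1_quotient q p z : C :=
  derive1 (fun w : C => q.[w, z.2] / p.[w, z.2] : C^o) z.1.

Definition expi (t : R) : C := Complex (cos t) (sin t).

(* L^r(T^2), in the angular parametrization of the torus; [r] may be < 1. *)
Definition in_Lp_torus (r : R) (f : C * C -> C) : Prop :=
  let Q : set (measurableTypeR R * measurableTypeR R) :=
    `[0, 2 * pi] `*` `[0, 2 * pi] in
  let g := fun t : measurableTypeR R * measurableTypeR R =>
    f (expi t.1, expi t.2) in
  [/\ measurable_fun Q (fun t => complex.Re (g t)),
      measurable_fun Q (fun t => complex.Im (g t))
    & (\int[(@lebesgue_measure R \x @lebesgue_measure R)%E]_(t in Q)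
         (normc (g t) `^ r)%:E < +oo)%E].

Definition is_z1_derivative_index p (x : \bar R) : Prop :=
  (0 < x)%E /\
  exists q, quotient_is_rational_schur q p /\
    x = ereal_sup [set r%:E | r in
          [set r : R | 0 < r /\ in_Lp_torus r (dz1_quotient q p)]].

End Definitions.

Arguments bidisk {R}.
Arguments torus {R}.

(* Main.v *)
(* Near a zero (t1, t2) of p, the gradient does not vanish, so there is a polynomial
   curve y = g(x) tangent to the zero set of p to order 2K, and contact order K means
   |g(x)| - 1 ~ |x - t1|^K for x on the circle.  On the torus this gives
   |p(x, y)| ~ |x - t1|^K + |y - g(x)/|g(x)||.  If q/p is Schur then |q| <= |p| on the
   torus, and evaluating at y = g(x)/|g(x)| shows that q vanishes along the curve to
   an order e >= K.  Now d(q/p)/dx = W/p^2 with W = q_x p - q p_x, and dividing p and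
   q by y - g(x) gives |W| <= C (|p|^2 + |x - t1|^e), while |W| is at least
   c |x - t1|^e on the region |y - g(x)/|g(x)|| <= |x - t1|^K when e < 2K.
   Integrating |W/p^2|^r in y and then in x, the contribution of the zero is finite
   when r (2K - e) < K + 1 and infinite when r (2K - e) > K + 1.  Hence the index of
   q is the least (K + 1)/(2K - e) over the zeros with e < 2K.
   Conversely p~ has order exactly K along each curve, so the index (K_j + 1)/k is
   attained by a multiple of (z1 - t1)^(K_j - k) p~ and of high powers of linear forms
   vanishing at the other zeros. *)

(* Vanishing to order 1 leaves only one partial derivative certainly nonzero, while both are needed:
   p_y makes the zero set a graph over x, and p_x multiplies the leading term of W. Stability
   supplies the missing one ([gradient_neq0]). A polynomial truncation of the analytic branch is
   enough because a zero with e >= 2K contributes only a bounded derivative; orders along the curve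
   are therefore recorded only up to 2K. The expansion of W contains, besides the terms in p^2 and
   (x - t1)^e, a cross term (x - t1)^(e-1) p. Absorbing it requires e >= 2 for the upper bound and K
   >= 2 for the lower one, so K >= 2 has to be established beforehand; it is derived from the growth
   of |g| - 1 on both sides of t1. The threshold comes from the inner integral in y, which has size
   |x - t1|^(K - (2K - e) r): integrability in x means that this exponent exceeds -1. Since e >= K,
   every threshold exceeds 1, so the upper estimates are only made for r >= 1, where r-th powers can
   be split off. *)
Require Import Defs.
From mathcomp Require Import all_boot all_order all_algebra.
From mathcomp Require Import all_classical all_reals all_analysis.
From mathcomp Require Import polyXY complex.
From mathcomp Require Import measurable_realfun.
From mathcomp Require Import zify ring lra.
Set Implicit Arguments.
Unset Strict Implicit.
Unset Printing Implicit Defensive.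
Import Order.TTheory GRing.Theory Num.Theory.
Import numFieldNormedType.Exports.
Local Open Scope classical_set_scope.
Local Open Scope ring_scope.

(** * Moduli and polynomial bounds *)

Section Modulus.
Variable R : realType.
Local Notation C := (R[i]).
Local Notation N := (@ComplexField.Normc.normc R).
Implicit Types (x y z w : C).

Lemma normE z : `|z| = ((N z)%:C)%C. Proof. by case: z. Qed.

Lemma Nge0 z : 0 <= N z. Proof. by case: z => a b /=; rewrite sqrtr_ge0. Qed.

Lemma N0 : N 0 = 0. Proof. exact: ComplexField.Normc.normc0. Qed.
Lemma N1 : N 1 = 1. Proof. exact: ComplexField.Normc.normc1. Qed.
Lemma NM z w : N (z * w) = N z * N w.
Proof. exact: ComplexField.Normc.normcM. Qed.
Lemma NV z : N z^-1 = (N z)^-1.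
Proof. exact: ComplexField.Normc.normcV. Qed.
Lemma Nf z w : N (z / w) = N z / N w.
Proof. by rewrite NM NV. Qed.
Lemma NX z n : N (z ^+ n) = N z ^+ n.
Proof. by elim: n => [|n IH]; rewrite ?expr0 ?N1 // !exprS NM IH. Qed.
Lemma NN z : N (- z) = N z. Proof. exact: normcN. Qed.
Lemma NBC z w : N (z - w) = N (w - z). Proof. by rewrite -NN opprB. Qed.
Lemma ND z w : N (z + w) <= N z + N w. Proof. exact: le_normcD. Qed.
Lemma NB z w : N (z - w) <= N z + N w.
Proof. by rewrite -(NN w) ND. Qed.
Lemma NBge z w : N z - N w <= N (z - w).
Proof. by rewrite lerBlDr -{1}(subrK w z) ND. Qed.
Lemma NDge z w : N z - N w <= N (z + w).
Proof. by rewrite -(NN w) -[X in _ <= N (_ + X)]opprK NBge. Qed.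
Lemma Ntri x y z : N (x - z) <= N (x - y) + N (y - z).
Proof. by rewrite -[x - z](subrKA y) ND. Qed.
Lemma N_eq0 z : (N z == 0) = (z == 0).
Proof.
by apply/eqP/eqP => [|->]; [exact: ComplexField.Normc.eq0_normc|exact: N0].
Qed.
Lemma N_gt0 z : (0 < N z) = (z != 0).
Proof. by rewrite lt_def Nge0 andbT N_eq0. Qed.
Lemma Nconj z : N z^* = N z.
Proof. by case: z => a b /=; rewrite sqrrN. Qed.
Lemma Nreal (a : R) : N (a%:C)%C = `|a|.
Proof. by rewrite /= expr0n /= addr0 sqrtr_sqr. Qed.
Lemma conjM z w : (z * w)^* = z^* * w^*. Proof. exact: rmorphM. Qed.
Lemma conjX z n : (z ^+ n)^* = z^* ^+ n. Proof. exact: rmorphXn. Qed.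
Lemma N_sqr z : N z ^+ 2 = complex.Re (z * z^*).
Proof.
case: z => a b; rewrite /= sqr_sqrtr ?addr_ge0 ?sqr_ge0 //.
by rewrite mulrN opprK !expr2.
Qed.
Lemma mulcC z : z * z^* = ((N z ^+ 2)%:C)%C.
Proof.
case: z => a b; rewrite /= sqr_sqrtr ?addr_ge0 ?sqr_ge0 //.
by apply/eqP; rewrite eq_complex /= mulrN opprK !expr2 eqxx /=; apply/eqP; ring.
Qed.
Lemma ReD z w : complex.Re (z + w) = complex.Re z + complex.Re w.
Proof. by case: z w => [a b] [c d]. Qed.
Lemma ReB z w : complex.Re (z - w) = complex.Re z - complex.Re w.
Proof. by case: z w => [a b] [c d]. Qed.
Lemma Re_conjc z : complex.Re z^* = complex.Re z.
Proof. by case: z => [a b]. Qed.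
Lemma ReZ (a : R) z : complex.Re ((a%:C)%C * z) = a * complex.Re z.
Proof. by case: z => [c d] /=; rewrite mul0r subr0. Qed.
Lemma Re_le z : complex.Re z <= N z.
Proof.
case: z => a b /=; apply: le_trans (ler_norm a) _.
by rewrite -sqrtr_sqr ler_sqrt ?addr_ge0 ?sqr_ge0 // lerDl sqr_ge0.
Qed.
Lemma norm_lt1 z : (`|z| < 1) = (N z < 1).
Proof. by rewrite normE -[1](rmorph1 (real_complex R)) ltcR. Qed.
Lemma norm_le1 z : (`|z| <= 1) = (N z <= 1).
Proof. by rewrite normE -[1](rmorph1 (real_complex R)) lecR. Qed.
Lemma norm_eq1 z : (`|z| = 1) <-> (N z = 1).
Proof.
rewrite normE -[1](rmorph1 (real_complex R)); split => [[]//|->//].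
Qed.
Lemma conj_unit z : N z = 1 -> z^* = z^-1.
Proof.
move=> z1; have z0 : z != 0 by rewrite -N_gt0 z1.
by apply: (mulfI z0); rewrite mulcC z1 expr1n divff // rmorph1.
Qed.

Lemma N_prod (I : Type) (s : seq I) (P : pred I) (F : I -> C) :
  N (\prod_(i <- s | P i) F i) = \prod_(i <- s | P i) N (F i).
Proof. by elim/big_ind2: _ => [|x1 x2 y1 y2 <- <-|//]; rewrite ?N1 ?NM. Qed.

End Modulus.

Section Bounds.
Variable R : realType.
Local Notation C := (R[i]).
Local Notation N := (@ComplexField.Normc.normc R).
Implicit Types (f g : {poly {poly C}}) (a b : {poly C}).

Lemma poly_bound (r : R) a : exists2 M : R, 0 < M &
  forall z, N z <= r -> N a.[z] <= M.
Proof.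
elim/poly_ind: a => [|a c [M M0 HM]].
  by exists 1 => // z _; rewrite horner0 N0.
exists (M * Num.max r 1 + N c + 1).
  by rewrite ltr_pwDr // addr_ge0 ?Nge0 // mulr_ge0 ?(ltW M0) // le_max ler01 orbT.
move=> z zr; rewrite hornerMXaddC; apply: le_trans (ND _ _) _; rewrite NM.
rewrite -addrA lerD // ?ler_wpDr //.
apply: ler_pM; rewrite ?Nge0 ?HM //; by rewrite le_max zr.
Qed.

Lemma poly_lip (r : R) a : exists2 M : R, 0 < M &
  forall z w, N z <= r -> N w <= r -> N (a.[z] - a.[w]) <= M * N (z - w).
Proof.
elim/poly_ind: a => [|a c [M M0 HM]].
  by exists 1 => // z w _ _; rewrite !horner0 subrr N0 mulr_ge0 ?Nge0.
have [B B0 HB] := poly_bound r a.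
exists (M * Num.max r 1 + B) => [|z w zr wr].
  by rewrite addr_gt0 // mulr_gt0 // lt_max ltr01 orbT.
rewrite !hornerMXaddC [X in N X](_ : _ = (a.[z] - a.[w]) * z + a.[w] * (z - w));
  last by ring.
apply: le_trans (ND _ _) _; rewrite !NM mulrDl lerD //.
  rewrite -mulrA [Num.max _ _ * _]mulrC mulrA; apply: ler_pM; rewrite ?Nge0 ?HM //.
  by rewrite le_max zr.
by apply: ler_wpM2r; rewrite ?Nge0 ?HB.
Qed.

Lemma poly2_bound (r : R) f : exists2 M : R, 0 < M &
  forall z w, N z <= r -> N w <= r -> N f.[z, w] <= M.
Proof.
elim/poly_ind: f => [|f c [M M0 HM]].
  by exists 1 => // z w _ _; rewrite !horner0 N0.
have [B B0 HB] := poly_bound r c.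
exists (M * Num.max r 1 + B) => [|z w zr wr].
  by rewrite addr_gt0 // mulr_gt0 // lt_max ltr01 orbT.
rewrite hornerMXaddC hornerD hornerM hornerC; apply: le_trans (ND _ _) _; rewrite NM.
rewrite lerD ?HB //; apply: ler_pM; rewrite ?Nge0 ?HM //; by rewrite le_max zr.
Qed.

Lemma poly2_lip (r : R) f : exists2 M : R, 0 < M &
  forall z w z' w', N z <= r -> N w <= r -> N z' <= r -> N w' <= r ->
   N (f.[z, w] - f.[z', w']) <= M * (N (z - z') + N (w - w')).
Proof.
elim/poly_ind: f => [|f c [M M0 HM]].
  by exists 1 => // z w z' w' _ _ _ _; rewrite !horner0 subrr N0 mulr_ge0 ?addr_ge0 ?Nge0.
have [B B0 HB] := poly2_bound r f.
have [D D0 HD] := poly_lip r c.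
exists (M * Num.max r 1 + B + D) => [|z w z' w' zr wr zr' wr'].
  by rewrite !addr_gt0 // mulr_gt0 // lt_max ltr01 orbT.
rewrite !hornerMXaddC !hornerD !hornerM !hornerC.
rewrite [X in N X](_ : _ = (f.[z, w] - f.[z', w']) * z + f.[z', w'] * (z - z')
   + (c.[w] - c.[w'])); last by ring.
apply: le_trans (ND _ _) _; apply: le_trans (lerD (ND _ _) (lexx _)) _.
rewrite !NM !mulrDl; apply: lerD; first apply: lerD.
- rewrite -mulrA [Num.max _ _ * _]mulrC mulrA; apply: ler_pM; rewrite ?Nge0 ?HM //.
  by rewrite le_max zr.
- apply: ler_pM; rewrite ?Nge0 ?HB // lerDl Nge0 //.
- apply: le_trans (HD _ _ wr wr') _; apply: ler_wpM2l; [exact: ltW|by rewrite lerDr Nge0].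
Qed.

End Bounds.

(** * Stable polynomials and their reflections *)

Section OneVariable.
Variable R : realType.
Local Notation C := (R[i]).
Local Notation N := (@ComplexField.Normc.normc R).
Implicit Types (P f g : {poly C}).

(* [Re (z / (z - alpha)) <= 1/2] when [|z| <= |alpha|], summed over the roots of P. *)
Lemma Re_log_deriv P z : (forall w, N w < 1 -> P.[w] != 0) -> N z <= 1 ->
  2 * complex.Re (z * P^`().[z] * P.[z]^*) <= (size P)%:R * N P.[z] ^+ 2.
Proof.
move=> Pn0 z1; have [s defP] := closed_field_poly_normal P.
have P0 : P != 0.
  by apply/eqP => P0; have := Pn0 0; rewrite P0 horner0 N0 eqxx ltr01 => /(_ isT).
have s_out a : a \in s -> 1 <= N a.
  move=> a_s; rewrite leNgt; apply/negP => /Pn0; rewrite defP hornerZ.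
  rewrite horner_prod (perm_big _ (perm_to_rem a_s)) big_cons /= hornerXsubC subrr mul0r mulr0.
  by rewrite eqxx.
have sz : size P = (size s).+1.
  by rewrite {1}defP size_scale ?lead_coef_eq0 // size_prod_XsubC.
apply: (@le_trans _ _ ((size s)%:R * N P.[z] ^+ 2)); last first.
  by rewrite sz ler_wpM2r ?exprn_ge0 ?Nge0 // ler_nat.
move: (lead_coef P) defP => c ->; clear sz Pn0 P0.
rewrite !derivZ !hornerZ rmorphM /= [X in 2 * complex.Re X](_ : _ =
    (c * c^*) * (z * (\prod_(a <- s) ('X - a%:P))^`().[z] * ((\prod_(a <- s) ('X - a%:P)).[z])^*));
  last by ring.
rewrite mulcC ReZ NM exprMn mulrCA [X in _ <= X]mulrCA ler_wpM2l ?exprn_ge0 ?Nge0 //.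
elim: s s_out => [|a s IH] s_out.
  rewrite big_nil -polyC1 derivC horner0 mulr0. by rewrite mul0r /= mulr0 mul0r.
have a1 : 1 <= N a by apply: s_out; rewrite mem_head.
have {}IH := IH (fun b bs => s_out b (mem_behead (s:=a::s) bs)).
rewrite big_cons derivM derivXsubC mul1r; set Q := \prod_(j <- s) _ in IH *.
rewrite !hornerM hornerD hornerM hornerXsubC !rmorphM /=.
rewrite [X in 2 * complex.Re X](_ : _ = (Q.[z] * Q.[z]^*) * (z * (z - a)^*) +
   ((z - a) * (z - a)^*) * (z * Q^`().[z] * Q.[z]^*)); last by ring.
rewrite ReD !mulcC !ReZ NM exprMn /= mulrDr -[(size s).+1%:R]natr1 [X in _ <= X]mulrDl mul1r addrC lerD //.
  by rewrite [X in X <= _]mulrCA [X in _ <= X]mulrCA ler_wpM2l ?exprn_ge0 ?Nge0.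
rewrite [X in X <= _]mulrCA [X in _ <= X]mulrC ler_wpM2l ?exprn_ge0 ?Nge0 //.
(* After expansion, 2 Re (z conj(z - a)) <= |z - a|^2 is exactly |z|^2 <= |a|^2. *)
have h : N z ^+ 2 <= N a ^+ 2 by rewrite ler_sqr ?nnegrE ?Nge0 // (le_trans z1).
move: h; rewrite !N_sqr; case: (z) (a) => [x y] [u v] /=; nra.
Qed.

(** All roots have modulus at least 1, so |P(0)| is the modulus of the leading coefficient times a
    product of factors >= 1. The coefficient at n is either the leading one or 0. *)
Lemma top_coef_le n P : (size P <= n.+1)%N -> (forall w, N w < 1 -> P.[w] != 0) ->
  N P`_n <= N P`_0.
Proof.
move=> sP Pn0; have [s defP] := closed_field_poly_normal P.
have P0 : P != 0.
  by apply/eqP => P0; have := Pn0 0; rewrite P0 horner0 N0 eqxx ltr01 => /(_ isT).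
have s_out a : a \in s -> 1 <= N a.
  move=> a_s; rewrite leNgt; apply/negP => /Pn0; rewrite defP hornerZ.
  rewrite horner_prod (perm_big _ (perm_to_rem a_s)) big_cons /= hornerXsubC subrr mul0r mulr0.
  by rewrite eqxx.
have -> : N P`_0 = N (lead_coef P) * \prod_(a <- s) N a.
  rewrite -horner_coef0 {1}defP hornerZ NM horner_prod N_prod; congr (_ * _).
  by apply: eq_bigr => a _; rewrite hornerXsubC sub0r NN.
apply: (@le_trans _ _ (N (lead_coef P))).
  rewrite lead_coefE; move: sP; rewrite leq_eqVlt => /orP[/eqP -> //|sP].
  by rewrite nth_default ?N0 ?Nge0.
rewrite ler_peMr ?Nge0 //.
elim: s s_out {defP} => [|a s IH] s_out; first by rewrite big_nil.
rewrite big_cons mulr_ege1 //; first by rewrite s_out ?mem_head.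
by apply: IH => b bs; apply: s_out; rewrite in_cons bs orbT.
Qed.

(** A formal leading coefficient: [c] may be 0, so the notion is stable under sums with cancellation
    and under products, which [lead_coef] is not. *)
Definition top n f c := (size f <= n.+1)%N /\ f`_n = c.

Lemma topM m n f g c d : top m f c -> top n g d -> top (m + n) (f * g) (c * d).
Proof.
move=> [sf fm] [sg gn]; split.
  apply: leq_trans (size_polyMleq _ _) _.
  by have := leq_add sf sg; rewrite addnS addSn; case: (_ + _)%N.
rewrite coefM (bigD1 (inord m)) //= inordK ?ltnS ?leq_addr //.
rewrite addKn fm gn big1 ?addr0 // => i im.
have [im'|im'|mi] := ltngtP i m.
- rewrite [g`_ _]nth_default ?mulr0 //; apply: leq_trans sg _; lia.
- by rewrite nth_default ?mul0r //; apply: leq_trans sf _.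
- by case/eqP: im; apply/val_inj; rewrite /= inordK ?ltnS ?leq_addr.
Qed.

Lemma topX n f c k : top n f c -> top (n * k) (f ^+ k) (c ^+ k).
Proof.
move=> t; elim: k => [|k IH]; last by rewrite mulnS !exprS; exact: topM.
by rewrite muln0 !expr0; split; rewrite ?size_poly1 // coef1.
Qed.

Lemma topZ n f c a : top n f c -> top n (a *: f) (a * c).
Proof. by move=> [sf <-]; split; rewrite ?coefZ // (leq_trans (size_scale_leq _ _)). Qed.

Lemma top_sum n (I : finType) (F : I -> {poly C}) c :
  (forall i, top n (F i) (c i)) -> top n (\sum_i F i) (\sum_i c i).
Proof.
move=> H; split; last by rewrite coef_sum; apply: eq_bigr => i _; case: (H i).
apply: (leq_trans (size_sum _ _ _)); apply/bigmax_leqP => i _; by case: (H i).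
Qed.

End OneVariable.

Section Reflection.
Variable R : realType.
Local Notation C := (R[i]).
Local Notation N := (@ComplexField.Normc.normc R).
Implicit Types (p q : {poly {poly C}}).

Lemma horner2_sum p (x y : C) :
  p.[x, y] = \sum_(i < size p) \sum_(j < sizeY p) p`_i`_j * (x ^+ i * y ^+ j).
Proof.
rewrite [p.[_]]horner_coef horner_sum; apply: eq_bigr => i _.
rewrite -!polyC_exp !hornerM !hornerC (@horner_coef_wide _ (sizeY p) p`_i) ?max_size_coefXY //.
by rewrite mulr_suml; apply: eq_bigr => j _; rewrite mulrAC mulrA.
Qed.

(** Unlike [reflection_horner] this form allows x = 0 or y = 0. It is the shape in which the
    conjugate of p~(x, y) appears as a formal top coefficient in [reflection_le]. *)
Lemma reflection_conj p (x y : C) : ((reflection p).[x, y])^* =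
  \sum_(i < size p) \sum_(j < sizeY p)
     p`_i`_j * (x^* ^+ ((size p).-1 - i) * y^* ^+ ((sizeY p).-1 - j)).
Proof.
rewrite /reflection horner_poly horner_sum rmorph_sum (reindex_inj rev_ord_inj) /=.
apply: eq_bigr => i _.
rewrite -!polyC_exp !hornerM !hornerC horner_poly (reindex_inj rev_ord_inj) /=.
rewrite mulr_suml rmorph_sum; apply: eq_bigr => j _.
have rev_sub n (k : 'I_n) : (n.-1 - (n - k.+1) = k)%N.
  by case: n k => [[]|n] // k; rewrite subSS subKn // leq_ord.
have rev_sub' n (k : 'I_n) : (n - k.+1 = n.-1 - k)%N by case: n k => [[]|n].
rewrite !rev_sub !rev_sub' /= !conjM !conjX conjCK.
by rewrite -mulrA [X in _ * X]mulrC.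
Qed.

(** Both claims rest on the identity |1 + conj(a) w|^2 - |w + a|^2 = (1 - |a|^2)(1 - |w|^2). *)
Lemma disk_automorphism (a w : C) : N a < 1 -> N w < 1 ->
  1 + a^* * w != 0 /\ N ((w + a) / (1 + a^* * w)) < 1.
Proof.
move=> a1 w1.
have d0 : 1 + a^* * w != 0.
  rewrite -N_gt0 (lt_le_trans _ (NDge _ _)) // N1 NM Nconj subr_gt0.
  by rewrite (le_lt_trans _ a1) // ler_piMr ?Nge0 // ltW.
split=> //; rewrite Nf ltr_pdivrMr ?N_gt0 // mul1r.
rewrite -ltr_sqr ?nnegrE ?Nge0 // -subr_gt0.
have -> : N (1 + a^* * w) ^+ 2 - N (w + a) ^+ 2 = (1 - N a ^+ 2) * (1 - N w ^+ 2).
  by rewrite !N_sqr; case: (a) (w) => [a1' a2] [b1 b2] /=; ring.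
by rewrite mulr_gt0 // subr_gt0 exprn_ilt1 ?Nge0.
Qed.

(* The polynomial below is p evaluated along the disk automorphisms
   w |-> (w + x) / (1 + x^* w) and w |-> (w + y) / (1 + y^* w), with the
   denominators cleared.  It has no zeros in the disk, its value at 0 is p(x, y)
   and its top coefficient is the conjugate of p~(x, y). *)
Lemma reflection_le p (x y : C) : (forall z, bidisk z -> p.[z.1, z.2] <> 0) ->
  N x < 1 -> N y < 1 -> N (reflection p).[x, y] <= N p.[x, y].
Proof.
move=> p0 x1 y1.
pose n1 := (size p).-1; pose n2 := (sizeY p).-1.
pose A (a : C) (n i : nat) : {poly C} :=
  ('X + a%:P) ^+ i * (1 + a^* *: 'X) ^+ (n - i).
pose P : {poly C} := \sum_(i < size p) \sum_(j < sizeY p)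
   p`_i`_j *: (A x n1 i * A y n2 j).
have topA a n i : (i <= n)%N -> top n (A a n i) (a^* ^+ (n - i)).
  move=> le_in.
  have t1 : top 1 ('X + a%:P) 1.
    by split; rewrite ?size_XaddC // coefD coefX coefC /= addr0.
  have t2 : top 1 (1 + a^* *: 'X) a^*.
    split; last by rewrite coefD coefZ coefX coef1 /= add0r mulr1.
    rewrite -polyC1 addrC; apply: leq_trans (size_polyD _ _) _.
    by rewrite geq_max (leq_trans (size_scale_leq _ _)) ?size_polyX // size_polyC; case: eqP.
  by have := topM (topX i t1) (topX (n - i) t2); rewrite !mul1n subnKC // expr1n mul1r.
have le1 (i : 'I_(size p)) : (i <= n1)%N.
  by rewrite /n1; case: (size p) i => [[]|] // n i; rewrite -ltnS.
have le2 (i : 'I_(sizeY p)) : (i <= n2)%N.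
  by rewrite /n2; case: (sizeY p) i => [[]|] // n i; rewrite -ltnS.
have topP : top (n1 + n2) P ((reflection p).[x, y])^*.
  rewrite reflection_conj; do 2!(apply: top_sum => ?); apply: topZ.
  by apply: topM; apply: topA.
have P0 : P`_0 = p.[x, y].
  rewrite -horner_coef0 horner2_sum horner_sum; apply: eq_bigr => i _.
  rewrite horner_sum; apply: eq_bigr => j _.
  by rewrite hornerZ !hornerM !horner_exp !hornerE /= !expr1n !mulr1.
have [sP tP] := topP.
rewrite -[N (reflection p).[x, y]]Nconj -tP -P0; apply: top_coef_le sP _ => w w1.
have [dx0 Mx] := disk_automorphism x1 w1; have [dy0 My] := disk_automorphism y1 w1.
have evA a i n : (i <= n)%N -> 1 + a^* * w != 0 ->
    (A a n i).[w] = (1 + a^* * w) ^+ n * ((w + a) / (1 + a^* * w)) ^+ i.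
  move=> le_in d0; rewrite hornerM !horner_exp !hornerE expr_div_n.
  by rewrite mulrCA expfB_cond ?(negPf d0) // mulrC; congr (_ * _).
have -> : P.[w] = (1 + x^* * w) ^+ n1 * (1 + y^* * w) ^+ n2 *
    p.[(w + x) / (1 + x^* * w), (w + y) / (1 + y^* * w)].
  rewrite horner2_sum mulr_sumr horner_sum; apply: eq_bigr => i _.
  rewrite mulr_sumr horner_sum; apply: eq_bigr => j _.
  rewrite hornerZ hornerM evA ?le1 // evA ?le2 // [X in _ * X = _]mulrACA.
  by rewrite [LHS]mulrCA.
rewrite !mulf_neq0 ?expf_neq0 //; apply/eqP.
apply: (p0 ((w + x) / (1 + x^* * w), (w + y) / (1 + y^* * w))).
by split; rewrite norm_lt1.
Qed.

(** The quotient f has no boundary values a priori, so the inequality |q| <= |p| is taken at the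
    shrunken point ((1 - s) x, (1 - s) y) and carried to (x, y) by the Lipschitz bounds of p and q;
    [s] is chosen so that the total error is at most [e]. *)
Lemma schur_le_torus p q : quotient_is_rational_schur q p ->
  forall x y : C, N x <= 1 -> N y <= 1 -> N q.[x, y] <= N p.[x, y].
Proof.
case=> _ [f [fpq _ f1]] x y x1 y1.
have [L L0 HL] := poly2_lip 1 p; have [M M0 HM] := poly2_lip 1 q.
apply/ler_addgt0Pr => e e0.
pose s := Num.min (1 / 2) (e / (2 * (L + M))).
have s0 : 0 < s by rewrite lt_min; apply/andP; split; rewrite divr_gt0 // ?mulr_gt0 ?addr_gt0.
have s1 : s <= 1 / 2 by rewrite ge_min lexx.
have se : s * (2 * (L + M)) <= e by rewrite -ler_pdivlMr ?mulr_gt0 ?addr_gt0 // ge_min lexx orbT.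
pose c : C := ((1 - s)%:C)%C.
have Nc : N c = 1 - s by rewrite Nreal ger0_norm; lra.
have inD z : N z <= 1 -> N (c * z) < 1.
  by move=> z1; rewrite NM Nc; have := Nge0 z; nra.
have close z : N z <= 1 -> N (z - c * z) <= s.
  move=> z1; rewrite -{1}[z]mul1r -mulrBl NM -(rmorph1 (real_complex R)) -rmorphB Nreal.
  rewrite opprB addrC subrK ger0_norm; last exact: ltW.
  by rewrite ler_piMr // ltW.
have bd : bidisk (c * x, c * y) by split; rewrite /= norm_lt1 inD.
have qp : N q.[c * x, c * y] <= N p.[c * x, c * y].
  rewrite -(fpq _ bd) NM ler_piMl ?Nge0 //; have := f1 _ bd; by rewrite norm_le1.
have hq := HM x y (c * x) (c * y) x1 y1 (ltW (inD _ x1)) (ltW (inD _ y1)).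
have hp := HL x y (c * x) (c * y) x1 y1 (ltW (inD _ x1)) (ltW (inD _ y1)).
have t1 := NBge q.[x, y] q.[c * x, c * y].
have t2 := NBge p.[c * x, c * y] p.[x, y]; rewrite NBC in t2.
have cx := close _ x1; have cy := close _ y1.
have : M * (N (x - c * x) + N (y - c * y)) <= M * (2 * s) by apply: ler_wpM2l; [exact: ltW|lra].
have : L * (N (x - c * x) + N (y - c * y)) <= L * (2 * s) by apply: ler_wpM2l; [exact: ltW|lra].
lra.
Qed.

End Reflection.

Section Expi.
Variable R : realType.
Local Notation C := (R[i]).
Local Notation N := (@ComplexField.Normc.normc R).

Lemma N_expi (t : R) : N (expi t) = 1.
Proof. by rewrite /= cos2Dsin2 sqrtr1. Qed.

Lemma expiD (s t : R) : expi (s + t) = expi s * expi t :> C.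
Proof.
by apply/eqP; rewrite eq_complex /= cosD sinD eqxx /= addrC [cos s * _]mulrC.
Qed.

Lemma expi0 : expi 0 = 1 :> C.
Proof. by apply/eqP; rewrite eq_complex /= cos0 sin0 !eqxx. Qed.

Lemma expiX (t : R) n : expi t ^+ n = expi (t *+ n) :> C.
Proof. by elim: n => [|n IH]; rewrite ?expi0 // exprS mulrS expiD IH. Qed.

Lemma expiN (t : R) : expi (- t) = (expi t)^* :> C.
Proof. by apply/eqP; rewrite eq_complex /= cosN sinN !eqxx. Qed.

(* For k >= 2 the map w |-> w^k wraps the right half of the circle around every
   closed half plane. *)
Lemma half_plane_power (mu : C) k : (1 < k)%N ->
  (forall w : C, N w = 1 -> 0 < complex.Re w -> complex.Re (mu * (w ^+ k)^*) <= 0) ->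
  mu = 0.
Proof.
(* The test points are 1 and exp(i b/k), exp(-i b/k) with b = 3 pi/4. Since k >= 2, b/k < pi/2,
   while cos b < 0; the three inequalities m1 <= 0 and m1 cos b +- m2 sin b <= 0 then force m1 = m2
   = 0. *)
move=> k1 H; pose b : R := pi - pi / 4.
have pi0 := pi_gt0 R.
have cb : cos b < 0.
  by rewrite /b addrC cosDpi cosN oppr_lt0 cos_gt0_pihalf //; lra.
have sb : 0 < sin b by apply: sin_gt0_pi; rewrite /b; apply/andP; split; lra.
have k0 : k%:R != 0 :> R by rewrite pnatr_eq0 -lt0n ltnW.
have cbk : 0 < cos (b / k%:R).
  have k2 : 2 <= k%:R :> R by rewrite ler_nat.
  apply: cos_gt0_pihalf; rewrite ltr_pdivrMr ?ltr_pdivlMr; try lra.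
  by rewrite /b; apply/andP; split; nra.
have bk : b / k%:R *+ k = b by rewrite -mulr_natr divfK.
have h1 := H 1 (@N1 R) ltr01; rewrite expr1n rmorph1 mulr1 in h1.
have h2 := H _ (N_expi _) cbk; rewrite expiX bk in h2.
have := H (expi (- (b / k%:R))) (N_expi _); rewrite [X in 0 < X]cosN => /(_ cbk).
rewrite expiX mulNrn bk expiN conjCK => h3.
case: mu h1 h2 h3 {H} => m1 m2 /= h1 h2 h3.
have m10 : m1 = 0 by nra.
have m20 : m2 = 0 by nra.
by apply/eqP; rewrite eq_complex /= m10 m20 eqxx.
Qed.

End Expi.

(** * Both partial derivatives at a boundary zero *)

Section Gradient.
Variable R : realType.
Local Notation C := (R[i]).
Local Notation N := (@ComplexField.Normc.normc R).
Implicit Types (p q : {poly {poly C}}).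

Lemma deriv_slice1 p (x : C) : ((swapXY p).[x%:P])^`() = (swapXY p^`()).[x%:P].
Proof. by rewrite !horner_swapXY deriv_map. Qed.

Lemma deriv_slice2 p (x : C) : (p.[x%:P])^`() = (map_poly (@deriv C) p).[x%:P].
Proof.
elim/poly_ind: p => [|p c IH]; first by rewrite map_poly0 !horner0 deriv0.
rewrite hornerMXaddC derivD derivM derivC mulr0 addr0 IH.
rewrite raddfD /= map_polyC /= hornerD hornerC; congr (_ + _).
rewrite (_ : map_poly _ (p * 'X) = map_poly (@deriv C) p * 'X) ?hornerMX //.
by apply/polyP => i; rewrite coefMX !coef_map /= coefMX; case: i => [|i]; rewrite ?deriv0 // coef_map.
Qed.

Lemma mixed_deriv10 p : mixed_deriv 1 0 p = p^`().
Proof. by rewrite /mixed_deriv derivn1; apply/polyP=> i; rewrite coef_map_id0 ?derivn0 //. Qed.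

Lemma mixed_deriv01 p : mixed_deriv 0 1 p = map_poly (@deriv C) p.
Proof.
rewrite /mixed_deriv derivn0; apply/polyP=> i.
by rewrite coef_map_id0 ?linear0 // coef_map derivn1.
Qed.

Lemma mixed_deriv00 p : mixed_deriv 0 0 p = p.
Proof. by rewrite /mixed_deriv derivn0; apply/polyP=> i; rewrite coef_map_id0 ?derivn0 //. Qed.

Lemma size_slice p (x : C) : (size (swapXY p).[x%:P] <= size p)%N.
Proof. by rewrite horner_swapXY map_polyE (leq_trans (size_Poly _)) // size_map. Qed.

(* If p(t1, .) vanished to order k >= 2 at t2, then Re_log_deriv for p(., t2 (1 - s w))
   at t1, as s -> 0, would give Re (mu conj(w^k)) <= 0 for all w in the right half of
   the circle, with mu != 0. *)
Lemma gradient_neq0 p (t1 t2 : C) : (forall z, bidisk z -> p.[z.1, z.2] <> 0) ->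
  N t1 = 1 -> N t2 = 1 -> p.[t1, t2] = 0 -> p.[t1%:P] != 0 ->
  p^`().[t1, t2] != 0 -> (p.[t1%:P])^`().[t2] != 0.
Proof.
move=> p0 t11 t21 pt f0 dp0; apply/negP => /eqP df0.
set f := p.[t1%:P] in f0 pt df0.
have [k [D Dt2 fE]] := multiplicity_XsubC f t2; rewrite f0 /= /root in Dt2.
have k1 : (1 < k)%N.
  move: fE; case: k => [|[|//]] fE.
    by move: pt Dt2; rewrite fE expr0 mulr1 => ->; rewrite eqxx.
  move: df0 Dt2; rewrite fE expr1 derivM derivXsubC mulr1 hornerD hornerM hornerXsubC.
  by rewrite subrr mulr0 add0r => ->; rewrite eqxx.
have k0 := ltnW k1.
have [L L0 HL] := poly2_lip 2 p^`(); have [M M0 HM] := poly_lip 2 D.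
have [B B0 HB] := poly2_bound 2 p^`(); have [E E0 HE] := poly_bound 2 D.
pose mu := t1 * p^`().[t1, t2] * D.[t2]^* * ((- t2) ^+ k)^*.
suff : mu = 0.
  move/eqP; rewrite !mulf_eq0 !fmorph_eq0 expf_eq0 oppr_eq0 (negPf dp0) (negPf Dt2) orbF.
  by rewrite -!N_eq0 t11 t21 oner_eq0 andbF.
apply: (half_plane_power k1) => w w1 Rw.
apply/ler_addgt0Pr => e e0; rewrite add0r.
pose S : R := (size p)%:R.
have S0 : 0 <= S by rewrite ler0n.
pose c := S * E ^+ 2 + L * E + B * M.
have c0 : 0 < c by rewrite ltr_wpDl ?mulr_gt0 // addr_ge0 ?mulr_ge0 ?exprn_ge0 // ltW.
(* [s <= Re w] puts t2 (1 - s w) inside the disk, since |1 - s w|^2 = 1 - 2 s Re w + s^2;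
   [s <= e / c] makes the collected errors at most [e]. *)
pose s := Num.min 1 (Num.min (complex.Re w) (e / c)).
have s0 : 0 < s by rewrite !lt_min ltr01 Rw divr_gt0.
have s00 := ltW s0.
have s1 : s <= 1 by rewrite ge_min lexx.
have sw : s <= complex.Re w by rewrite !ge_min lexx orbT.
have sc : s * c <= e by rewrite -ler_pdivlMr // !ge_min lexx !orbT.
pose sC : C := (s%:C)%C.
have NsC : N sC = s by rewrite Nreal ger0_norm // ltW.
have {p0} p0 (z2 : C) : N z2 < 1 -> forall v : C, N v < 1 -> (swapXY p).[z2, v] != 0.
  move=> z21 v v1; rewrite horner2_swapXY; apply/eqP.
  by apply: (p0 (v, z2)); split; rewrite /= norm_lt1.
pose z2 := t2 * (1 - sC * w).
have dz : z2 - t2 = - t2 * (sC * w) by rewrite /z2; ring.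
have Ndz : N (z2 - t2) = s by rewrite dz !NM NN t21 NsC w1 mulr1 mul1r.
have z21 : N z2 < 1.
  rewrite NM t21 mul1r -(@ltr_pXn2r _ 2) ?nnegrE ?Nge0 ?ler01 // expr1n.
  have -> : N (1 - sC * w) ^+ 2 = 1 - 2 * s * complex.Re w + s ^+ 2 * N w ^+ 2.
    by rewrite !N_sqr; case: (w) => a b /=; ring.
  by rewrite w1 expr1n mulr1; nra.
have t1le : N t1 <= 1 by rewrite t11.
have {p0} := Re_log_deriv (p0 _ z21) t1le.
rewrite deriv_slice1 !horner2_swapXY.
set A := p^`().[t1, z2].
have -> : p.[t1, z2] = D.[z2] * ((- t2) ^+ k * w ^+ k) * sC ^+ k.
  by rewrite -/f fE hornerM horner_exp hornerXsubC dz !exprMn; ring.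
have -> : N (D.[z2] * ((- t2) ^+ k * w ^+ k) * sC ^+ k) = N D.[z2] * s ^+ k.
  by rewrite !NM !NX NN t21 w1 NsC expr1n !mulr1.
(* [nu] is mu conj(w^k) with p_x and D taken at z2 instead of t2. In [Re_log_deriv] the left side
   carries s^k and the right side s^(2k); dividing by s^k leaves 2 Re nu = O(s), and nu differs from
   mu conj(w^k) by O(s) as well. *)
pose nu := t1 * A * D.[z2]^* * ((- t2) ^+ k)^* * (w ^+ k)^*.
have -> : t1 * A * (D.[z2] * ((- t2) ^+ k * w ^+ k) * sC ^+ k)^* = ((s ^+ k)%:C)%C * nu.
  rewrite !conjM [(sC ^+ k)^*](_ : _ = ((s ^+ k)%:C)%C); last first.
    by rewrite conjX rmorphXn; congr (_ ^+ _); apply/eqP; rewrite eq_complex /= oppr0 !eqxx.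
  by rewrite /nu; ring.
rewrite ReZ => H.
have z22 : N z2 <= 2 by lra.
have t12 : N t1 <= 2 by rewrite t11; lra.
have t22 : N t2 <= 2 by rewrite t21; lra.
have DE : N D.[z2] <= E by apply: HE.
have D0E : N D.[t2] <= E by apply: HE.
have AB : N A <= B by apply: HB.
have sk0 : 0 < s ^+ k by rewrite exprn_gt0.
have sk : s ^+ k <= s by rewrite ler_iXnr // ltW.
have szk : (size (swapXY p).[z2%:P])%:R <= S by rewrite ler_nat size_slice.
have {H} Hnu : 2 * complex.Re nu <= S * E ^+ 2 * s.
  rewrite -(ler_pM2l sk0) mulrCA; apply: le_trans H _.
  rewrite exprMn mulrA [X in _ <= X](_ : _ = S * E ^+ 2 * (s ^+ k * s)); last by ring.
  apply: ler_pM; rewrite ?mulr_ge0 ?exprn_ge0 ?ler0n ?Nge0 //.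
    by apply: ler_pM; rewrite ?exprn_ge0 ?ler0n ?Nge0 // lerXn2r ?nnegrE ?Nge0 // (le_trans (Nge0 _) DE).
  by rewrite expr2 ler_wpM2l // ltW.
have Hmu : N (mu * (w ^+ k)^* - nu) <= (L * E + B * M) * s.
  rewrite (_ : _ - _ = t1 * ((p^`().[t1, t2] - A) * D.[t2]^* + A * (D.[t2] - D.[z2])^*)
      * ((- t2) ^+ k)^* * (w ^+ k)^*); last by rewrite rmorphB /= /mu /nu; ring.
  rewrite !NM !Nconj !NX NN t11 t21 w1 expr1n !mulr1 mul1r (le_trans (ND _ _)) //.
  rewrite !NM !Nconj mulrDl; apply: lerD.
    rewrite mulrAC ler_pM ?Nge0 //.
    by apply: (le_trans (HL _ _ _ _ _ _ _ _)); rewrite // subrr N0 add0r NBC Ndz.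
  rewrite -mulrA ler_pM ?Nge0 //; by apply: (le_trans (HM _ _ _ _)); rewrite // NBC Ndz.
have := Re_le (mu * (w ^+ k)^* - nu); rewrite ReB.
move: Hnu Hmu sc; rewrite /c !mulrDl; have : 0 <= S * E ^+ 2 * s by rewrite !mulr_ge0 ?exprn_ge0 // ltW.
by lra.
Qed.

Lemma gradient_neq0_swap p (t1 t2 : C) : (forall z, bidisk z -> p.[z.1, z.2] <> 0) ->
  N t1 = 1 -> N t2 = 1 -> p.[t1, t2] = 0 -> (swapXY p).[t2%:P] != 0 ->
  (p.[t1%:P])^`().[t2] != 0 -> p^`().[t1, t2] != 0.
Proof.
move=> p0 t11 t21 pt f0 dp0.
have := @gradient_neq0 (swapXY p) t2 t1 _ t21 t11; rewrite horner2_swapXY deriv_slice1.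
rewrite horner2_swapXY; apply=> //.
  by move=> z [z1 z2]; rewrite horner2_swapXY; apply: (p0 (z.2, z.1)).
by rewrite -(swapXYK p) deriv_slice1 horner2_swapXY in dp0.
Qed.

End Gradient.

(** * The zero set near a boundary zero *)

Section NormalForm.
Variable R : realType.
Local Notation C := (R[i]).
Local Notation N := (@ComplexField.Normc.normc R).
Implicit Types (p q f : {poly {poly C}}) (a b u : {poly C}).

Lemma horner_horner f a (x : C) : f.[a].[x] = f.[a.[x], x].
Proof.
elim/poly_ind: f => [|f c IH]; first by rewrite !horner0.
by rewrite !hornerMXaddC !hornerD !hornerM IH hornerC.
Qed.

Lemma horner_lift a (x y : C) : (map_poly polyC a).[x, y] = a.[x].
Proof. by rewrite horner_map /= hornerC. Qed.

Lemma taylor2 (S : comNzRingType) (f : {poly S}) (x d : S) :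
  exists r, f.[x + d] = f.[x] + f^`().[x] * d + d ^+ 2 * r.
Proof.
elim/poly_ind: f => [|f c [r IH]].
  by exists 0; rewrite deriv0 !horner0 mul0r mulr0 !addr0.
exists (r * (x + d) + f^`().[x]).
rewrite derivD derivM derivX derivC mulr1 addr0 !hornerMXaddC hornerD hornerMX IH.
ring.
Qed.

(** Each correction by c (X - t1)^(n+1), with c = - s(t1) / f_y(t1, t2), kills the leading error
    term. The outer variable of [f] is the one solved for, so this acts as an implicit function
    theorem to finite order whose solution is a polynomial. *)
Lemma newton f (t1 t2 : C) n : f.[t2, t1] = 0 -> f^`().[t2, t1] != 0 ->
  exists a s, a.[t1] = t2 /\ f.[a] = ('X - t1%:P) ^+ n.+1 * s.
Proof.
move=> f0 df0; elim: n => [|n [a [s [at1 fa]]]].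
  exists t2%:P; have /factor_theorem[s ->] : root f.[t2%:P] t1 by rewrite /root f0.
  by exists s; rewrite hornerC expr1 mulrC.
pose c := - s.[t1] / f^`().[t2, t1]; set H := 'X - t1%:P in fa *.
have [r fr] := taylor2 f a (c%:P * H ^+ n.+1).
have /factor_theorem[v vE] : root (s + f^`().[a] * c%:P) t1.
  by rewrite /root hornerD hornerM horner_horner at1 hornerC mulrC divfK // subrr.
exists (a + c%:P * H ^+ n.+1), (v + c%:P ^+ 2 * H ^+ n * r); split.
  by rewrite hornerD hornerM horner_exp hornerXsubC subrr expr0n mulr0 addr0.
rewrite {}fr fa; rewrite -/H in vE.
rewrite [LHS](_ : _ = H ^+ n.+1 * (s + f^`().[a] * c%:P) +
   c%:P ^+ 2 * (H ^+ n.+1 * H ^+ n.+1) * r); last by ring.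
by rewrite vE !exprS; ring.
Qed.

(** Division by y - a(x), which is monic in y: over C[x], the polynomial [swapXY p] minus its value
    at [a] has the root [a]. *)
Lemma poly2_division p a : exists q,
  p = map_poly polyC (swapXY p).[a] + ('Y - map_poly polyC a) * q.
Proof.
have /factor_theorem[q qE] : root (swapXY p - (swapXY p).[a]%:P) a.
  by rewrite /root hornerD hornerN hornerC subrr.
exists (swapXY q); rewrite -{1}(swapXYK p) -{1}(subrK (swapXY p).[a]%:P (swapXY p)) qE.
by rewrite rmorphD rmorphM rmorphB /= !swapXY_polyC swapXY_X addrC mulrC.
Qed.

Lemma poly2_division_horner p a q : p = map_poly polyC (swapXY p).[a] + ('Y - map_poly polyC a) * q ->
  forall x y : C, p.[x, y] = (swapXY p).[a].[x] + (y - a.[x]) * q.[x, y].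
Proof.
move=> E x y; rewrite {1}E !hornerD !hornerM !horner_lift !hornerD !hornerN !horner_lift.
by rewrite !hornerC hornerX.
Qed.

Lemma poly2_lower f (t1 t2 : C) : N t1 = 1 -> N t2 = 1 -> f.[t1, t2] != 0 ->
  exists d c : R, [/\ 0 < d <= 1, 0 < c &
    forall x y, N (x - t1) < d -> N (y - t2) < d -> c <= N f.[x, y]].
Proof.
move=> t11 t21 f0; have [L L0 HL] := poly2_lip 2 f.
set A := N f.[t1, t2]; have A0 : 0 < A by rewrite N_gt0.
pose d := Num.min 1 (A / (4 * L)).
have d1 : d <= 1 by rewrite ge_min lexx.
have d0 : 0 < d by rewrite lt_min ltr01 divr_gt0 ?mulr_gt0.
have dA : d * (4 * L) <= A by rewrite -ler_pdivlMr ?mulr_gt0 // ge_min lexx orbT.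
exists d, (A / 2); split; rewrite ?d0 ?divr_gt0 // => x y xd yd.
have x2 : N x <= 2 by have := NBge x t1; lra.
have y2 : N y <= 2 by have := NBge y t2; lra.
have t12 : N t1 <= 2 by lra.
have t22 : N t2 <= 2 by lra.
have h := HL _ _ _ _ x2 y2 t12 t22; have := NBge f.[t1, t2] f.[x, y].
rewrite NBC -/A.
have : L * (N (x - t1) + N (y - t2)) <= L * (d + d).
  by apply: ler_wpM2l; [exact: ltW|lra].
lra.
Qed.

(** The quotient v / conj v of v = 1 + i s lies on the circle, and its distance to 1 is 2 s / |v|,
    which is positive and at most 2 s. It supplies points t1 w of the circle at which asymptotic
    estimates can be contradicted. *)
Lemma unit_near1 (d : R) : 0 < d -> exists w : C, [/\ N w = 1, w != 1 & N (w - 1) < d].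
Proof.
move=> d0; pose s := d / 4.
have s0 : 0 < s by rewrite divr_gt0.
pose v : C := Complex 1 s.
have v1 : 1 <= N v.
  rewrite /= expr1n -[X in X <= _]sqrtr1 ler_sqrt ?addr_ge0 ?sqr_ge0 // ?ler01 //.
  by rewrite lerDl sqr_ge0.
have v0 : v != 0 by rewrite -N_gt0 (lt_le_trans ltr01).
have vB : v - v^* = Complex 0 (s + s).
  by apply/eqP; rewrite eq_complex /= opprK subrr !eqxx.
have cv0 : v^* != 0 by rewrite fmorph_eq0.
have wB : v / v^* - 1 = (v - v^*) / v^* by rewrite mulrBl divff.
exists (v / v^*); split.
- by rewrite Nf Nconj divff ?N_eq0.
- rewrite -subr_eq0 wB mulf_neq0 ?invr_eq0 // vB eq_complex /= eqxx /=.
  by rewrite gt_eqF ?addr_gt0.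
- rewrite wB Nf Nconj vB ltr_pdivrMr ?N_gt0 //.
  have -> : N (Complex 0 (s + s)) = s + s.
    by rewrite /= expr0n /= add0r sqrtr_sqr ger0_norm // addr_ge0 ?ltW.
  have : d * 1 <= d * N v by rewrite ler_pM2l.
  by rewrite /s; lra.
Qed.

End NormalForm.

(** * Consequences of the contact order *)

Section Contact.
Variable R : realType.
Local Notation C := (R[i]).
Local Notation N := (@ComplexField.Normc.normc R).
Variables (p : {poly {poly C}}) (t1 t2 : C) (K : nat).
Hypotheses (t11 : N t1 = 1) (t21 : N t2 = 1) (pt : p.[t1, t2] = 0).
Hypothesis Kp : is_contact_order p (t1, t2) K.

Lemma reflection_eq0 (x y : C) : N x = 1 -> y != 0 ->
  (reflection p).[x, y] = 0 <-> p.[x, 1 / y^*] = 0.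
Proof.
move=> x1 y0; have x0 : x != 0 by rewrite -N_gt0 x1.
rewrite reflection_horner // (conj_unit x1) div1r invrK; split => [|->]; last first.
  by rewrite rmorph0 mulr0.
by move/eqP; rewrite !mulf_eq0 !expf_eq0 (negPf x0) (negPf y0) !andbF /= fmorph_eq0 => /eqP.
Qed.

Lemma inv_conj_unit (y : C) : N y = 1 -> 1 / y^* = y.
Proof. by move=> y1; rewrite conj_unit // div1r invrK. Qed.

(** With K = 0 the gap over z1 = t1 would be at least a > 0, because 0^0 = 1; but t2 itself is a
    zero of p~ there, with 1 - |t2| = 0. *)
Lemma contact_gt0 : (0 < K)%N.
Proof.
have [r0 r00 /(_ r0)] := Kp; rewrite r00 lexx => /(_ isT) [d [a [b [d0 a0 b0 H]]]].
have [||H1 _] := H t1; [exact/norm_eq1|by rewrite subrr N0|].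
rewrite lt0n; apply/eqP => K0; move: H1; rewrite K0 expr0 mulr1 => H1.
have : ((1 - N t2)%:E >= fiber_gap p (t1, t2) r0 t1)%E.
  apply: ereal_inf_lbound; exists t2 => //; split; last by rewrite /= subrr N0.
  by apply/reflection_eq0; rewrite // ?inv_conj_unit // -N_gt0 t21.
by move/(le_trans H1); rewrite t21 subrr lee_fin leNgt a0.
Qed.

(** If p(t1, y) vanished for all y, then p~ would vanish at points of modulus > 1 next to t2 and the
    gap over t1 would be negative, against the lower bound a 0^K = 0. *)
Lemma contact_fiber1 : p.[t1%:P] != 0.
Proof.
apply/eqP => p0.
have [r0 r00 /(_ r0)] := Kp; rewrite r00 lexx => /(_ isT) [d [a [b [d0 a0 b0 H]]]].
have [||H1 _] := H t1; [exact/norm_eq1|by rewrite subrr N0|].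
pose y : C := t2 * ((1 + r0 / 2)%:C)%C.
have Ny : N y = 1 + r0 / 2 by rewrite NM t21 mul1r Nreal ger0_norm // addr_ge0 ?divr_ge0 // ltW.
have : ((1 - N y)%:E >= fiber_gap p (t1, t2) r0 t1)%E.
  apply: ereal_inf_lbound; exists y => //; split.
    by apply/reflection_eq0; rewrite ?p0 ?horner0 // -N_gt0 Ny; lra.
  rewrite /= /y -[X in _ - X]mulr1 -mulrBr NM t21 mul1r -[X in _ - X](rmorph1 (real_complex R)).
  by rewrite -rmorphB Nreal addrC addKr ger0_norm; lra.
move/(le_trans H1); rewrite lee_fin subrr N0 expr0n -leqn0 leqNgt contact_gt0 /= mulr0 Ny.
by lra.
Qed.

(** If p(x, t2) vanished for all x, then the gap would be at most 1 - |t2| = 0 at points x <> t1 of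
    the circle, where it must be positive. *)
Lemma contact_fiber2 : (swapXY p).[t2%:P] != 0.
Proof.
apply/eqP => p0.
have [r0 r00 /(_ r0)] := Kp; rewrite r00 lexx => /(_ isT) [d [a [b [d0 a0 b0 H]]]].
have [w [w1 wn1 wd]] := unit_near1 d0.
have E : t1 * w - t1 = t1 * (w - 1) by ring.
have [||H1 _] := H (t1 * w).
- by apply/norm_eq1; rewrite NM t11 w1 mulr1.
- by rewrite E NM t11 mul1r.
have : ((1 - N t2)%:E >= fiber_gap p (t1, t2) r0 (t1 * w)%R)%E.
  apply: ereal_inf_lbound; exists t2 => //; split; last by rewrite /= subrr N0.
  apply/reflection_eq0; rewrite ?NM ?t11 ?w1 ?mulr1 // ?inv_conj_unit -?N_gt0 ?t21 //.
  by rewrite -horner2_swapXY p0 horner0.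
move/(le_trans H1); rewrite lee_fin t21 subrr leNgt mulr_gt0 // exprn_gt0 //.
by rewrite E NM t11 mul1r N_gt0 subr_eq0.
Qed.

(** A zero y of p~ that nearly attains the infimum is reflected to the zero 1/conj(y) of p, which
    turns 1 - |y| into (1 - |y|) / |y|. *)
Lemma contact_root (e : R) : 0 < e -> exists d a b : R, [/\ 0 < d, 0 < a, 0 < b &
  forall x, N x = 1 -> 0 < N (x - t1) < d -> exists y, [/\ p.[x, y] = 0, N (y - t2) < e,
     a * N (x - t1) ^+ K <= N y - 1 & N y - 1 <= b * N (x - t1) ^+ K]].
Proof.
move=> e0; have [r0 r00] := Kp.
(* [r <= 1/2] keeps |y| >= 1/2, so that reflection at most doubles the distance to t2; [r <= e/2]
   compensates for this. *)
pose r := Num.min r0 (Num.min (1 / 2) (e / 2)).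
have rr0 : 0 < r <= r0 by rewrite ge_min lexx !lt_min r00 !divr_gt0.
have r12 : r <= 1 / 2 by rewrite !ge_min lexx orbT.
have re : r <= e / 2 by rewrite !ge_min lexx !orbT.
move=> /(_ _ rr0) [d [a [b [d0 a0 b0 H]]]].
(* One factor 2 pays for an infimum that need not be attained, the other for 1/|y| <= 2. *)
exists d, a, (4 * b); split; rewrite ?mulr_gt0 // => x x1 /andP[x0 xd].
have [H1 H2] := H x (proj2 (norm_eq1 _) x1) xd.
have hK : 0 < N (x - t1) ^+ K by rewrite exprn_gt0.
have : (fiber_gap p (t1, t2) r x < (2 * b * N (x - t1) ^+ K)%:E)%E.
  by apply: (le_lt_trans H2); rewrite lte_fin ltr_pM2r // ltr_pMl // ltr1n.
move/ereal_inf_lt => [_ [y [ry yt] <-]]; rewrite lte_fin /= in yt * => yb.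
have ya : a * N (x - t1) ^+ K <= 1 - N y.
  rewrite -lee_fin; apply: (le_trans H1); apply: ereal_inf_lbound; by exists y.
have y1 : 1 / 2 <= N y by have := NBge t2 (t2 - y); rewrite subKr t21 NBC; lra.
have y0 : y != 0 by rewrite -N_gt0; lra.
have Ny0 : 0 < N y by rewrite N_gt0.
have aK : 0 < a * N (x - t1) ^+ K by rewrite mulr_gt0.
have t20 : t2 != 0 by rewrite -N_gt0 t21.
exists (1 / y^*); split.
- exact/reflection_eq0.
- rewrite -[X in _ - X](inv_conj_unit t21).
  have -> : 1 / y^* - 1 / t2^* = (t2 - y)^* / (y^* * t2^*).
    by rewrite rmorphB /=; field; rewrite !fmorph_eq0 y0 t20.
  rewrite Nf NM !Nconj t21 mulr1 ltr_pdivrMr //; rewrite NBC; nra.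
- rewrite Nf N1 Nconj lerBrDr ler_pdivlMr //; nra.
- rewrite Nf N1 Nconj lerBlDr ler_pdivrMr //.
  have : 0 < b * N (x - t1) ^+ K by rewrite mulr_gt0.
  nra.
Qed.

End Contact.

Section Curve.
Variable R : realType.
Local Notation C := (R[i]).
Local Notation N := (@ComplexField.Normc.normc R).
Implicit Types (p q f : {poly {poly C}}) (a b u : {poly C}).

(* The graph of [g] is tangent to the zero set of p at (t1, t2) to order 2 K,
   beyond the contact order, so that g may replace the true zero branch. *)
Definition branch p (t1 t2 : C) (K : nat) (g : {poly C}) : Prop :=
  [/\ g.[t1] = t2,
     exists s Q, [/\ (swapXY p).[g] = ('X - t1%:P) ^+ (2 * K) * s,
        p = map_poly polyC (swapXY p).[g] + ('Y - map_poly polyC g) * Q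
        & Q.[t1, t2] != 0],
      p^`().[t1, t2] != 0,
      (2 <= K)%N
    & exists d a b : R, [/\ 0 < d <= 1, 0 < a, 0 < b & forall x : C, N x = 1 ->
        0 < N (x - t1) < d ->
        [/\ a * N (x - t1) ^+ K <= N g.[x] - 1, N g.[x] - 1 <= b * N (x - t1) ^+ K
          & forall y : C, N y = 1 -> N (y - t2) < d ->
            a * N (y - g.[x]) <= N p.[x, y] /\ N p.[x, y] <= b * N (y - g.[x])]]].

(** Order 1 gives one nonzero partial derivative, and stability gives the other; the contact order
    ensures that p vanishes identically on neither of the two lines through (t1, t2), as
    [gradient_neq0] and its mirror image require. *)
Lemma order1_gradient p (t1 t2 : C) (K : nat) : N t1 = 1 -> N t2 = 1 ->
  (forall z, bidisk z -> p.[z.1, z.2] <> 0) ->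
  vanishes_to_order p (t1, t2) 1 -> is_contact_order p (t1, t2) K ->
  [/\ p.[t1, t2] = 0, p^`().[t1, t2] != 0 & (p.[t1%:P])^`().[t2] != 0].
Proof.
move=> t11 t21 p0 [v0 [i [j [ij vn0]]]] Kp.
have pt : p.[t1, t2] = 0 by have := v0 0%N 0%N isT; rewrite mixed_deriv00.
have f1 := contact_fiber1 t11 t21 pt Kp; have f2 := contact_fiber2 t11 t21 Kp.
move: ij vn0; case: i => [|[|//]] ij; last first.
  rewrite (_ : j = 0%N); last by case: j ij.
  rewrite mixed_deriv10 => /eqP dp; split => //; exact: gradient_neq0 dp.
rewrite (_ : j = 1%N); last by case: j ij => // j [].
rewrite mixed_deriv01 -deriv_slice2 => /eqP dp; split => //.
exact: gradient_neq0_swap dp.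
Qed.

Lemma poly_factor_lip (a : {poly C}) (t : C) : N t = 1 -> exists2 M : R, 0 < M &
  forall x, N x <= 2 -> N (a.[x] - a.[t]) <= M * N (x - t).
Proof.
move=> t1; have [M M0 HM] := poly_lip 2 a; exists M => // x x2; apply: HM => //.
by rewrite t1; lra.
Qed.

(** At a true zero y over x, the division p = (x - t1)^(2K) s + (y - g) Q gives |g(x) - y| |Q| <= M2
    |x - t1|^(2K), which is negligible against |x - t1|^K. Hence |g| - 1 inherits the two-sided
    bound that [contact_root] gives for |y| - 1. *)
Lemma branch_exists p (t1 t2 : C) (K : nat) : N t1 = 1 -> N t2 = 1 ->
  (forall z, bidisk z -> p.[z.1, z.2] <> 0) ->
  vanishes_to_order p (t1, t2) 1 -> is_contact_order p (t1, t2) K ->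
  exists g, branch p t1 t2 K g.
Proof.
move=> t11 t21 p0 v1 Kp; have [pt d1p d2p] := order1_gradient t11 t21 p0 v1 Kp.
have K0 := contact_gt0 t11 t21 pt Kp.
have [g [s [gt1 gs]]] : exists g s, g.[t1] = t2 /\
    (swapXY p).[g] = ('X - t1%:P) ^+ (2 * K) * s.
  rewrite -(@prednK (2 * K)); last by rewrite muln_gt0.
  apply: newton; first by rewrite horner2_swapXY.
  by move: d2p; rewrite -{1}(swapXYK p) deriv_slice1 horner2_swapXY.
have [Q pQ] := poly2_division p g; have pE := poly2_division_horner pQ.
have {}pE x y : p.[x, y] = (x - t1) ^+ (2 * K) * s.[x] + (y - g.[x]) * Q.[x, y].
  by rewrite pE gs hornerM horner_exp hornerXsubC.
have Qt : Q.[t1, t2] != 0.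
  (* On the line x = t1 the remainder vanishes and p = (y - t2) Q, so Q(t1, t2) is p_y(t1, t2). *)
  apply: contraNneq d2p => Q0.
  have -> : p.[t1%:P] = ('X - t2%:P) * Q.[t1%:P].
    rewrite {1}pQ hornerD hornerM horner_map /= gs hornerM horner_exp hornerXsubC subrr.
    rewrite expr0n muln_eq0 /= (gtn_eqF K0) mul0r add0r hornerD hornerN hornerC.
    by rewrite horner_map /= gt1.
  by rewrite derivM derivXsubC mul1r hornerD hornerM hornerXsubC subrr mul0r Q0 addr0.
have [d1 [c [/andP[d10 d11] c0 HQ]]] := poly2_lower t11 t21 Qt.
have [M1 M10 HM1] := poly2_bound 2 Q; have [M2 M20 HM2] := poly_bound 2 s.
have [L L0 HL] := poly_factor_lip g t11.
have [d2 [a [b [d20 a0 b0 Hroot]]]] := contact_root t21 Kp d10.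
pose d := Num.min (Num.min d1 d2) (Num.min (a * c / (4 * M2)) (d1 / L)).
have d0 : 0 < d by rewrite !lt_min d10 d20 !divr_gt0 ?mulr_gt0.
have dd1 : d <= d1 by rewrite !ge_min lexx.
have dd2 : d <= d2 by rewrite !ge_min lexx orbT.
have dM : d * (4 * M2) <= a * c by rewrite -ler_pdivlMr ?mulr_gt0 // !ge_min lexx !orbT.
have dL : d * L <= d1 by rewrite -ler_pdivlMr // !ge_min lexx !orbT.
have main (x : C) : N x = 1 -> 0 < N (x - t1) < d ->
    [/\ (a / 2) * N (x - t1) ^+ K <= N g.[x] - 1,
        N g.[x] - 1 <= (b + a) * N (x - t1) ^+ K
      & M2 * N (x - t1) ^+ (2 * K) <= (c / 2) * (a / 2 * N (x - t1) ^+ K)].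
  move=> x1 /andP[x0 xd].
  have [|y [py yt ya yb]] := Hroot x x1; first by rewrite x0 (lt_le_trans xd).
  have x2 : N x <= 2 by rewrite x1; lra.
  have hK : N (x - t1) ^+ K <= d.
    apply: le_trans (ltW xd); rewrite ler_iXnr ?ltW //; lra.
  have hK0 : 0 < N (x - t1) ^+ K by rewrite exprn_gt0.
  set h := N (x - t1) ^+ K in hK hK0 ya yb *.
  have h2 : N (x - t1) ^+ (2 * K) = h * h by rewrite mul2n -addnn exprD.
  have small : M2 * (h * h) <= c / 2 * (a / 2 * h).
    rewrite [X in X <= _]mulrA [X in _ <= X]mulrA; apply: ler_wpM2r; first exact: ltW.
    have : M2 * h <= M2 * d by rewrite ler_wpM2l // ltW.
    by lra.
  have gy : N (g.[x] - y) <= a / 2 * h.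
    have /eqP := pE x y; rewrite py eq_sym addr_eq0 => /eqP E.
    have : N (g.[x] - y) * N Q.[x, y] <= M2 * (h * h).
      rewrite -NM -opprB mulNr -E NM NX h2 mulrC; apply: ler_wpM2r; last exact: HM2.
      by rewrite mulr_ge0 ?ltW.
    have Qxy : c <= N Q.[x, y] by apply: HQ => //; exact: lt_le_trans xd _.
    have := ler_wpM2l (Nge0 (g.[x] - y)) Qxy.
    move=> u1 u2; rewrite -(ler_pM2r c0); apply: (le_trans u1); apply: (le_trans u2).
    apply: (le_trans small); have : 0 < a / 2 * h by rewrite !mulr_gt0 // invr_gt0.
    nra.
  have h1 := NBge g.[x] y; have h2' := NBge y g.[x]; rewrite NBC in h2'.
  clear -h1 h2' gy ya yb hK0 h2 small; split; rewrite ?h2 //; lra.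
(* For K = 1 the lower bound at t1 w and at t1 w^* contradicts the cancellation of
   the first order terms of |g|^2 in the sum of the two values. *)
have K2 : (2 <= K)%N.
  rewrite ltn_neqAle K0 andbT eq_sym; apply/eqP => K1.
  clear v1 Hroot; rewrite K1 in main.
  have /factor_theorem[G gG] : root (g - t2%:P) t1.
    by rewrite /root hornerD hornerN hornerC gt1 subrr.
  have gx (x : C) : g.[x] = t2 + (x - t1) * G.[x].
    by rewrite -[g](subrK t2%:P) gG hornerD hornerM hornerXsubC hornerC addrC mulrC.
  have [L' L'0 HL'] := poly_factor_lip G t11.
  set G0 := G.[t1] in HL'.
  pose e := Num.min d (a / (4 * (L' + N G0 + N G0 ^+ 2 + 1))).
  have D0 : 0 < L' + N G0 + N G0 ^+ 2 + 1.
    by have := Nge0 G0; have := sqr_ge0 (N G0); lra.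
  have e0 : 0 < e by rewrite lt_min d0 divr_gt0 // mulr_gt0.
  have [w [w1 wn1 we]] := unit_near1 e0.
  set t := N (w - 1) in we.
  have t0 : 0 < t by rewrite N_gt0 subr_eq0.
  have ta : t * (4 * (L' + N G0 + N G0 ^+ 2 + 1)) < a.
    by rewrite -ltr_pdivlMr ?mulr_gt0 // (lt_le_trans we) // ge_min lexx orbT.
  have td : t < d by rewrite (lt_le_trans we) // ge_min lexx.
  have est (v : C) : N v = 1 -> N (v - 1) = t ->
      1 + a * t <= 2 * complex.Re (t2^* * (t1 * (v - 1)) * G0) + 1 + t ^+ 2 * N G0 ^+ 2 + 2 * t ^+ 2 * L'.
    move=> Nv vt.
    have E : t1 * v - t1 = t1 * (v - 1) by ring.
    have Nx : N (t1 * v) = 1 by rewrite NM t11 Nv mulr1.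
    have Nh : N (t1 * v - t1) = t by rewrite E NM t11 mul1r.
    have [||lb _ _] := main (t1 * v) => //; first by rewrite Nh t0 td.
    rewrite expr1 Nh gx E in lb.
    have Gl := HL' (t1 * v); rewrite Nh Nx in Gl.
    have {}Gl : N (G.[t1 * v] - G0) <= L' * t by apply: Gl; lra.
    set A := t2 + t1 * (v - 1) * G0.
    have Al : 1 + a / 2 * t - L' * t ^+ 2 <= N A.
      have : N (t1 * (v - 1) * (G.[t1 * v] - G0)) <= L' * t ^+ 2.
        by rewrite NM NM t11 mul1r vt expr2 mulrCA ler_wpM2l // ltW.
      have -> : t1 * (v - 1) * (G.[t1 * v] - G0) = t2 + t1 * (v - 1) * G.[t1 * v] - A.
        by rewrite /A; ring.
      have := NBge (t2 + t1 * (v - 1) * G.[t1 * v]) A; lra.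
    have A2 : N A ^+ 2 = 1 + 2 * complex.Re (t2^* * (t1 * (v - 1)) * G0) + t ^+ 2 * N G0 ^+ 2.
      have -> : t ^+ 2 * N G0 ^+ 2 = N (t1 * (v - 1) * G0) ^+ 2.
        by rewrite !NM t11 mul1r vt exprMn.
      pose B := t1 * (v - 1) * G0.
      rewrite /A (_ : t2^* * _ * G0 = t2^* * B) -/B; last by rewrite /B; ring.
      transitivity (N t2 ^+ 2 + 2 * complex.Re (t2^* * B) + N B ^+ 2); last by rewrite t21 expr1n.
      by rewrite !N_sqr; case: (t2) (B) => [u1 u2] [u3 u4] /=; ring.
    have N_A : 1 + 2 * (N A - 1) <= N A ^+ 2 by have := sqr_ge0 (N A - 1); rewrite expr2; nra.
    by move: N_A; rewrite A2; lra.
  have e1 := est w w1 erefl.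
  have cw1 : N w^* = 1 by rewrite Nconj.
  have cwt : N (w^* - 1) = t.
    have -> : w^* - 1 = (w - 1)^* by rewrite rmorphB rmorph1.
    exact: Nconj.
  have e2 := est w^* cw1 cwt.
  (* The cancellation is w + conj w - 2 = -|w - 1|^2 on the circle, which is of second order in
     t. *)
  have sum : complex.Re (t2^* * (t1 * (w - 1)) * G0) + complex.Re (t2^* * (t1 * (w^* - 1)) * G0)
     <= t ^+ 2 * N G0.
    rewrite -ReD (_ : _ + _ = t2^* * t1 * (w + w^* - 2) * G0); last by ring.
    apply: (le_trans (Re_le _)); rewrite !NM Nconj t21 t11 !mul1r ler_wpM2r ?Nge0 //.
    have -> : w + w^* - 2 = - ((w - 1) * (w - 1)^*).
      by rewrite rmorphB rmorph1 mulrBl !mulrBr mulcC w1 expr1n rmorph1; ring.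
    by rewrite NN NM Nconj expr2.
  have : t * (a - t * (L' + N G0 + N G0 ^+ 2 + 1) * 2) > 0 by rewrite mulr_gt0 //; lra.
  have : 0 <= t ^+ 2 * N G0 by rewrite mulr_ge0 ?exprn_ge0 ?Nge0 // ltW.
  have : 0 <= t ^+ 2 * N G0 ^+ 2 by rewrite mulr_ge0 ?exprn_ge0 ?Nge0 // ltW.
  have : 0 <= t ^+ 2 * L' by rewrite mulr_ge0 ?exprn_ge0 // ltW.
  have : 0 <= t ^+ 2 by rewrite exprn_ge0 // ltW.
  have -> : t * (a - t * (L' + N G0 + N G0 ^+ 2 + 1) * 2) =
     a * t - 2 * (t ^+ 2 * L' + t ^+ 2 * N G0 + t ^+ 2 * N G0 ^+ 2 + t ^+ 2) by ring.
  lra.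
exists g; split => //; first by exists s, Q.
pose a' := Num.min (a / 2) (c / 2); pose b' := Num.max (b + a) (M1 + c).
have a'0 : 0 < a' by rewrite lt_min !divr_gt0.
have b'0 : 0 < b' by rewrite lt_max addr_gt0.
exists d, a', b'; split => //; first by rewrite d0 (le_trans dd1).
move=> x x1 xd; have [lb ub sm] := main x x1 xd.
have /andP[x0 xd'] := xd.
have hK0 : 0 < N (x - t1) ^+ K by rewrite exprn_gt0.
split.
- by apply: le_trans lb; rewrite ler_pM2r // ge_min lexx.
- by apply: le_trans ub _; rewrite ler_pM2r // le_max lexx.
move=> y y1 yd.
have x2 : N x <= 2 by rewrite x1; lra.
have y2 : N y <= 2 by rewrite y1; lra.
have Qlb : c <= N Q.[x, y] by apply: HQ; apply: lt_le_trans dd1.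
(* As |y| = 1 < |g(x)|, the point y stays at distance at least |g(x)| - 1 from g(x). This makes the
   remainder of order 2K at most half of the lower bound for |(y - g) Q|. *)
have yg : a / 2 * N (x - t1) ^+ K <= N (y - g.[x]).
  by apply: (le_trans lb); have := NBge g.[x] y; rewrite NBC y1.
have err : N ((x - t1) ^+ (2 * K) * s.[x]) <= c / 2 * N (y - g.[x]).
  rewrite NM NX mulrC; apply: le_trans (_ : M2 * N (x - t1) ^+ (2 * K) <= _).
    by rewrite ler_wpM2r ?exprn_ge0 ?Nge0 // HM2.
  apply: (le_trans sm); rewrite ler_wpM2l // divr_ge0 // ltW //.
have yg0 := Nge0 (y - g.[x]).
have Q1 := ler_wpM2l yg0 Qlb; have Q2 := ler_wpM2l yg0 (HM1 _ _ x2 y2).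
split; rewrite pE.
  apply: (@le_trans _ _ (c / 2 * N (y - g.[x]))); first by rewrite ler_wpM2r // ge_min lexx orbT.
  rewrite (addrC (_ * s.[x])); apply: le_trans (NDge _ _).
  by rewrite [N ((y - _) * _)]NM; lra.
apply: (@le_trans _ _ ((M1 + c) * N (y - g.[x]))); last by rewrite ler_wpM2r // le_max lexx orbT.
apply: (le_trans (ND _ _)); rewrite [N ((y - _) * _)]NM.
have : 0 <= c * N (y - g.[x]) by rewrite mulr_ge0 // ltW.
lra.
Qed.

End Curve.

(** * The order of the numerator along the curve *)

Section BranchOrder.
Variable R : realType.
Local Notation C := (R[i]).
Local Notation N := (@ComplexField.Normc.normc R).
Implicit Types (p q f : {poly {poly C}}) (g u : {poly C}).

(* The vanishing order of q along the curve [g], truncated at 2 K. *)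
Definition branch_order q (t1 : C) (K : nat) g (e : nat) : Prop :=
  (e <= 2 * K)%N /\ exists u, (swapXY q).[g] = ('X - t1%:P) ^+ e * u /\
    ((e < 2 * K)%N -> u.[t1] != 0).

Lemma branch_order_exists q (t1 : C) K g : exists e, branch_order q t1 K g e.
Proof.
have [b0|b0] := eqVneq ((swapXY q).[g]) 0.
  by exists (2 * K)%N; split => //; exists 0; rewrite b0 mulr0 ltnn.
have [m [D Dt E]] := multiplicity_XsubC (swapXY q).[g] t1; rewrite b0 /= in Dt.
have [mK|Km] := ltnP m (2 * K).
  exists m; split; first exact: ltnW.
  by exists D; rewrite E mulrC.
exists (2 * K)%N; split => //; exists (D * ('X - t1%:P) ^+ (m - 2 * K)).
by rewrite ltnn E mulrCA -exprD subnKC.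
Qed.

(** Radial projection to the circle; the value 1 at 0 makes |phase z| = 1 hold without a hypothesis
    on z. *)
Definition phase (z : C) : C := if z == 0 then 1 else z / ((N z)%:C)%C.

Lemma N_phase z : N (phase z) = 1.
Proof.
rewrite /phase; have [_|z0] := eqVneq z 0; first exact: N1.
by rewrite Nf Nreal ger0_norm ?Nge0 // divff // N_eq0.
Qed.

Lemma phase_dist z : z != 0 -> 1 <= N z -> N (phase z - z) = N z - 1.
Proof.
move=> z0 z1; have nz : ((N z)%:C)%C != 0 :> C.
  by rewrite -N_eq0 Nreal normr_eq0 N_eq0.
have -> : phase z - z = phase z * (1 - N z)%:C%C.
  by rewrite /phase (negPf z0) rmorphB rmorph1; field.
by rewrite NM N_phase // mul1r Nreal ler0_norm ?opprB // subr_le0.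
Qed.

Section Estimates.
Variables (p q : {poly {poly C}}) (t1 t2 : C) (K e : nat) (g : {poly C}).
Hypotheses (t11 : N t1 = 1) (t21 : N t2 = 1).
Hypothesis gp : branch p t1 t2 K g.
Hypothesis qp : forall x y : C, N x = 1 -> N y = 1 -> N q.[x, y] <= N p.[x, y].
Hypothesis eq : branch_order q t1 K g e.

(** Radial projection moves g(x) by exactly |g(x)| - 1, which the branch controls by |x - t1|^K; the
    distance to t2 adds the Lipschitz bound of g. *)
Lemma phase_branch : exists d b : R, [/\ 0 < d <= 1, 0 < b & forall x : C, N x = 1 ->
  0 < N (x - t1) < d -> [/\ N (phase g.[x]) = 1,
    N (phase g.[x] - g.[x]) <= b * N (x - t1) ^+ K
  & N (phase g.[x] - t2) <= b * N (x - t1)]].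
Proof.
have [gt1 _ _ K2 [d [a [b [/andP[d0 d1] a0 b0 H]]]]] := gp.
have [L L0 HL] := poly_factor_lip g t11.
exists d, (b + L); split; rewrite ?d0 ?d1 ?addr_gt0 // => x x1 xd.
have /andP[x0 xd'] := xd; have [lb ub _] := H x x1 xd.
have hK0 : 0 < N (x - t1) ^+ K by rewrite exprn_gt0.
have hK : N (x - t1) ^+ K <= N (x - t1).
  by rewrite ler_iXnr ?ltW // ?(ltn_trans _ K2) //; apply: lt_le_trans xd' _.
have gN : 1 <= N g.[x].
  by have := mulr_gt0 a0 hK0; lra.
have g0 : g.[x] != 0 by rewrite -N_gt0; lra.
have D := phase_dist g0 gN.
have D2 : N (phase g.[x] - g.[x]) <= b * N (x - t1) ^+ K by rewrite D.
have G : N (g.[x] - t2) <= L * N (x - t1) by rewrite -gt1 HL // x1; lra.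
split; first exact: N_phase.
  by apply: (le_trans D2); rewrite ler_pM2r // lerDl ltW.
apply: (le_trans (Ntri _ g.[x] _)); rewrite mulrDl lerD //.
by apply: (le_trans D2); rewrite ler_wpM2l // ltW.
Qed.

(* At y = phase g(x), q(x, y) = u(x) (x - t1)^e + O(|x - t1|^K), while |q| <= |p| and
   p(x, y) = O(|x - t1|^K). *)
Lemma branch_order_ge : (K <= e)%N.
Proof.
rewrite leqNgt; apply/negP => eK.
have [_ _ _ K2 [d [a [b [/andP[d0 d1] a0 b0 H]]]]] := gp.
have [d' [b' [/andP[d'0 d'1] b'0 H']]] := phase_branch.
have [_ [u [uE u0]]] := eq.
have {}u0 : (map_poly polyC u).[t1, t2] != 0.
  by rewrite horner_lift u0 // (leq_trans eK) // leq_pmull.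
have [du [c [/andP[du0 du1] c0 Hu]]] := poly2_lower t11 t21 u0.
have [Q qQ] := poly2_division q g; have qE := poly2_division_horner qQ.
have [M M0 HM] := poly2_bound 2 Q.
(* At y = phase g(x), the first term bounds |q| <= |p| <= b |y - g| and the second bounds |(y - g)
   Q|, both in units of |x - t1|^K. *)
pose c' := b * b' + b' * M.
have c'0 : 0 < c' by rewrite addr_gt0 ?mulr_gt0.
pose r := Num.min (Num.min (d / (b' + 1)) d') (Num.min du (c / c')).
have b'1 : 0 < b' + 1 by rewrite addr_gt0.
have r0 : 0 < r by rewrite !lt_min d'0 du0 !divr_gt0.
have [w [w1 wn1 wr]] := unit_near1 r0.
pose x := t1 * w; have x1 : N x = 1 by rewrite NM t11 w1 mulr1.
have hE : x - t1 = t1 * (w - 1) by rewrite /x; ring.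
set h := N (x - t1); have hw : h = N (w - 1) by rewrite /h hE NM t11 mul1r.
have h0 : 0 < h by rewrite hw N_gt0 subr_eq0.
rewrite -hw in wr.
have hd : h * (b' + 1) < d by rewrite -ltr_pdivlMr // (lt_le_trans wr) // !ge_min lexx.
have hd' : h < d' by rewrite (lt_le_trans wr) // !ge_min lexx orbT.
have hdu : h < du by rewrite (lt_le_trans wr) // !ge_min lexx !orbT.
have hc : h * c' < c by rewrite -ltr_pdivlMr // (lt_le_trans wr) // !ge_min lexx !orbT.
have hd1 : h < d by have := mulr_gt0 h0 b'0; lra.
have [] := H' x x1; first by rewrite -/h h0 hd'.
set y := phase g.[x]; rewrite -/h => y1 yg yt.
have [] := H x x1; first by rewrite -/h h0 hd1.
rewrite -/h => _ _ /(_ y y1) []; first by apply: le_lt_trans hd; apply: (le_trans yt); lra.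
move=> _ pb.
have x2 : N x <= 2 by lra.
have y2 : N y <= 2 by lra.
have up : N (swapXY q).[g].[x] <= c' * h ^+ K.
  have -> : (swapXY q).[g].[x] = q.[x, y] - (y - g.[x]) * Q.[x, y] by rewrite qE addrK.
  apply: (le_trans (NB _ _)); rewrite NM mulrDl; apply: lerD.
    apply: (le_trans (qp x1 y1)); apply: (le_trans pb); rewrite -mulrA.
    by apply: ler_wpM2l => //; exact: ltW.
  apply: le_trans (_ : b' * h ^+ K * M <= _); last by rewrite mulrAC.
  by apply: ler_pM; rewrite ?Nge0 // HM.
have lo : c * h ^+ e <= N (swapXY q).[g].[x].
  rewrite uE hornerM horner_exp hornerXsubC NM NX -/h mulrC.
  have := Hu x t2; rewrite horner_lift subrr N0 => /(_ hdu du0) ?.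
  by rewrite ler_wpM2l // exprn_ge0 // ltW.
have := le_trans lo up; apply/negP; rewrite -ltNge.
apply: (@le_lt_trans _ _ (c' * h * h ^+ e)); last by rewrite ltr_pM2r ?exprn_gt0 // mulrC.
rewrite -mulrA -exprS; apply: ler_wpM2l; first exact: ltW.
by rewrite ler_wiXn2l // ?ltW //; lra.
Qed.

End Estimates.
End BranchOrder.

(** * The Wronskian along the zero curve *)

Section LocalEstimates.
Variable R : realType.
Local Notation C := (R[i]).
Local Notation N := (@ComplexField.Normc.normc R).
Implicit Types (p q f : {poly {poly C}}) (g u : {poly C}).

Lemma lift_XsubC (t : C) : map_poly polyC ('X - t%:P) = 'X - t%:P%:P.
Proof. by rewrite rmorphB /= map_polyX map_polyC. Qed.

Lemma horner2D f (f' : {poly {poly C}}) (x y : C) : (f + f').[x, y] = f.[x, y] + f'.[x, y].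
Proof. by rewrite !hornerD. Qed.
Lemma horner2B f (f' : {poly {poly C}}) (x y : C) : (f - f').[x, y] = f.[x, y] - f'.[x, y].
Proof. by rewrite !(hornerD, hornerN). Qed.
Lemma horner2M f (f' : {poly {poly C}}) (x y : C) : (f * f').[x, y] = f.[x, y] * f'.[x, y].
Proof. by rewrite hornerM hornerM. Qed.
Lemma horner2X f k (x y : C) : (f ^+ k).[x, y] = f.[x, y] ^+ k.
Proof. by rewrite horner_exp horner_exp. Qed.
Lemma horner2_XsubC (t x y : C) : ('X - t%:P%:P).[x, y] = x - t.
Proof. by rewrite hornerXsubC hornerD hornerN !hornerC. Qed.

Definition wronskian p q : {poly {poly C}} := q^`() * p - q * p^`().

(** Primes stand for x-derivatives, h k for (x - t1)^e, and k m for its derivative. Multiplying by Q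
    lets the relation for q Q replace q and q'; the second factor Q is needed because q' Q still
    contains q Q'. *)
Lemma wronskian_identity (S : comPzRingType) (p q Q Q1 U p' q' Q' Q1' U' h k m : S) :
  q * Q = Q1 * p + h * k * U ->
  q' * Q + q * Q' = Q1' * p + Q1 * p' + (k * m * U + h * k * U') ->
  (q' * p - q * p') * Q ^+ 2 = p ^+ 2 * (Q * Q1' - Q' * Q1) +
    k * p * (Q * U * m + h * (Q * U' - Q' * U)) - h * k * (U * p' * Q).
Proof.
move=> qQ dqQ; have {}dqQ : q' * Q = Q1' * p + Q1 * p' + (k * m * U + h * k * U') - q * Q'.
  by rewrite -dqQ addrK.
have -> : (q' * p - q * p') * Q ^+ 2 = p * Q * (q' * Q) - p' * Q * (q * Q) by ring.
rewrite dqQ; set T := _ + (k * _ * _ + _).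
have -> : p * Q * (T - q * Q') - p' * Q * (q * Q) =
  p * Q * T - p * Q' * (q * Q) - p' * Q * (q * Q) by ring.
by rewrite qQ /T; ring.
Qed.

(** Dividing both p and q by y - g and eliminating y - g gives q Q = Q1 p + (x - t1)^e U with U = u
    Q - (x - t1)^(2K - e) s Q1. For e < 2K the second part of U vanishes at x = t1, so U(t1, t2) =
    u(t1) Q(t1, t2). *)
Lemma wronskian_expansion p q (t1 : C) K e g s Q :
  (0 < e)%N -> branch_order q t1 K g e ->
  (swapXY p).[g] = ('X - t1%:P) ^+ (2 * K) * s ->
  p = map_poly polyC (swapXY p).[g] + ('Y - map_poly polyC g) * Q ->
  exists A B U, wronskian p q * Q ^+ 2 =
    p ^+ 2 * A + ('X - t1%:P%:P) ^+ e.-1 * p * B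
      - ('X - t1%:P%:P) ^+ e * (U * p^`() * Q) /\
    ((e < 2 * K)%N -> forall t2, Q.[t1, t2] != 0 -> U.[t1, t2] != 0).
Proof.
case: e => [//|e] _ [eK [u [uE u0]]] sE pE; have [Q1 qE] := poly2_division q g.
set H := 'X - t1%:P%:P; pose s' := map_poly polyC s; pose u' := map_poly polyC u.
rewrite sE rmorphM rmorphXn /= lift_XsubC -/H -/s' in pE.
rewrite uE rmorphM rmorphXn /= lift_XsubC -/H -/u' in qE.
have [U [qQ UP]] : exists U, q * Q = Q1 * p + H ^+ e.+1 * U /\
    ((e.+1 < 2 * K)%N -> forall t2, Q.[t1, t2] != 0 -> U.[t1, t2] != 0).
  exists (u' * Q - H ^+ (2 * K - e.+1) * s' * Q1); split.
    rewrite {1}qE {1}pE -{1}(subnKC eK) exprD.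
    move: (H ^+ (2 * K - e.+1)) (H ^+ e.+1) => h1 h2.
    by set G := _ - map_poly _ g; ring.
  move=> e2K t2 Qt; rewrite !(hornerD, hornerN, hornerM, horner_exp) horner_lift.
  rewrite !hornerX !hornerC subrr expr0n subn_eq0 leqNgt e2K /= !mul0r subr0.
  by rewrite mulf_neq0 ?u0.
exists (Q * Q1^`() - Q^`() * Q1), (Q * U * e.+1%:R + H * (Q * U^`() - Q^`() * U)), U.
split=> //; rewrite /wronskian [H ^+ e.+1]exprS; apply: wronskian_identity; first by rewrite -exprS.
have := congr1 (@deriv _) qQ; rewrite !(derivM, derivD) deriv_exp derivXsubC mul1r => ->.
by rewrite -exprS /= mulr_natr.
Qed.

Section Estimates.
Variables (p q : {poly {poly C}}) (t1 t2 : C) (K e : nat) (g : {poly C}).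
Hypotheses (t11 : N t1 = 1) (t21 : N t2 = 1).
Hypothesis gp : branch p t1 t2 K g.
Hypothesis qp : forall x y : C, N x = 1 -> N y = 1 -> N q.[x, y] <= N p.[x, y].
Hypothesis eq : branch_order q t1 K g e.

(** The size of p is expressed through the circle point phase g(x) instead of g(x), so that it can
    be integrated in y over the circle. The last two clauses concern the window |y - phase g(x)| <=
    |x - t1|^K used for the lower bounds. *)
Lemma local_size : exists d k b : R, [/\ 0 < d <= 1, 0 < k, 0 < b & forall x : C, N x = 1 ->
  0 < N (x - t1) < d -> N (phase g.[x]) = 1 /\ forall y, N y = 1 ->
  [/\ N (y - t2) < d -> N (x - t1) ^+ K + N (y - phase g.[x]) <= k * N p.[x, y],
      N (y - phase g.[x]) <= N (x - t1) ^+ K -> N p.[x, y] <= b * N (x - t1) ^+ K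
    & N (y - phase g.[x]) <= N (x - t1) ^+ K -> N (y - t2) <= b * N (x - t1)]].
Proof.
have [gt1 _ _ K2 [d [a [b [/andP[d0 d1] a0 b0 H]]]]] := gp.
have [d' [b' [/andP[d'0 d'1] b'0 H']]] := phase_branch t11 gp.
pose r := Num.min (d / (b' + 1)) d'.
have r0 : 0 < r by rewrite lt_min d'0 divr_gt0 // addr_gt0.
have rd : r * (b' + 1) <= d by rewrite -ler_pdivlMr ?addr_gt0 // ge_min lexx.
have rd' : r <= d' by rewrite ge_min lexx orbT.
have rd1 : r <= d by have := mulr_gt0 r0 b'0; lra.
(* With Y = |y - g(x)|: a |x - t1|^K <= Y, |y - phase g| <= Y + b' |x - t1|^K and a Y <= |p| combine
   to this constant. *)
pose k := (1 + a + b') / (a * a); pose b2 := b * (1 + b') + (1 + b').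
have k0 : 0 < k by rewrite divr_gt0 ?mulr_gt0 // !addr_gt0.
have b20 : 0 < b2 by rewrite !(addr_gt0, mulr_gt0).
exists r, k, b2; split; rewrite ?r0 ?(le_trans rd') // => x x1 /andP[x0 xr].
have [||w1 wg wt] := H' x => //; first by rewrite x0 (lt_le_trans xr).
have [||glo gup pE] := H x => //; first by rewrite x0 (lt_le_trans xr).
set h := N (x - t1) in x0 xr wg wt glo gup *; set w := phase _ in w1 wg wt *.
have hK0 : 0 < h ^+ K by rewrite exprn_gt0.
have hK : h ^+ K <= h by rewrite ler_iXnr ?ltW // ?(ltn_trans _ K2) //; lra.
split=> // y y1.
have near : N (y - w) <= h ^+ K -> N (y - t2) <= (1 + b') * h.
  by move=> yw; have := Ntri y w t2; lra.
split.
- move=> yr; have [|plo _] := pE y y1; first exact: lt_le_trans yr _.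
  have yg : a * h ^+ K <= N (y - g.[x]) by have := NBge g.[x] y; rewrite NBC; lra.
  have yw : N (y - w) <= N (y - g.[x]) + b' * h ^+ K.
    by have := Ntri y g.[x] w; rewrite (NBC g.[x]); lra.
  have Y0 := Nge0 (y - g.[x]).
  rewrite /k -mulrA [_^-1 * _]mulrC mulrA ler_pdivlMr ?mulr_gt0 //.
  have u1 := ler_wpM2l (ltW a0) yg.
  have u2 := ler_wpM2l (ltW a0) (ler_wpM2l (ltW a0) yw).
  have u3 := ler_wpM2l (ltW b'0) u1.
  have u4 := ler_wpM2l (ltW a0) plo.
  have u5 := ler_wpM2l (ltW b'0) plo.
  clear -u1 u2 u3 u4 u5 plo; lra.
- move=> yw; have yt := near yw.
  have [|_ pup] := pE y y1.
    have : h * (b' + 1) < r * (b' + 1) by rewrite ltr_pM2r ?addr_gt0.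
    by lra.
  apply: (le_trans pup); have := Ntri y w g.[x] => yg.
  have : N (y - g.[x]) <= (1 + b') * h ^+ K by lra.
  move/(ler_wpM2l (ltW b0)) => u.
  have : 0 <= (1 + b') * h ^+ K by rewrite mulr_ge0 ?addr_ge0 ?ltW.
  by rewrite /b2; lra.
- move=> yw; have yt := near yw.
  have : 0 <= b * (1 + b') * h by rewrite !mulr_ge0 ?addr_ge0 ?ltW.
  by rewrite /b2; lra.
Qed.

(** The expansion of W Q^2 is divided by |Q|^2 >= c^2; the terms of size h^e are rewritten as (h^e /
    D^2) D^2, with D bounded by a multiple of |p| through [local_size]. *)
Lemma local_upper : exists d M : R, [/\ 0 < d <= 1, 0 < M & forall x y : C, N x = 1 ->
  N y = 1 -> 0 < N (x - t1) < d -> N (y - t2) < d ->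
  [/\ N (phase g.[x]) = 1, p.[x, y] != 0 & N (wronskian p q).[x, y] <=
   M * (1 + N (x - t1) ^+ e / (N (x - t1) ^+ K + N (y - phase g.[x])) ^+ 2) * N p.[x, y] ^+ 2]].
Proof.
have Ke := branch_order_ge t11 t21 gp qp eq.
have [_ [s [Q [sE pE Qt]]] _ K2 _] := gp.
have e2 := leq_trans K2 Ke; have e0 := ltnW e2.
have e1 : (0 < e.-1)%N by rewrite -ltnS (prednK e0).
have [A [B [U [WE _]]]] := wronskian_expansion e0 eq sE pE.
have [d [k [b [/andP[d0 d1] k0 b0 H]]]] := local_size.
have [dQ [c [/andP[dQ0 dQ1] c0 HQ]]] := poly2_lower t11 t21 Qt.
have [mA mA0 HA] := poly2_bound 2 A; have [mB mB0 HB] := poly2_bound 2 B.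
have [mV mV0 HV] := poly2_bound 2 (U * p^`() * Q).
pose m := mA + mB + mV; have m0 : 0 < m by rewrite !addr_gt0.
pose M := m / c ^+ 2 * (1 + k ^+ 2).
have M0 : 0 < M.
  by rewrite mulr_gt0 ?divr_gt0 ?exprn_gt0 ?addr_gt0 ?exprn_gt0.
exists (Num.min d dQ), M; split => //.
  by rewrite lt_min d0 dQ0 ge_min d1.
move=> x y x1 y1; rewrite !lt_min => /and3P[x0 xd xdQ] /andP[yd ydQ].
have [|w1 /(_ y y1) [/(_ yd) Dk _ _]] := H x x1; first by rewrite x0.
set h := N (x - t1) in x0 xd xdQ Dk *.
set D := _ + _ in Dk *; set P := N p.[x, y] in Dk *.
have hK0 : 0 < h ^+ K by rewrite exprn_gt0.
have D0 : 0 < D by rewrite ltr_wpDr ?Nge0.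
have P0 : 0 < P by rewrite -(pmulr_rgt0 _ k0) (lt_le_trans D0).
split=> //; first by rewrite -N_gt0.
have x2 : N x <= 2 by lra.
have y2 : N y <= 2 by lra.
have Qlb := HQ _ _ xdQ ydQ.
have he0 : 0 < h ^+ e by rewrite exprn_gt0.
(* If |p| <= h, the product is at most h^e; otherwise h^(e-1) <= h < |p| because e >= 2, and it is
   at most |p|^2. *)
have cross : h ^+ e.-1 * P <= P ^+ 2 + h ^+ e.
  have [Ph|hP] := leP P h.
    apply: (@le_trans _ _ (h ^+ e)); last by rewrite lerDr sqr_ge0.
    by rewrite -[in X in _ <= X](prednK e0) exprSr ler_wpM2l // exprn_ge0 // ltW.
  apply: (@le_trans _ _ (P ^+ 2)); last by rewrite lerDl ltW.
  rewrite expr2 ler_wpM2r ?(ltW P0) // (le_trans _ (ltW hP)) //.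
  have h1 : h <= 1 by lra.
  exact: ler_iXnr e1 (ltW x0) h1.
have up : N (wronskian p q).[x, y] * c ^+ 2 <= m * (P ^+ 2 + h ^+ e).
  apply: (@le_trans _ _ (N (wronskian p q * Q ^+ 2).[x, y])).
    rewrite horner2M NM ler_wpM2l ?Nge0 // horner2X NX.
    by apply: lerXn2r => //; rewrite nnegrE ?Nge0 // ltW.
  rewrite WE horner2B horner2D (horner2M (p ^+ 2)) (horner2M _ B) (horner2M (_ ^+ e.-1)).
  rewrite (horner2M (_ ^+ e)) !horner2X horner2_XsubC.
  apply: (le_trans (NB _ _)); apply: (le_trans (lerD (ND _ _) (lexx _))).
  rewrite [N (p.[x, y] ^+ 2 * _)]NM NX [N (_ * B.[x, y])]NM [N (_ * p.[x, y])]NM NX.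
  rewrite [N (_ ^+ e * _)]NM NX -/h -/P.
  have t1' := ler_wpM2l (sqr_ge0 P) (HA _ _ x2 y2).
  have hP0 : 0 <= h ^+ e.-1 * P by rewrite mulr_ge0 ?exprn_ge0 ?ltW.
  have t2' := ler_wpM2l hP0 (HB _ _ x2 y2).
  have t3' := ler_wpM2l (ltW he0) (HV _ _ x2 y2).
  have t4' := ler_wpM2r (ltW mB0) cross.
  have t5' := sqr_ge0 P.
  have : 0 <= (mV * P ^+ 2) by rewrite mulr_ge0 // ltW.
  have : 0 <= (mA * h ^+ e) by rewrite mulr_ge0 // ltW.
  by clear -t1' t2' t3' t4' t5'; rewrite /m; lra.
have hD : h ^+ e <= k ^+ 2 * (h ^+ e / D ^+ 2) * P ^+ 2.
  rewrite (_ : _ * P ^+ 2 = h ^+ e * ((k * P) ^+ 2 / D ^+ 2)); last by ring.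
  rewrite ler_peMr ?(ltW he0) // ler_pdivlMr ?exprn_gt0 // mul1r.
  by rewrite lerXn2r ?nnegrE ?mulr_ge0 // ltW.
rewrite -(ler_pM2r (exprn_gt0 2 c0)); apply: (le_trans up).
rewrite (_ : M * _ * _ * _ = m * ((1 + k ^+ 2) * (1 + h ^+ e / D ^+ 2) * P ^+ 2)); last first.
  by rewrite /M; field; rewrite (gt_eqF c0) (gt_eqF D0).
rewrite ler_pM2l //.
have : 0 <= k ^+ 2 * P ^+ 2 by rewrite mulr_ge0 ?sqr_ge0.
have : 0 <= h ^+ e / D ^+ 2 * P ^+ 2 by rewrite mulr_ge0 ?sqr_ge0 // divr_ge0 ?sqr_ge0 // ltW.
lra.
Qed.

(** In the window |p| = O(h^K), so the terms in p^2 and (x - t1)^(e-1) p are O(h^(e+1)) and cannot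
    cancel the term (x - t1)^e U p_x Q, whose cofactor is nonzero at (t1, t2). The conclusion is |W
    / p^2| >= c h^(e - 2K) with denominators cleared. *)
Lemma local_lower : (e < 2 * K)%N -> exists d c : R, [/\ 0 < d <= 1, 0 < c &
  forall x : C, N x = 1 -> 0 < N (x - t1) < d -> N (phase g.[x]) = 1 /\
  forall y, N y = 1 -> N (y - phase g.[x]) <= N (x - t1) ^+ K ->
  p.[x, y] != 0 /\
  c * N (x - t1) ^+ e * N p.[x, y] ^+ 2 <= N (wronskian p q).[x, y] * N (x - t1) ^+ (2 * K)].
Proof.
move=> e2K.
have Ke := branch_order_ge t11 t21 gp qp eq.
have [_ [s [Q [sE pE Qt]]] dp K2 _] := gp.
have e2 := leq_trans K2 Ke; have e0 := ltnW e2.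
have e1 : (0 < e.-1)%N by rewrite -ltnS (prednK e0).
have [A [B [U [WE /(_ e2K t2 Qt) Ut]]]] := wronskian_expansion e0 eq sE pE.
have [d [k [b [/andP[d0 d1] k0 b0 H]]]] := local_size.
have Vt : (U * p^`() * Q).[t1, t2] != 0 by rewrite !hornerM !mulf_neq0.
have [dV [c [/andP[dV0 dV1] c0 HV]]] := poly2_lower t11 t21 Vt.
have [mA mA0 HA] := poly2_bound 2 A; have [mB mB0 HB] := poly2_bound 2 B.
have [mQ mQ0 HQ] := poly2_bound 2 Q.
pose l := mA * b ^+ 2 + mB * b.
have l0 : 0 < l by rewrite addr_gt0 ?mulr_gt0 ?exprn_gt0.
pose r := Num.min (Num.min d dV) (Num.min (d / (b + 1)) (Num.min (dV / (b + 1)) (c / (2 * l)))).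
have b1 : 0 < b + 1 by rewrite addr_gt0.
have r0 : 0 < r by rewrite !lt_min d0 dV0 !divr_gt0 // mulr_gt0.
have rd : r <= d by rewrite !ge_min lexx.
have rdV : r <= dV by rewrite !ge_min lexx !orbT.
have rbd : r * (b + 1) <= d by rewrite -ler_pdivlMr // !ge_min lexx !orbT.
have rbV : r * (b + 1) <= dV by rewrite -ler_pdivlMr // !ge_min lexx !orbT.
have rl : r * (2 * l) <= c by rewrite -ler_pdivlMr ?mulr_gt0 // !ge_min lexx !orbT.
exists r, (c / (2 * mQ ^+ 2 * b ^+ 2)); split.
- by rewrite r0 (le_trans rd).
- by rewrite divr_gt0 ?mulr_gt0 ?exprn_gt0.
move=> x x1 /andP[x0 xr].
have [|w1 Hy] := H x x1; first by rewrite x0 (lt_le_trans xr).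
split=> // y y1 yw; have [Dk /(_ yw) pb /(_ yw) yt] := Hy y y1.
set h := N (x - t1) in x0 xr Dk pb yt yw *.
have hb : h * (b + 1) < r * (b + 1) by rewrite ltr_pM2r.
have yd : N (y - t2) < d by lra.
have ydV : N (y - t2) < dV by lra.
have {}Dk := Dk yd; set P := N p.[x, y] in Dk pb *.
have hK0 : 0 < h ^+ K by rewrite exprn_gt0.
have P0 : 0 < P.
  by rewrite -(pmulr_rgt0 _ k0) (lt_le_trans _ Dk) // ltr_wpDr ?Nge0.
split; first by rewrite -N_gt0.
have x2 : N x <= 2 by lra.
have y2 : N y <= 2 by lra.
have he0 : 0 < h ^+ e by rewrite exprn_gt0.
have h1 : h <= 1 by lra.
have P2 : P ^+ 2 <= b ^+ 2 * h ^+ (2 * K).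
  rewrite mulnC exprM -exprMn lerXn2r ?nnegrE ?(ltW P0) // mulr_ge0 ?ltW //.
have p2 : mA * P ^+ 2 <= mA * b ^+ 2 * (h * h ^+ e).
  rewrite -mulrA ler_wpM2l ?(ltW mA0) // (le_trans P2) // ler_wpM2l ?sqr_ge0 //.
  by rewrite -exprS ler_wiXn2l // ltW.
(* Here K >= 2 is essential: the exponent e - 1 + K has to reach e + 1. *)
have p1 : mB * (h ^+ e.-1 * P) <= mB * b * (h * h ^+ e).
  rewrite -mulrA ler_wpM2l ?(ltW mB0) //.
  apply: (@le_trans _ _ (h ^+ e.-1 * (b * h ^+ K))).
    by rewrite ler_wpM2l // exprn_ge0 // ltW.
  rewrite mulrCA ler_wpM2l ?(ltW b0) // -exprD -exprS.
  apply: (ler_wiXn2l (ltW x0) h1).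
  by rewrite -[X in (X < _)%N](prednK e0) -addn2 leq_add2l.
have Wlo : c / 2 * h ^+ e <= N (wronskian p q).[x, y] * mQ ^+ 2.
  apply: (@le_trans _ _ (N (wronskian p q * Q ^+ 2).[x, y])); last first.
    rewrite horner2M NM ler_wpM2l ?Nge0 // horner2X NX.
    by apply: lerXn2r; rewrite ?nnegrE ?Nge0 ?HQ // ltW.
  rewrite WE horner2B horner2D (horner2M (p ^+ 2)) (horner2M _ B) (horner2M (_ ^+ e.-1)).
  rewrite (horner2M (_ ^+ e)) !horner2X horner2_XsubC.
  rewrite NBC; apply: le_trans (NBge _ _).
  rewrite [N (_ ^+ e * _)]NM NX -/h.
  have Vlo := ler_wpM2l (ltW he0) (HV _ _ (lt_le_trans xr rdV) ydV).
  apply: le_trans (lerB Vlo (ND _ _)).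
  rewrite [N (p.[x, y] ^+ 2 * _)]NM NX [N (_ * B.[x, y])]NM [N (_ * p.[x, y])]NM NX -/h -/P.
  have t1' := ler_wpM2l (sqr_ge0 P) (HA _ _ x2 y2).
  have hP0 : 0 <= h ^+ e.-1 * P by rewrite mulr_ge0 ?exprn_ge0 ?ltW.
  have t2' := ler_wpM2l hP0 (HB _ _ x2 y2).
  have hl : h * (2 * l) <= c by apply: le_trans rl; rewrite ler_pM2r ?mulr_gt0 // ltW.
  have := ler_wpM2r (ltW he0) hl.
  by rewrite /l; lra.
have W0 := Nge0 (wronskian p q).[x, y].
have Z0 : 0 < 2 * mQ ^+ 2 * b ^+ 2 by rewrite !mulr_gt0 ?exprn_gt0.
have -> : c / (2 * mQ ^+ 2 * b ^+ 2) * h ^+ e * P ^+ 2 = c * h ^+ e * P ^+ 2 / (2 * mQ ^+ 2 * b ^+ 2).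
  by rewrite (mulrAC c _ (h ^+ e)) (mulrAC _ _ (P ^+ 2)).
rewrite ler_pdivrMr //.
apply: (@le_trans _ _ (c * h ^+ e * (b ^+ 2 * h ^+ (2 * K)))).
  by rewrite ler_wpM2l // mulr_ge0 ?(ltW c0) ?(ltW he0).
have := ler_wpM2l (mulr_ge0 (sqr_ge0 b) (exprn_ge0 (2 * K) (ltW x0))) Wlo.
lra.
Qed.

End Estimates.
End LocalEstimates.

(** * Integrals over the circle and the torus *)

Section Circle.
Variable R : realType.
Local Notation C := (R[i]).
Local Notation N := (@ComplexField.Normc.normc R).
Local Notation mu := (@lebesgue_measure R).

Lemma expi_surj (w : C) : N w = 1 -> exists2 t : R, 0 <= t <= 2 * pi & w = expi t.
Proof.
case: w => a b w1; have ab : a ^+ 2 + b ^+ 2 = 1.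
  by move/(congr1 (fun x => x ^+ 2)): w1; rewrite /= sqr_sqrtr ?addr_ge0 ?sqr_ge0 // expr1n.
have a1 : -1 <= a <= 1.
  by rewrite -ler_norml -(@expr_le1 _ 2) // real_normK ?num_real // -ab lerDl sqr_ge0.
have := acos_ge0 a1; have := acos_lepi a1; have := pi_ge0 R => pi0 ap a0.
have ca : cos (acos a) = a by rewrite acosK // in_itv.
have sa : sin (acos a) = `|b| by rewrite sin_acos // -ab addrC addKr sqrtr_sqr.
have [b0|b0] := leP 0 b.
  exists (acos a); first by apply/andP; split; lra.
  by apply/eqP; rewrite eq_complex /= ca sa ger0_norm // !eqxx.
exists (2 * pi - acos a); first by apply/andP; split; lra.
have -> : 2 * pi - acos a = - acos a + pi *+ 2 by rewrite mulr2n; ring.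
apply/eqP; rewrite eq_complex /= cosD2pi sinD2pi cosN sinN ca sa ltr0_norm //.
by rewrite opprK !eqxx.
Qed.

Lemma sin_mvt (u : R) : 0 < u -> exists2 c, 0 < c < u & sin u = cos c * u.
Proof.
move=> u0; have [c cu] := @MVT R (@sin R) (@cos R) 0 u u0 (fun x _ => is_derive_sin x)
   (continuous_subspaceT (@continuous_sin R)).
rewrite sin0 !subr0 => ->; exists c => //; by move: cu; rewrite in_itv.
Qed.

Lemma norm_sin_le (u : R) : `|sin u| <= `|u|.
Proof.
have pos (v : R) : 0 <= v -> `|sin v| <= v.
  rewrite le_eqVlt => /orP[/eqP <-|v0]; first by rewrite sin0 normr0.
  have [c _ ->] := sin_mvt v0; rewrite normrM [`|v|]gtr0_norm // ler_piMl ?cos_max ?(ltW v0) //.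
case/orP: (le_total 0 u) => u0; first by rewrite [`|u|]ger0_norm ?pos.
by rewrite -[`|sin u|]normrN -sinN -[`|u|]normrN [`|- u|]ger0_norm ?pos // oppr_ge0.
Qed.

(** On (0, 1] the mean value theorem gives sin v >= cos 1 v. On [1, pi/2] sin is increasing, and sin
    v >= sin 1 >= cos 1 >= (cos 1 / 2) v because v <= 2; this explains the constant cos 1 / 2. *)
Lemma norm_sin_ge : exists2 k : R, 0 < k & forall u : R, `|u| <= pi / 2 -> k * `|u| <= `|sin u|.
Proof.
pose k : R := cos 1 / 2; have k0 : 0 < k by rewrite divr_gt0 // cos1_gt0.
have pi2 := pi_ge2 R; have c1 := cos1_gt0 R.
have sin_ge (v : R) : 0 < v <= 1 -> cos 1 * v <= sin v.
  move=> /andP[v0 v1]; have [c /andP[c0 cv] ->] := sin_mvt v0.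
  rewrite ler_pM2r // ltW // ltr_cos ?in_itv /=; first by lra.
    by apply/andP; split; lra.
  by apply/andP; split; lra.
have pos (v : R) : 0 <= v -> v <= pi / 2 -> k * v <= `|sin v|.
  rewrite le_eqVlt => /orP[/eqP <-|v0] vp; first by rewrite mulr0.
  apply: le_trans (ler_norm _).
  have [v1|v1] := leP v 1.
    by apply: le_trans (sin_ge v _); rewrite ?v0 // ler_pM2r // /k; lra.
  have vs : sin 1 < sin v.
    by rewrite ltr_sin // in_itv /=; apply/andP; split; lra.
  have := sin_ge 1; rewrite ltr01 lexx mulr1 => /(_ isT) s1.
  have v2 : v <= 2 by have := pihalf_lt2 R; lra.
  by rewrite /k; nra.
exists k => // u up.
case/orP: (le_total 0 u) => u0; first by move: up; rewrite [`|u|]ger0_norm //; exact: pos.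
rewrite -[`|u|]normrN -[`|sin u|]normrN -sinN [`|- u|]ger0_norm ?oppr_ge0 //.
by apply: pos; rewrite ?oppr_ge0 //; move: up; rewrite ler0_norm.
Qed.

Lemma dist_expi (s t : R) : N (expi s - expi t) = 2 * `|sin ((s - t) / 2)|.
Proof.
set v := (s - t) / 2; have sv : s = t + v *+ 2 by rewrite /v mulr2n; field.
have -> : expi s - expi t = expi t * (expi (v *+ 2) - 1) by rewrite [in LHS]sv expiD mulrBr mulr1.
rewrite NM N_expi mul1r.
apply/eqP; rewrite -(@eqrXn2 _ 2) ?Nge0 ?mulr_ge0 //; apply/eqP.
rewrite exprMn real_normK ?num_real // N_sqr.
rewrite /= cos_mulr2n sin_mulr2n oppr0 addr0.
have SK := cos2Dsin2 v; move: (cos v) (sin v) SK => c k SK.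
have -> : c ^+ 2 = 1 - k ^+ 2 by rewrite -SK addrK.
have c2 : c * c = 1 - k * k by rewrite -!expr2 -SK addrK.
transitivity (4 * k ^+ 4 + 4 * k ^+ 2 * (c * c)); first by rewrite !mulr2n; ring.
by rewrite c2; ring.
Qed.

Lemma dist_expi_le (s t : R) : N (expi s - expi t) <= `|s - t|.
Proof.
rewrite dist_expi -ler_pdivlMl // mulrC.
by rewrite (le_trans (norm_sin_le _)) // normrM [`|2^-1|]ger0_norm.
Qed.

(** Angles near 0 and near 2 pi give nearby points, so arc length is compared with the chord only
    after replacing t by one of its representatives t, t - 2 pi, t + 2 pi within distance pi of
    s. *)
Lemma dist_expi_ge : exists2 k : R, 0 < k & forall s t : R, 0 <= s <= 2 * pi -> 0 <= t <= 2 * pi ->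
  exists2 u, u \in [:: t - 2 * pi; t; t + 2 * pi] & k * `|s - u| <= N (expi s - expi t).
Proof.
have [k k0 H] := norm_sin_ge; exists k => // s t /andP[s0 s2] /andP[t0 t2].
have pi0 := pi_gt0 R.
have key (u : R) : expi u = expi t :> C -> `|s - u| <= pi -> k * `|s - u| <= N (expi s - expi t).
  move=> <- su; rewrite dist_expi.
  have E : `|(s - u) / 2| = `|s - u| / 2 by rewrite normrM [`|2^-1|]ger0_norm.
  have := H ((s - u) / 2); rewrite E ler_pM2r // => /(_ su); lra.
have ep : expi (t + 2 * pi) = expi t :> C.
  have -> : 2 * pi = pi *+ 2 :> R by rewrite mulr2n; ring.
  by apply/eqP; rewrite eq_complex /= cosD2pi sinD2pi !eqxx.
have em : expi (t - 2 * pi) = expi t :> C.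
  have -> : - (2 * pi) = - (pi *+ 2) :> R by rewrite mulr2n; ring.
  rewrite -[in RHS](subrK (pi *+ 2) t).
  by apply/eqP; rewrite eq_complex /= cosD2pi sinD2pi !eqxx.
have [h1|h1] := leP (s - t) (- pi).
  exists (t - 2 * pi); first by rewrite !inE eqxx.
  by apply: key em _; rewrite ler_norml; apply/andP; split; lra.
have [h2|h2] := leP (s - t) pi.
  exists t; first by rewrite !inE eqxx orbT.
  by apply: key => //; rewrite ler_norml h2 ltW.
exists (t + 2 * pi); first by rewrite !inE eqxx !orbT.
by apply: key ep _; rewrite ler_norml; apply/andP; split; lra.
Qed.

End Circle.

(** * Measurability of complex-valued functions *)

Section ComplexMeasurable.
Context d (T : measurableType d) (R : realType).
Local Notation C := (R[i]).
Local Notation N := (@ComplexField.Normc.normc R).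
Implicit Types (D : set T) (f g : T -> C).

Definition cmeas D f : Prop :=
  measurable_fun D (fun t => complex.Re (f t)) /\ measurable_fun D (fun t => complex.Im (f t)).

Lemma cmeas_cst D (c : C) : cmeas D (fun _ => c).
Proof. by split; exact: measurable_cst. Qed.

Lemma cmeasD D f g : cmeas D f -> cmeas D g -> cmeas D (fun t => f t + g t).
Proof.
move=> [f1 f2] [g1 g2]; split.
  apply: (eq_measurable_fun (fun t => complex.Re (f t) + complex.Re (g t))).
    by move=> t _; case: (f t) (g t) => [? ?] [? ?].
  exact: measurable_funD.
apply: (eq_measurable_fun (fun t => complex.Im (f t) + complex.Im (g t))).
  by move=> t _; case: (f t) (g t) => [? ?] [? ?].
exact: measurable_funD.
Qed.

Lemma cmeasM D f g : cmeas D f -> cmeas D g -> cmeas D (fun t => f t * g t).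
Proof.
move=> [f1 f2] [g1 g2]; split.
  apply: (eq_measurable_fun (fun t => complex.Re (f t) * complex.Re (g t) -
     complex.Im (f t) * complex.Im (g t))).
    by move=> t _; case: (f t) (g t) => [? ?] [? ?].
  by apply: measurable_funB; exact: measurable_funM.
apply: (eq_measurable_fun (fun t => complex.Re (f t) * complex.Im (g t) +
   complex.Im (f t) * complex.Re (g t))).
  by move=> t _; case: (f t) (g t) => [? ?] [? ?].
by apply: measurable_funD; exact: measurable_funM.
Qed.

Lemma cmeas_normc D f : cmeas D f -> measurable_fun D (fun t => N (f t)).
Proof.
move=> [f1 f2].
apply: (eq_measurable_fun (fun t => Num.sqrt (complex.Re (f t) ^+ 2 + complex.Im (f t) ^+ 2))).
  by move=> t _; case: (f t).
apply: (measurableT_comp (continuous_measurable_fun (@sqrt_continuous R))).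
by apply: measurable_funD; exact: measurable_funX.
Qed.

Lemma cmeasV D f : cmeas D f -> cmeas D (fun t => (f t)^-1).
Proof.
move=> fm; have [f1 f2] := fm.
(* The inverse is |f|^(-2) conj f, an identity that also holds where f = 0 because both sides are
   then 0; so no case distinction on the domain is needed. *)
have Vm : measurable_fun D (fun t => (N (f t) ^+ 2) `^ (-1)).
  apply: (measurableT_comp (measurable_powR (-1))).
  by apply: measurable_funX; exact: cmeas_normc.
have E t : (f t)^-1 = ((((N (f t) ^+ 2) `^ (-1))%:C)%C) * (f t)^*.
  rewrite powR_inv1 ?sqr_ge0 // fmorphV /= -mulcC.
  have [->|f0] := eqVneq (f t) 0; first by rewrite mul0r invr0 mul0r.
  by rewrite invfM -mulrA mulVf ?mulr1 // fmorph_eq0.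
split.
  apply: (eq_measurable_fun (fun t => (N (f t) ^+ 2) `^ (-1) * complex.Re (f t))).
    by move=> t _; rewrite E ReZ Re_conjc.
  exact: measurable_funM.
apply: (eq_measurable_fun (fun t => - ((N (f t) ^+ 2) `^ (-1) * complex.Im (f t)))).
  by move=> t _; rewrite E; case: (f t) => a b /=; rewrite mul0r addr0 mulrN.
by apply: measurableT_comp => //; exact: measurable_funM.
Qed.

Lemma cmeas_horner D f (a : {poly C}) : cmeas D f -> cmeas D (fun t => a.[f t]).
Proof.
move=> fm; elim/poly_ind: a => [|a c IH].
  rewrite (_ : (fun _ => _) = fun _ => 0); first exact: cmeas_cst.
  by apply/funext => t; rewrite horner0.
rewrite (_ : (fun _ => _) = fun t => a.[f t] * f t + c).
  by apply: cmeasD; [exact: cmeasM|exact: cmeas_cst].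
by apply/funext => t; rewrite hornerMXaddC.
Qed.

Lemma cmeas_horner2 D f g (p : {poly {poly C}}) : cmeas D f -> cmeas D g ->
  cmeas D (fun t => p.[f t, g t]).
Proof.
move=> fm gm; elim/poly_ind: p => [|p c IH].
  rewrite (_ : (fun _ => _) = fun _ => 0); first exact: cmeas_cst.
  by apply/funext => t; rewrite !horner0.
rewrite (_ : (fun _ => _) = fun t => p.[f t, g t] * f t + c.[g t]).
  by apply: cmeasD; [exact: cmeasM|exact: cmeas_horner].
by apply/funext => t; rewrite hornerMXaddC hornerD hornerM hornerC.
Qed.

Lemma cmeas_expi D (h : T -> R) : measurable_fun D h -> cmeas D (fun t => expi (h t)).
Proof.
move=> hm; split.
  apply: (eq_measurable_fun (fun t => cos (h t))) => //.
  exact: (measurableT_comp (continuous_measurable_fun (@continuous_cos R))).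
apply: (eq_measurable_fun (fun t => sin (h t))) => //.
exact: (measurableT_comp (continuous_measurable_fun (@continuous_sin R))).
Qed.

End ComplexMeasurable.

(** * Dyadic estimates of integrals over the circle *)

Section Covering.
Context d (T : measurableType d) (R : realType).
Variable mu : {measure set T -> \bar R}.
Local Open Scope ereal_scope.

(** The sets need not be disjoint: one index n with f <= c n on E n already gives f <= sum of c n
    times the indicator of E n. Points where f vanishes need not be covered. *)
Lemma integral_le_cover (D : set T) (f : T -> \bar R) (E : nat -> set T) (c : nat -> R) :
  measurable D -> measurable_fun D f -> (forall t, D t -> 0 <= f t) ->
  (forall n, measurable (E n)) -> (forall n, (0 <= c n)%R) ->
  (forall t, D t -> f t = 0 \/ exists2 n, E n t & f t <= (c n)%:E) ->
  \int[mu]_(t in D) f t <= \sum_(n <oo) (c n)%:E * mu (D `&` E n).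
Proof.
move=> mD mf f0 mE c0 H.
have mI n : measurable_fun D (fun t => (c n)%:E * (\1_(E n) t)%:E).
  apply: measurable_funeM; apply/measurable_EFinP.
  exact: measurable_indic.
apply: (@le_trans _ _ (\int[mu]_(t in D) (\sum_(n <oo) (c n)%:E * (\1_(E n) t)%:E))).
  apply: ge0_le_integral => //.
  - apply: ge0_emeasurable_sum => // n t Dt _; by rewrite mule_ge0 ?lee_fin.
  - move=> t Dt; have [->|[m Em fm]] := H t Dt.
      by apply: nneseries_ge0 => n _ _; rewrite mule_ge0 ?lee_fin.
    apply: le_trans fm _.
    apply: le_trans (nneseries_lim_ge m.+1 _); last by move=> n _ _; rewrite mule_ge0 ?lee_fin.
    rewrite big_nat_recr //= indicE mem_set // mule1 leeDr //.
    by apply: sume_ge0 => n _; rewrite mule_ge0 ?lee_fin.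
rewrite integral_nneseries //; last by move=> n t Dt; rewrite mule_ge0 ?lee_fin.
rewrite le_eqVlt; apply/orP; left; apply/eqP; apply: eq_eseriesr => n _.
rewrite ge0_integralZl_EFin //.
- by rewrite integral_indic // setIC.
- by apply/measurable_EFinP; exact: measurable_indic.
Qed.

Lemma geometric_eseries_le (a q : R) : (0 <= a)%R -> (0 < q < 1)%R ->
  \sum_(n <oo) (a * q ^+ n)%:E <= (a / (1 - q))%:E.
Proof.
move=> a0 /andP[q0 q1]; apply: lime_le.
  by apply: is_cvg_nneseries => n _ _; rewrite lee_fin mulr_ge0 // exprn_ge0 // ltW.
near=> n; rewrite sumEFin lee_fin.
by apply: geometric_le_lim => //; rewrite gtr0_norm.
Unshelve. all: by end_near.
Qed.

End Covering.

Section CircleMeasure.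
Variable R : realType.
Local Notation C := (R[i]).
Local Notation N := (@ComplexField.Normc.normc R).
Local Notation mu := (@lebesgue_measure R).
Local Notation I := (`[0%R, (2 * pi)%R]%classic : set (measurableTypeR R)).

Lemma eqW_le (x y : R) : x = y -> x <= y. Proof. by move->. Qed.

Lemma lebesgue_measure_circle : mu I = (2 * pi)%:E.
Proof.
by rewrite lebesgue_measure_itv /= lte_fin mulr_gt0 ?pi_gt0 // -EFinB subr0.
Qed.

Lemma circle_lty : (mu I < +oo)%E.
Proof. by rewrite lebesgue_measure_circle ltry. Qed.

Definition cdist (w : C) (t : R) : R := N (expi t - w).

Lemma measurable_cdist w (D : set (measurableTypeR R)) : measurable_fun D (cdist w).
Proof.
apply: cmeas_normc; apply: cmeasD; last exact: cmeas_cst.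
by apply: cmeas_expi; exact: measurable_id.
Qed.

Lemma measurable_cdist_lt w s : measurable ([set t | cdist w t < s] : set (measurableTypeR R)).
Proof.
rewrite -[X in measurable X]setTI.
rewrite (_ : [set _ | _] = cdist w @^-1` `]-oo, s[%classic).
  exact: measurable_cdist.
by apply/seteqP; split => t /=; rewrite in_itv.
Qed.

Lemma measurable_cdist_le w s : measurable ([set t | s <= cdist w t] : set (measurableTypeR R)).
Proof.
rewrite -[X in measurable X]setTI.
rewrite (_ : [set _ | _] = cdist w @^-1` `[s, +oo[%classic).
  exact: measurable_cdist.
by apply/seteqP; split => t /=; rewrite in_itv /= andbT.
Qed.

(** Three intervals of radius s/k, around the three representatives of the angle of w, cover the
    sublevel set; their total length is 6 s/k. *)
Lemma cdist_sublevel : exists2 A : R, 0 < A & forall w s, N w = 1 -> 0 < s ->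
  (mu (I `&` [set t | (cdist w t < s)%R]) <= (A * s)%:E)%E.
Proof.
have [k k0 H] := dist_expi_ge R; exists (6 / k); first by rewrite divr_gt0.
move=> w s w1 s0; have [t0 t0I ->] := expi_surj w1.
have sk0 : 0 <= s / k by rewrite divr_ge0 // ltW.
pose B u := ball u (s / k) : set (measurableTypeR R).
have mB u : measurable (B u) by rewrite /B; exact: measurable_ball.
have Ble u : (mu (B u) <= (s / k *+ 2)%:E)%E by rewrite lebesgue_measure_ball.
apply: (@le_trans _ _ (mu (B (t0 - 2 * pi) `|` (B t0 `|` B (t0 + 2 * pi))))).
  apply: le_measure; rewrite ?inE.
  - by apply: measurableI; [exact: measurable_itv|exact: measurable_cdist_lt].
  - by apply: measurableU => //; apply: measurableU.
  move=> t [] /=; rewrite in_itv /= => tI ts.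
  have [u uin ku] := H t t0 tI t0I.
  have : B u t.
    rewrite /B -ball_normE /= distrC ltr_pdivlMr // mulrC.
    exact: le_lt_trans ku ts.
  by move: uin; rewrite !inE => /or3P[] /eqP -> Bt; [left|right; left|right; right].
apply: le_trans (measureU2 _ (mB _) _) _; first by apply: measurableU.
apply: le_trans (leeD (lexx _) (measureU2 _ (mB _) (mB _))) _.
apply: le_trans (leeD (Ble _) (leeD (Ble _) (Ble _))) _.
rewrite -!EFinD lee_fin !mulr2n; apply: eqW_le; field; rewrite gt_eqF //.
Qed.

(** On the n-th dyadic shell the sum r + |exp(it) - w| is at least 2^n r / 2, so the kernel is at
    most 4 (2^n r)^(-2), while the shell has measure at most A 2^n r. The products 4 A / (2^n r) sum
    to 8 A / r. *)
Lemma cdist_kernel2 : exists2 A : R, 0 < A & forall w r, N w = 1 -> 0 < r ->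
  (\int[mu]_(t in I) (((r + cdist w t) ^- 2)%R%:E) <= (A / r)%R%:E)%E.
Proof.
have [A A0 HA] := cdist_sublevel; exists (8 * A); first by rewrite mulr_gt0.
move=> w r w1 r0.
have Nge t : 0 <= cdist w t by exact: Nge0.
pose b n : R := 2 ^+ n * r.
have b0 n : 0 < b n by rewrite mulr_gt0 // exprn_gt0.
pose E n : set (measurableTypeR R) := [set t | cdist w t < b n] `&` [set t | b n / 2 - r <= cdist w t].
pose c n : R := 4 * (b n) ^- 2.
have mI : measurable I by exact: measurable_itv.
have mE n : measurable (E n).
  by apply: measurableI; [exact: measurable_cdist_lt|exact: measurable_cdist_le].
have mf : measurable_fun I (fun t => ((r + cdist w t) ^- 2)%:E).
  apply/measurable_EFinP.
  apply: (eq_measurable_fun (fun t => ((r + cdist w t) ^+ 2) `^ (-1))).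
    by move=> t _; rewrite powR_inv1 // sqr_ge0.
  apply: (measurableT_comp (measurable_powR (-1))).
  apply: measurable_funX; apply: measurable_funD; first exact: measurable_cst.
  exact: measurable_cdist.
apply: (le_trans (@integral_le_cover _ _ _ mu I _ E c mI mf _ mE _ _)).
- by move=> t _; rewrite lee_fin invr_ge0 sqr_ge0.
- by move=> n; rewrite mulr_ge0 // invr_ge0 sqr_ge0.
- move=> t _; right.
  have ex : exists n, cdist w t < b n.
    have [n nP] : exists n : nat, cdist w t / r < n%:R.
      exists (Num.truncn (cdist w t / r)).+1; exact: truncnS_gt.
    exists n; rewrite -ltr_pdivrMr // (lt_trans nP) // -natrX ltr_nat.
    exact: ltn_expl.
  have [n bn nmin] := ex_minnP ex.
  exists n; first split => //=.
    case: n bn nmin => [|n] _ nmin.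
      by rewrite /b expr0 mul1r; have := Nge t; lra.
    have : b n <= cdist w t by rewrite leNgt; apply/negP => /nmin; rewrite ltnn.
    by rewrite /b exprS; lra.
  rewrite lee_fin /c.
  have Et : b n / 2 - r <= cdist w t.
    case: n bn nmin => [|n] _ nmin.
      by rewrite /b expr0 mul1r; have := Nge t; lra.
    have : b n <= cdist w t by rewrite leNgt; apply/negP => /nmin; rewrite ltnn.
    by rewrite /b exprS; lra.
  have bb : b n / 2 <= r + cdist w t by lra.
  have -> : 4 * b n ^- 2 = (b n / 2) ^- 2 by rewrite expr_div_n invf_div; field; rewrite gt_eqF.
  rewrite lef_pV2 ?posrE ?exprn_gt0 ?divr_gt0 //; last by have := Nge t; lra.
  by apply: lerXn2r; rewrite ?nnegrE //; have := Nge t; have := b0 n; lra.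
apply: (@le_trans _ _ (\sum_(n <oo) (4 * A / r * (2^-1) ^+ n)%:E)%E).
  apply: lee_nneseries => [n _ _|n _]; first by rewrite mule_ge0 // lee_fin mulr_ge0 // invr_ge0 sqr_ge0.
  apply: (@le_trans _ _ ((c n)%:E * (A * b n)%:E)%E).
    apply: lee_wpmul2l; first by rewrite lee_fin mulr_ge0 // invr_ge0 sqr_ge0.
    apply: le_trans (HA w (b n) w1 (b0 n)); apply: le_measure; rewrite ?inE.
    - exact: measurableI.
    - by apply: measurableI => //; exact: measurable_cdist_lt.
    - by move=> t [It [Et _]].
  rewrite -EFinM lee_fin /c /b exprVn.
  apply: eqW_le.
  by field; rewrite !gt_eqF // exprn_gt0.
apply: (le_trans (geometric_eseries_le _ _)).
- by rewrite divr_ge0 ?mulr_ge0 // ltW.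
- by apply/andP; split; lra.
by rewrite lee_fin; apply: eqW_le; field; rewrite gt_eqF.
Qed.

(** For b < 0, the shells of radius about 2^(-n) have measure O(2^(-n)) and the integrand is
    O(2^(-nb)) there; the resulting series has ratio 2^(-(b+1)) < 1. For b >= 0 the integrand is
    bounded. *)
Lemma cdist_power (w : C) (b : R) : N w = 1 -> - 1 < b ->
  (\int[mu]_(t in I) ((cdist w t `^ b)%R%:E) < +oo)%E.
Proof.
move=> w1 b1.
have Nge t : 0 <= cdist w t by exact: Nge0.
have Nle t : cdist w t <= 2.
  by apply: (le_trans (NB _ _)); rewrite N_expi w1; lra.
have mI : measurable I by exact: measurable_itv.
have mf : measurable_fun I (fun t => (cdist w t `^ b)%:E).
  apply/measurable_EFinP; apply: (measurableT_comp (measurable_powR b)).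
  exact: measurable_cdist.
have [b0|b0] := leP 0 b.
  apply: (@le_lt_trans _ _ (\int[mu]_(t in I) ((2 `^ b)%R%:E))%E).
    apply: ge0_le_integral => //.
    - by move=> t _; rewrite lee_fin powR_ge0.
    - by move=> t _; rewrite lee_fin ge0_ler_powR ?nnegrE.
  rewrite integral_cst //; apply: lte_mul_pinfty; rewrite ?lee_fin ?powR_ge0 //.
  exact: circle_lty.
have [A A0 HA] := cdist_sublevel.
pose l n : R := 2 * (2^-1) ^+ n.
have l0 n : 0 < l n by rewrite mulr_gt0 // exprn_gt0.
pose E n : set (measurableTypeR R) := [set t | cdist w t < 2 * l n] `&` [set t | l n <= cdist w t].
pose c n : R := l n `^ b.
have mE n : measurable (E n).
  by apply: measurableI; [exact: measurable_cdist_lt|exact: measurable_cdist_le].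
apply: (le_lt_trans (@integral_le_cover _ _ _ mu I _ E c mI mf _ mE _ _)).
- by move=> t _; rewrite lee_fin powR_ge0.
- by move=> n; exact: powR_ge0.
- move=> t _; have := Nge t; rewrite le_eqVlt => /orP[/eqP <-|t0].
    (* At the singular point [powR] takes the value 0 for a nonzero exponent, so no shell has to
       contain it. *)
    by left; rewrite powR0 // lt_eqF.
  right.
  have ex : exists n, l n <= cdist w t.
    have [n nP] : exists n : nat, 2 / cdist w t < n%:R.
      exists (Num.truncn (2 / cdist w t)).+1; exact: truncnS_gt.
    exists n; rewrite /l exprVn ler_pdivrMr ?exprn_gt0 // mulrC -ler_pdivrMr //.
    by rewrite (le_trans (ltW nP)) // -natrX ler_nat ltnW // ltn_expl.
  have [n ln nmin] := ex_minnP ex.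
  have ln2 : cdist w t < 2 * l n.
    case: n ln nmin => [|n] _ nmin.
      by rewrite /l expr0; have := Nle t; lra.
    have -> : 2 * l n.+1 = l n by rewrite /l exprS; field.
    by rewrite ltNge; apply/negP => /nmin; rewrite ltnn.
  exists n => //; rewrite lee_fin /c.
  have bE x : x `^ b = (x `^ (- b))^-1 by rewrite -powRN opprK.
  rewrite !bE lef_pV2 ?posrE ?powR_gt0 //.
  by rewrite ge0_ler_powR ?nnegrE ?oppr_ge0 // ltW.
pose q : R := (2^-1) `^ (b + 1).
have q0 : 0 < q by rewrite powR_gt0.
have q1 : q < 1.
  have := @gt0_ltr_powR R (b + 1) _ 2^-1 1; rewrite powR1; apply; rewrite ?nnegrE //; lra.
apply: (@le_lt_trans _ _ (\sum_(n <oo) (4 * A * 2 `^ b * q ^+ n)%:E)%E).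
  apply: lee_nneseries => [n _ _|n _]; first by rewrite mule_ge0 // lee_fin powR_ge0.
  apply: (@le_trans _ _ ((c n)%:E * (A * (2 * l n))%:E)%E).
    apply: lee_wpmul2l; first by rewrite lee_fin powR_ge0.
    have l20 : 0 < 2 * l n by rewrite mulr_gt0.
    apply: le_trans (HA w _ w1 l20); apply: le_measure; rewrite ?inE.
    - exact: measurableI.
    - by apply: measurableI => //; exact: measurable_cdist_lt.
    - by move=> t [It [Et _]].
  rewrite -EFinM lee_fin /c /l /q powRM ?exprn_ge0 ?invr_ge0 //.
  rewrite -!powR_mulrn ?powR_ge0 ?invr_ge0 // -!powRrM [(b + 1) * _]mulrC mulrDr mulr1 powRD; last first.
    by rewrite invr_eq0 pnatr_eq0 implybT.
  by apply: eqW_le; ring.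
apply: (le_lt_trans (geometric_eseries_le _ _)); rewrite ?ltry ?q0 //.
by rewrite !mulr_ge0 ?powR_ge0 // ltW.
Qed.

(** The arc is taken on only one side of w, to the right or to the left according to the angle of w,
    so that it stays inside the parameter interval; being open, it avoids w itself. *)
Lemma arc (w : C) (r : R) : N w = 1 -> 0 < r <= 1 -> exists a : R,
  [/\ 0 <= a, a + r <= 2 * pi & forall t, a < t < a + r -> 0 < cdist w t <= r].
Proof.
move=> w1 /andP[r0 r1]; have [t0 /andP[t00 t02] ->] := expi_surj w1.
have pi2 := pi_ge2 R.
have [k k0 H] := norm_sin_ge R.
have key t : t != t0 -> `|t - t0| <= r -> 0 < cdist (expi t0) t <= r.
  move=> tt0 tr; apply/andP; split; last exact: le_trans (dist_expi_le _ _) tr.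
  rewrite /cdist dist_expi mulr_gt0 //.
  have E : `|(t - t0) / 2| = `|t - t0| / 2 by rewrite normrM [`|2^-1|]ger0_norm.
  apply: lt_le_trans (H _ _); rewrite E; last by lra.
  by rewrite mulr_gt0 // divr_gt0 // normr_gt0 subr_eq0.
have [t0p|t0p] := leP t0 pi.
  exists t0; split => //; first by lra.
  move=> t /andP[u v]; apply: key; first by rewrite gt_eqF.
  by rewrite ger0_norm; lra.
exists (t0 - r); split; try lra.
move=> t /andP[u v]; apply: key; first by rewrite lt_eqF //; lra.
by rewrite ler0_norm; lra.
Qed.

End CircleMeasure.

(** * The derivative of the quotient as a function on the torus *)

Section QuotientDerivative.
Variable F : numFieldType.
Implicit Types (a b : {poly F}) (x : F).

Lemma is_derive_horner a x : is_derive (x : F^o) 1 (fun w : F^o => a.[w] : F^o) a^`().[x].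
Proof.
elim/poly_ind: a => [|a c IH].
  rewrite deriv0 horner0 (_ : (fun _ => _) = cst (0 : F^o)); first exact: is_derive_cst.
  by apply/funext => w; rewrite horner0.
rewrite (_ : (fun _ => _) = (fun w : F^o => a.[w] : F^o) * (id : F^o -> F^o) + cst (c : F^o)); last first.
  by apply/funext => w; rewrite hornerMXaddC.
have D := is_deriveD (is_deriveM IH (@is_derive_id F F^o x 1)) (@is_derive_cst F F^o F^o c x 1).
apply: (is_derive_eq D); rewrite derivD derivC addr0 derivM derivX mulr1.
by rewrite addr0 hornerD hornerMX addrC; congr (_ + _); [exact: mulrC|exact: mulr1].
Qed.

Lemma derive1_poly_quotient a b x : b.[x] != 0 ->
  derive1 (fun w : F => a.[w] / b.[w] : F^o) x =
  (a^`().[x] * b.[x] - a.[x] * b^`().[x]) / b.[x] ^+ 2.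
Proof.
move=> b0; have [da Da] := is_derive_horner a x; have [db Db] := is_derive_horner b x.
have dV := derivableV b0 db.
rewrite derive1E; apply: (etrans (deriveM da dV)).
rewrite (deriveV b0 db) Da Db /GRing.scale /=; field.
exact: b0.
Qed.

End QuotientDerivative.

Lemma dz1_quotientE (R : realType) (p q : {poly {poly R[i]}}) (x y : R[i]) : p.[x, y] != 0 ->
  dz1_quotient q p (x, y) = (wronskian p q).[x, y] / p.[x, y] ^+ 2.
Proof.
move=> pxy; rewrite /dz1_quotient /=.
pose a := (swapXY q).[y%:P]; pose b := (swapXY p).[y%:P].
have bx : b.[x] != 0 by rewrite /b horner2_swapXY.
rewrite (_ : (fun w : R[i] => q.[w, y] / p.[w, y]) = (fun w => a.[w] / b.[w])); last first.
  by apply/funext => w; rewrite /a /b !horner2_swapXY.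
apply: (etrans (derive1_poly_quotient a bx)).
rewrite /a /b !deriv_slice1 !horner2_swapXY.
by rewrite /wronskian horner2B !horner2M.
Qed.

Section TorusMeasurability.
Variable R : realType.
Local Notation C := (R[i]).
Local Notation N := (@ComplexField.Normc.normc R).
Local Notation I := (`[0%R, (2 * pi)%R]%classic : set (measurableTypeR R)).
Local Notation T2 := (measurableTypeR R * measurableTypeR R)%type.

Lemma expi_fiber_finite (w : C) : finite_set [set t : R | 0 <= t <= 2 * pi /\ expi t = w].
Proof.
have [k k0 H] := dist_expi_ge R.
have [[t0 [t0I t0w]]|none] := pselect (exists t : R, 0 <= t <= 2 * pi /\ expi t = w); last first.
  rewrite (_ : [set _ | _] = set0) //.
  by apply/seteqP; split => t // [h1 h2]; apply: none; exists t.
apply: (@sub_finite_set _ _ [set` [:: t0 - 2 * pi; t0; t0 + 2 * pi]]); last exact: finite_seq.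
move=> t [tI tw] /=; have [u uin] := H t t0 tI t0I.
rewrite tw t0w subrr N0 pmulr_rle0 // normr_le0 subr_eq0 => /eqP ->; exact: uin.
Qed.

Lemma measurable_finite2 (Z : set T2) : finite_set Z -> measurable Z.
Proof.
move=> /finite_set_countable; apply: countable_measurable => -[a b].
rewrite (_ : [set (a, b)] = [set a] `*` [set b]); first exact: measurableX.
by apply/seteqP; split => -[u v] /=; [move=> [-> ->]|move=> [-> ->]].
Qed.

(** The quotient rule describes the derivative only off the zeros of p. On a finite set every
    function is measurable, so these values do no harm. *)
Lemma measurable_fun_off_finite (D Z : set T2) (f g : T2 -> R) :
  measurable D -> finite_set Z -> measurable_fun D g ->
  (forall t, D t -> ~ Z t -> f t = g t) -> measurable_fun D f.
Proof.
move=> mD fZ mg fg; have mZ := measurable_finite2 fZ.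
rewrite (_ : D = (D `&` ~` Z) `|` (D `&` Z)); last first.
  by rewrite -setIUr setUC setUv setIT.
apply/measurable_funU; [exact: measurableI (measurableC _)|exact: measurableI|split].
  apply: (eq_measurable_fun g); first by move=> t; rewrite inE => -[Dt Zt]; rewrite fg.
  apply: (measurable_funS mD) mg; exact: subIsetl.
move=> _ Y _; apply: measurable_finite2; apply: sub_finite_set fZ.
by move=> t [[]].
Qed.

End TorusMeasurability.

Section Tonelli.
Context d1 d2 (T1 : measurableType d1) (T2 : measurableType d2) (R : realType).
Variables (m1 : {sigma_finite_measure set T1 -> \bar R}) (m2 : {sigma_finite_measure set T2 -> \bar R}).
Variables (D1 : set T1) (D2 : set T2) (f : T1 * T2 -> \bar R).
Hypotheses (mD1 : measurable D1) (mD2 : measurable D2).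
Hypothesis mf : measurable_fun (D1 `*` D2) f.
Hypothesis f0 : forall t, (0 <= f t)%E.
Local Open Scope ereal_scope.

Let h := f \_ (D1 `*` D2).

Let mh : measurable_fun setT h.
Proof. by apply/(measurable_restrictT _ _).1 => //; exact: measurableX. Qed.

Let h0 t : 0 <= h t.
Proof. by rewrite /h patchE; case: ifP. Qed.

Let hE : fubini_F m2 h = (fun x => \int[m2]_(y in D2) f (x, y)) \_ D1.
Proof.
apply/funext => x; rewrite /fubini_F patchE; case: ifPn => [xD|xD].
  rewrite [RHS]integral_mkcond; apply: eq_integral => y _.
  rewrite /h !patchE; congr (if _ then _ else _).
  by apply/idP/idP; rewrite !inE /=; [case|move=> yD; split=> //; rewrite inE in xD].
rewrite integral0_eq // => y _; rewrite /h patchE ifN //.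
by apply: contra xD; rewrite !inE => -[].
Qed.

Lemma tonelli_rectangle :
  \int[m1 \x m2]_(t in D1 `*` D2) f t = \int[m1]_(x in D1) \int[m2]_(y in D2) f (x, y).
Proof. by rewrite integral_mkcond fubini_tonelli1 // hE -integral_mkcond. Qed.

Lemma measurable_fun_section_integral :
  measurable_fun D1 (fun x => \int[m2]_(y in D2) f (x, y)).
Proof.
have : measurable_fun setT (fubini_F m2 h) by exact: measurable_fun_fubini_tonelli_F.
by rewrite hE => H; exact: ((measurable_restrictT _ mD1).2 H).
Qed.

End Tonelli.

Section LowerBound.
Variable R : realType.
Local Notation C := (R[i]).
Local Notation N := (@ComplexField.Normc.normc R).

Lemma lipschitz2_continuous (f : R * R -> R) (L : R) :
  (forall s t, `|f s - f t| <= L * (`|s.1 - t.1| + `|s.2 - t.2|)) -> continuous f.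
Proof.
move=> H s; have L0 : 0 < `|L| + 1 by rewrite ltr_wpDl.
apply/cvgrPdist_lt => e e0.
pose r := e / (2 * (`|L| + 1)).
have r0 : 0 < r by rewrite divr_gt0 // mulr_gt0.
near=> t.
have [st1 st2] : `|s.1 - t.1| < r /\ `|s.2 - t.2| < r.
  near: t; exists ([set u | `|s.1 - u| < r], [set u | `|s.2 - u| < r]) => /=.
    by split; apply/nbhs_ballP; exists r => // u; rewrite -ball_normE.
  by move=> [u v] [].
apply: (le_lt_trans (H s t)).
set a := `|_| in st1 *; set b := `|s.2 - _| in st2 *.
have a0 : 0 <= a by exact: normr_ge0.
have b0 : 0 <= b by exact: normr_ge0.
apply: (@le_lt_trans _ _ ((`|L| + 1) * (a + b))).
  by apply: ler_wpM2r; [exact: addr_ge0|have := ler_norm L; lra].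
have : (`|L| + 1) * (a + b) < (`|L| + 1) * (r + r).
  by rewrite ltr_pM2l // ltrD.
suff -> : (`|L| + 1) * (r + r) = e by [].
by rewrite /r; field; rewrite gt_eqF.
Unshelve. all: by end_near.
Qed.

Lemma lipschitz_max0 (x y : R) : `|Num.max 0 x - Num.max 0 y| <= `|x - y|.
Proof.
wlog xy : x y / x <= y.
  move=> H; case/orP: (le_total x y) => h; first exact: H.
  by rewrite distrC [X in _ <= X]distrC; exact: H.
have [x0|x0] := leP 0 x; have [y0|y0] := leP 0 y; try lra.
- by rewrite !ler0_norm; lra.
- by rewrite subrr normr0.
Qed.

(** Instead of minimizing |p| over the complement of the neighbourhoods, the function |p| plus the
    bumps max(0, d j - distance to tau j) is minimized over the whole square. It is positive
    everywhere, and at a far point all bumps vanish, so it equals |p| there. *)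
Lemma torus_lower_bound (p : {poly {poly C}}) m (tau : 'I_m -> C * C) (d : 'I_m -> R) :
  (forall z, torus z -> p.[z.1, z.2] = 0 -> exists j, z = tau j) ->
  (forall j, 0 < d j) -> exists2 c : R, 0 < c & forall x y : C, N x = 1 -> N y = 1 ->
  (forall j, d j <= N (x - (tau j).1) \/ d j <= N (y - (tau j).2)) -> c <= N p.[x, y].
Proof.
move=> zeros d0.
pose chi j (t : R * R) := Num.max 0 (d j - N (expi t.1 - (tau j).1) - N (expi t.2 - (tau j).2)).
pose psi (t : R * R) := N p.[expi t.1, expi t.2] + \sum_(j < m) chi j t.
have [L L0 HL] := poly2_lip 1 p.
have chi0 j t : 0 <= chi j t by rewrite le_max lexx.
have Ndist (a b c : C) : `|N (a - c) - N (b - c)| <= N (a - b).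
  rewrite ler_norml; apply/andP; split; have := Ntri a b c; have := Ntri b a c; rewrite (NBC b a); lra.
have psic : continuous psi.
  apply: (@lipschitz2_continuous _ (L + m%:R)) => s t.
  have -> : psi s - psi t = (N p.[expi s.1, expi s.2] - N p.[expi t.1, expi t.2]) +
      \sum_(j < m) (chi j s - chi j t) by rewrite sumrB /psi; ring.
  rewrite mulrDl (le_trans (ler_normD _ _)) // lerD //.
    apply: (@le_trans _ _ (N (p.[expi s.1, expi s.2] - p.[expi t.1, expi t.2]))).
      by have := Ndist p.[expi s.1, expi s.2] p.[expi t.1, expi t.2] 0; rewrite !subr0.
    apply: (le_trans (HL _ _ _ _ _ _ _ _)); rewrite ?N_expi // ler_pM2l //.
    by apply: lerD; exact: dist_expi_le.
  apply: (le_trans (ler_norm_sum _ _ _)).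
  rewrite mulr_natl -[X in _ *+ X]card_ord -sumr_const; apply: ler_sum => j _.
  apply: (le_trans (lipschitz_max0 _ _)).
  set a1 := N (expi s.1 - _); set a2 := N (expi s.2 - _).
  set b1 := N (expi t.1 - _); set b2 := N (expi t.2 - _).
  have -> : d j - a1 - a2 - (d j - b1 - b2) = (b1 - a1) + (b2 - a2) by ring.
  apply: (le_trans (ler_normD _ _)); apply: lerD.
    by rewrite distrC (le_trans (Ndist _ _ _)) // dist_expi_le.
  by rewrite distrC (le_trans (Ndist _ _ _)) // dist_expi_le.
have pi0 := pi_gt0 R.
pose Q : set (R * R) := `[0, 2 * pi]%classic `*` `[0, 2 * pi]%classic.
have cQ : compact Q by apply: compact_setX; exact: segment_compact.
have Q0 : Q !=set0.
  by exists (0, 0); split; rewrite /= in_itv /= lexx mulr_ge0 // ltW.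
have [t tQ tmin] := compact_EVT_min Q0 cQ (continuous_subspaceT psic).
have psi_gt0 : 0 < psi t.
  have [p0|p0] := eqVneq p.[expi t.1, expi t.2] 0; last first.
    by rewrite ltr_wpDr ?sumr_ge0 // N_gt0.
  have [|j tj] := zeros (expi t.1, expi t.2) _ p0.
    by split; apply/norm_eq1; rewrite N_expi.
  rewrite /psi p0 N0 add0r (bigD1 j) //= ltr_wpDr ?sumr_ge0 //.
  have e1 : N (expi t.1 - (tau j).1) = 0 by rewrite -tj subrr N0.
  have e2 : N (expi t.2 - (tau j).2) = 0 by rewrite -tj subrr N0.
  by rewrite /chi e1 e2 !subr0 lt_max d0 orbT.
exists (psi t) => // x y x1 y1 far.
have [a aI xa] := expi_surj x1; have [b bI yb] := expi_surj y1.
rewrite xa yb in far *.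
have : (a, b) \in Q by rewrite inE; split; rewrite /= in_itv.
move/tmin => h; apply: (le_trans h); rewrite /psi /= big1 ?addr0 // => j _.
apply/max_idPl; have := far j.
have := Nge0 (expi a - (tau j).1); have := Nge0 (expi b - (tau j).2).
by move=> u v [] ?; lra.
Qed.

End LowerBound.

(** * Integrability of the derivative *)

Section Integrability.
Variable R : realType.
Local Notation C := (R[i]).
Local Notation N := (@ComplexField.Normc.normc R).
Local Notation mu := (@lebesgue_measure R).
Local Notation I := (`[0%R, (2 * pi)%R]%classic : set (measurableTypeR R)).
Local Notation T2 := (measurableTypeR R * measurableTypeR R)%type.
Variables (p q : {poly {poly C}}) (m : nat) (tau : 'I_m -> C * C).
Variables (K e : 'I_m -> nat) (g : 'I_m -> {poly C}).
Hypothesis tau_zeros : forall z : C * C, (torus z /\ p.[z.1, z.2] = 0) <-> exists j, z = tau j.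
Hypothesis branch_g : forall j, branch p (tau j).1 (tau j).2 (K j) (g j).
Hypothesis qp : forall x y : C, N x = 1 -> N y = 1 -> N q.[x, y] <= N p.[x, y].
Hypothesis order_e : forall j, branch_order q (tau j).1 (K j) (g j) (e j).

Lemma tau_torus j : N (tau j).1 = 1 /\ N (tau j).2 = 1.
Proof.
have [_ /(_ (ex_intro _ j erefl)) [[h1 h2] _]] := tau_zeros (tau j).
by split; apply/norm_eq1.
Qed.

Definition local_majorant j (x y : C) : R := N (x - (tau j).1) ^+ e j /
  (N (x - (tau j).1) ^+ K j + N (y - phase (g j).[x])) ^+ 2.

(** Near some tau j this is [local_upper]; away from all of them |p| is bounded below by compactness
    and W / p^2 is bounded. Only finitely many x on the circle are excluded. *)
Lemma quotient_derivative_bound : exists2 M : R, 0 < M & forall x y : C, N x = 1 -> N y = 1 ->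
  (forall j, x != (tau j).1) -> p.[x, y] != 0 /\
  let F := N ((wronskian p q).[x, y] / p.[x, y] ^+ 2) in
  (F <= M \/ exists j, F <= M * (1 + local_majorant j x y)).
Proof.
have loc j : exists dM : R * R, [/\ 0 < dM.1, 0 < dM.2 & forall x y : C, N x = 1 -> N y = 1 ->
    0 < N (x - (tau j).1) < dM.1 -> N (y - (tau j).2) < dM.1 ->
    p.[x, y] != 0 /\ N ((wronskian p q).[x, y] / p.[x, y] ^+ 2) <= dM.2 * (1 + local_majorant j x y)].
  have [t1 t2] := tau_torus j.
  have [d [M [/andP[d0 _] M0 H]]] := local_upper t1 t2 (branch_g j) qp (order_e j).
  exists (d, M); split => // x y x1 y1 xd yd.
  have [_ p0 W] := H x y x1 y1 xd yd; split => //.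
  by rewrite Nf NX ler_pdivrMr // exprn_gt0 // N_gt0.
have {loc} [dM loc] := choice loc.
have zer z : torus z -> p.[z.1, z.2] = 0 -> exists j, z = tau j.
  by move=> tz pz; apply/tau_zeros.
have d0 j : 0 < (dM j).1 by case: (loc j).
have [c c0 far] := torus_lower_bound zer d0.
have [B B0 HB] := poly2_bound 1 (wronskian p q).
pose M := B / c ^+ 2 + \sum_j (dM j).2.
have M0 : 0 <= \sum_j (dM j).2 by apply: sumr_ge0 => j _; case: (loc j) => _ /ltW.
have Bc0 : 0 < B / c ^+ 2 by rewrite divr_gt0 ?exprn_gt0.
exists M; first by rewrite ltr_wpDr.
move=> x y x1 y1 xn; split.
  apply/eqP => pxy; have [|j xj] := zer (x, y) _ pxy; first by split; apply/norm_eq1.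
  by have := xn j; rewrite -xj eqxx.
have [[j [jx jy]]|nofar] := pselect (exists j, N (x - (tau j).1) < (dM j).1 /\ N (y - (tau j).2) < (dM j).1).
  right; exists j; have [_ M2 H] := loc j.
  have [|_ F] := H x y x1 y1 _ jy; first by rewrite jx N_gt0 subr_eq0 xn.
  apply: (le_trans F); apply: ler_wpM2r.
    by rewrite addr_ge0 // divr_ge0 ?exprn_ge0 ?addr_ge0 ?Nge0 ?exprn_ge0 ?Nge0.
  rewrite /M (bigD1 j) //=.
  have : 0 <= \sum_(i < m | i != j) (dM i).2 by apply: sumr_ge0 => i _; case: (loc i) => _ /ltW.
  by lra.
left; have pc : c <= N p.[x, y].
  apply: far => // j; have [h|h] := leP (dM j).1 (N (x - (tau j).1)); first by left.
  right; rewrite leNgt; apply/negP => h2; apply: nofar; by exists j.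
rewrite Nf NX; apply: (@le_trans _ _ (B / c ^+ 2)); last by rewrite lerDl.
apply: ler_pM; rewrite ?Nge0 ?invr_ge0 ?exprn_ge0 ?Nge0 //; first by apply: HB; rewrite ?x1 ?y1.
rewrite lef_pV2 ?posrE ?exprn_gt0 ?(lt_le_trans c0 pc) //.
by apply: lerXn2r; rewrite ?nnegrE ?Nge0 // ltW.
Qed.

Definition torus_derivative (t : T2) : C := dz1_quotient q p (expi t.1, expi t.2).

Let Q : set T2 := I `*` I.

Lemma torus_derivative_finite_exception : exists2 Z : set T2, finite_set Z & forall t, Q t -> ~ Z t ->
  torus_derivative t = (wronskian p q).[expi t.1, expi t.2] / p.[expi t.1, expi t.2] ^+ 2.
Proof.
pose Z : set T2 := \bigcup_(j in [set: 'I_m])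
  ([set s : R | 0 <= s <= 2 * pi /\ expi s = (tau j).1] `*` [set s : R | 0 <= s <= 2 * pi /\ expi s = (tau j).2]).
exists Z.
  apply: bigcup_finite; first exact: finite_finset.
  by move=> j _; apply: finite_setX; exact: expi_fiber_finite.
move=> t [/= t1 t2] Zt; apply: dz1_quotientE; apply/eqP => p0; apply: Zt.
rewrite /= !in_itv /= in t1 t2.
have [|j tj] := proj1 (tau_zeros (expi t.1, expi t.2)); first by split=> //; split; apply/norm_eq1; rewrite N_expi.
by exists j => //; rewrite /= -tj.
Qed.

Lemma cmeas_torus_derivative : cmeas Q torus_derivative.
Proof.
have mQ : measurable Q by apply: measurableX; exact: measurable_itv.
have [Z fZ H] := torus_derivative_finite_exception.
have cm (D : set T2) : cmeas D (fun t => (wronskian p q).[expi t.1, expi t.2] / p.[expi t.1, expi t.2] ^+ 2).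
  have e1 : cmeas D (fun t : T2 => expi t.1) by apply: cmeas_expi; apply: measurable_funTS; exact: measurable_fst.
  have e2 : cmeas D (fun t : T2 => expi t.2) by apply: cmeas_expi; apply: measurable_funTS; exact: measurable_snd.
  apply: cmeasM; first exact: cmeas_horner2.
  apply: cmeasV; rewrite (_ : (fun _ => _) = fun t : T2 => p.[expi t.1, expi t.2] * p.[expi t.1, expi t.2]).
    by apply: cmeasM; exact: cmeas_horner2.
  by apply/funext => t; rewrite expr2.
have [c1 c2] := cm Q.
by split; [apply: measurable_fun_off_finite mQ fZ c1 _|apply: measurable_fun_off_finite mQ fZ c2 _];
  move=> t Qt Zt; rewrite H.
Qed.

Definition derivative_density (r : R) (t : T2) : \bar R := (N (torus_derivative t) `^ r)%:E.

Lemma measurable_derivative_density r : measurable_fun Q (derivative_density r).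
Proof.
apply/measurable_EFinP; apply: (measurableT_comp (measurable_powR r)).
exact: cmeas_normc cmeas_torus_derivative.
Qed.

Lemma in_Lp_torusE r :
  in_Lp_torus r (dz1_quotient q p) <-> (\int[(mu \x mu)%E]_(t in Q) derivative_density r t < +oo)%E.
Proof.
split; first by case.
by move=> H; have [h1 h2] := cmeas_torus_derivative; split.
Qed.

End Integrability.

Section IntegralBounds.
Context d (T : measurableType d) (R : realType) (mu : {measure set T -> \bar R}).
Local Open Scope ereal_scope.

Lemma integral_affine_le (D : set T) m (c0 V : R) (c B : 'I_m -> R) (k : 'I_m -> T -> R) :
  measurable D -> (0 <= c0)%R -> (forall j, 0 <= c j)%R ->
  (forall j, measurable_fun D (k j)) -> (forall j t, 0 <= k j t)%R ->
  mu D <= V%:E -> (forall j, \int[mu]_(t in D) (k j t)%:E <= (B j)%:E) ->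
  \int[mu]_(t in D) (c0 + \sum_j c j * k j t)%R%:E <= (c0 * V + \sum_j c j * B j)%R%:E.
Proof.
move=> mD c00 c_ge0 mk k0 DV kB.
under eq_integral => t _ do rewrite EFinD -sumEFin.
have mkE j : measurable_fun D (fun t => (c j * k j t)%:E).
  by apply/measurable_EFinP; apply: measurable_funM => //; exact: measurable_cst.
have ck0 j t : 0 <= (c j * k j t)%:E by rewrite lee_fin mulr_ge0.
rewrite ge0_integralD //; last 2 first.
- by move=> t _; apply: sume_ge0.
- exact: emeasurable_sum.
rewrite integral_cst // ge0_integral_sum // EFinD -sumEFin; apply: leeD.
  by rewrite EFinM; apply: lee_wpmul2l; rewrite ?lee_fin.
apply: lee_sum => j _.
under eq_integral => t _ do rewrite EFinM.
rewrite ge0_integralZl_EFin //.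
- by rewrite EFinM; apply: lee_wpmul2l; rewrite ?lee_fin.
- by move=> t _; rewrite lee_fin.
- by apply/measurable_EFinP.
Qed.

Lemma integral_ge_cst (D S : set T) (f : T -> \bar R) (v : R) :
  measurable D -> measurable S -> measurable_fun D f -> (forall t, D t -> 0 <= f t) ->
  S `<=` D -> (0 <= v)%R -> (forall t, S t -> v%:E <= f t) ->
  v%:E * mu S <= \int[mu]_(t in D) f t.
Proof.
move=> mD mS mf f0 SD v0 H.
apply: (@le_trans _ _ (\int[mu]_(t in S) f t)); last exact: ge0_subset_integral.
rewrite -integral_cst //; apply: ge0_le_integral => //.
exact: measurable_funS mf.
Qed.

End IntegralBounds.

Section Integrability.
Variable R : realType.
Local Notation C := (R[i]).
Local Notation N := (@ComplexField.Normc.normc R).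
Local Notation mu := (@lebesgue_measure R).
Local Notation I := (`[0%R, (2 * pi)%R]%classic : set (measurableTypeR R)).
Local Notation T2 := (measurableTypeR R * measurableTypeR R)%type.

(** The exponents in the inner integral add up as -k (r - 1) + e - K = K - k r, where e = 2K - k;
    the factor h^(-K) comes from [cdist_kernel2] with radius h^K. *)
Lemma powR_exponent (h r : R) (K e k : nat) : 0 < h -> (k + e = 2 * K)%N ->
  (h ^+ k)^-1 `^ (r - 1) * h ^+ e / h ^+ K = h `^ (K%:R - k%:R * r).
Proof.
move=> h0 ke; have h00 := ltW h0.
have hn0 : h != 0 by rewrite gt_eqF.
have ker : e%:R = 2 * K%:R - k%:R :> R.
  by rewrite -natrM -ke natrD [k%:R + _]addrC addrK.
rewrite -!powR_mulrn // -!powRN -powRrM -!powRD ?hn0 ?implybT //.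
by congr (_ `^ _); rewrite ker; ring.
Qed.

(** Write r = (r - 1) + 1 and bound only the power r - 1, by the maximum h^(e - 2K) = h^(-k) of the
    majorant. The remaining factor D^(-2) does not depend on r, so a single kernel estimate serves
    all exponents. *)
Lemma majorant_power (h D r : R) (K e k : nat) : 0 < h -> (k + e = 2 * K)%N -> 1 <= r ->
  h ^+ K <= D ->
  (h ^+ e / D ^+ 2) `^ r <= (h ^+ k)^-1 `^ (r - 1) * h ^+ e * D ^- 2.
Proof.
move=> h0 ke r1 hD; have hK : 0 < h ^+ K by rewrite exprn_gt0.
have D0 : 0 < D by exact: lt_le_trans hD.
have he : 0 < h ^+ e by rewrite exprn_gt0.
have T0 : 0 < h ^+ e / D ^+ 2 by rewrite divr_gt0 // exprn_gt0.
have TE : (h ^+ e / D ^+ 2) `^ r = (h ^+ e / D ^+ 2) `^ (r - 1) * (h ^+ e / D ^+ 2).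
  by rewrite -[in LHS](subrK 1 r) [LHS]powRD ?(gt_eqF T0) ?implybT // powRr1 // ltW.
rewrite TE -mulrA.
rewrite ler_pM2r // ge0_ler_powR ?nnegrE ?subr_ge0 ?(ltW T0) ?invr_ge0 ?exprn_ge0 ?(ltW h0) //.
rewrite ler_pdivrMr ?exprn_gt0 // mulrC ler_pdivlMr ?exprn_gt0 //.
rewrite -exprD addnC ke mulnC exprM lerXn2r ?nnegrE // ltW //.
Qed.

Variables (p q : {poly {poly C}}) (m : nat) (tau : 'I_m -> C * C).
Variables (K e : 'I_m -> nat) (g : 'I_m -> {poly C}).
Hypothesis tau_zeros : forall z : C * C, (torus z /\ p.[z.1, z.2] = 0) <-> exists j, z = tau j.
Hypothesis branch_g : forall j, branch p (tau j).1 (tau j).2 (K j) (g j).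
Hypothesis qp : forall x y : C, N x = 1 -> N y = 1 -> N q.[x, y] <= N p.[x, y].
Hypothesis order_e : forall j, branch_order q (tau j).1 (K j) (g j) (e j).

Local Notation k j := (2 * K j - e j)%N.

Let ke j : (k j + e j = 2 * K j)%N.
Proof. by rewrite subnK //; case: (order_e j). Qed.

Let tau1 j : N (tau j).1 = 1. Proof. by case: (tau_torus tau_zeros j). Qed.

Let mI : measurable I. Proof. exact: measurable_itv. Qed.

Let muI : (mu I <= (2 * pi)%:E)%E. Proof. by rewrite lebesgue_measure_circle. Qed.

Lemma measurable_derivative_density_section r x : I x -> measurable_fun I (fun y => derivative_density p q r (x, y)).
Proof.
move=> Ix; apply: (measurable_comp _ _ (measurable_derivative_density q tau_zeros r)).
- by apply: measurableX; exact: measurable_itv.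
- by move=> t [y Iy <-].
- by apply: measurable_funTS; exact: pair1_measurable.
Qed.

Lemma inner_integral_le (r : R) : 1 <= r -> exists2 B : R, 0 <= B & forall x : R, I x ->
  (forall j, expi x != (tau j).1) ->
  (\int[mu]_(y in I) derivative_density p q r (x, y) <=
    (B + \sum_j B * cdist (tau j).1 x `^ ((K j)%:R - (k j)%:R * r))%R%:E)%E.
Proof.
move=> r1; have r0 : 0 <= r by lra.
have [M M0 HM] := quotient_derivative_bound tau_zeros branch_g qp order_e.
have [A A0 HA] := cdist_kernel2 R.
have pi0 := pi_gt0 R.
have pp : 0 <= 2 * pi :> R by lra.
(* The factor 2 serves (M (1 + t))^r <= (2 M)^r (1 + t^r), proved by separating t <= 1 from t >
   1. *)
pose B0 : R := (2 * M) `^ r; have B00 : 0 <= B0 by exact: powR_ge0.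
exists (B0 * (2 * pi) + B0 * A) => [|x Ix xn].
  by rewrite addr_ge0 // mulr_ge0 // ?mulr_ge0 // ltW.
pose h j := cdist (tau j).1 x.
have h0 j : 0 < h j by rewrite /h /cdist N_gt0 subr_eq0.
pose w j := phase (g j).[expi x].
pose a j := (h j ^+ k j)^-1 `^ (r - 1) * h j ^+ e j.
have a0 j : 0 <= a j by rewrite mulr_ge0 ?powR_ge0 // exprn_ge0 // ltW.
pose kap j y := (h j ^+ K j + cdist (w j) y) ^- 2.
have kap0 j y : 0 <= kap j y by rewrite invr_ge0 sqr_ge0.
have mkap j : measurable_fun I (kap j).
  apply: (eq_measurable_fun (fun y => ((h j ^+ K j + cdist (w j) y) ^+ 2) `^ (-1))).
    by move=> y _; rewrite powR_inv1 // sqr_ge0.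
  apply: (measurableT_comp (measurable_powR (-1))).
  apply: measurable_funX; apply: measurable_funD; first exact: measurable_cst.
  exact: measurable_cdist.
have pt y : N (torus_derivative p q (x, y)) `^ r <= B0 + \sum_j (B0 * a j) * kap j y.
  have [pxy Fb] := HM (expi x) (expi y) (N_expi x) (N_expi y) xn.
  rewrite /torus_derivative /= dz1_quotientE //.
  have -> : B0 + \sum_j B0 * a j * kap j y = B0 * (1 + \sum_j a j * kap j y).
    by rewrite mulrDr mulr1 mulr_sumr; congr (_ + _); apply: eq_bigr => j _; rewrite mulrA.
  have s0 : 0 <= \sum_j a j * kap j y by apply: sumr_ge0 => j _; rewrite mulr_ge0.
  set F := N _ in Fb *; have F0 : 0 <= F by exact: Nge0.
  case: Fb => [FM|[j Fj]].
    apply: (@le_trans _ _ (B0 * 1)); last by rewrite ler_wpM2l // lerDl.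
    by rewrite mulr1 /B0 ge0_ler_powR ?nnegrE ?mulr_ge0 ?(ltW M0) //; lra.
  set t := local_majorant _ _ _ _ _ _ _ in Fj.
  have t0 : 0 <= t by rewrite divr_ge0 ?exprn_ge0 ?addr_ge0 ?Nge0 ?exprn_ge0 ?Nge0.
  have tp : t `^ r <= a j * kap j y.
    by apply: (majorant_power (h0 j) (ke j) r1); rewrite lerDl; exact: Nge0.
  move: t t0 tp Fj => t t0 tp Fj.
  apply: (@le_trans _ _ (B0 * (1 + t `^ r))); last first.
    rewrite ler_wpM2l // lerD2l (bigD1 j) //=.
    apply: (le_trans tp).
    by rewrite lerDl; apply: sumr_ge0 => i _; rewrite mulr_ge0.
  have [t1|t1] := leP t 1.
    apply: (@le_trans _ _ (B0 * 1)); last by rewrite ler_wpM2l // lerDl powR_ge0.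
    rewrite mulr1 /B0 ge0_ler_powR ?nnegrE ?mulr_ge0 ?(ltW M0) //.
    by apply: (le_trans Fj); nra.
  apply: (@le_trans _ _ (B0 * t `^ r)); last by rewrite ler_wpM2l // lerDr.
  rewrite /B0 -powRM ?mulr_ge0 ?(ltW M0) //.
  rewrite ge0_ler_powR ?nnegrE ?mulr_ge0 ?(ltW M0) //.
  by apply: (le_trans Fj); nra.
apply: (@le_trans _ _ (\int[mu]_(y in I) (B0 + \sum_j (B0 * a j) * kap j y)%R%:E)%E).
  apply: ge0_le_integral => //.
  - by move=> y _; rewrite lee_fin powR_ge0.
  - exact: (measurable_derivative_density_section r Ix).
  - apply/measurable_EFinP; apply: measurable_funD; first exact: measurable_cst.
    apply: measurable_sum => j; apply: measurable_funM => //; exact: measurable_cst.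
  - by move=> y _; rewrite lee_fin.
apply: le_trans (@integral_affine_le _ _ _ mu I m B0 (2 * pi) _ (fun j => A / h j ^+ K j) kap mI B00 _ mkap kap0 _ _) _.
- by move=> j; rewrite mulr_ge0.
- exact: muI.
- by move=> j; apply: HA; rewrite ?N_phase // exprn_gt0.
rewrite lee_fin; apply: lerD; first by rewrite lerDl mulr_ge0 // ltW.
apply: ler_sum => j _.
rewrite -(powR_exponent r (h0 j) (ke j)) -/(a j).
apply: (@le_trans _ _ (B0 * A * (a j / h j ^+ K j))).
  by apply: eqW_le; ring.
apply: ler_wpM2r; first by rewrite divr_ge0 // exprn_ge0 // ltW.
by rewrite lerDr mulr_ge0.
Qed.

Lemma derivative_density_integral_lty (r : R) : 1 <= r -> (forall j, (k j)%:R * r < (K j).+1%:R) ->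
  (\int[(mu \x mu)%E]_(t in I `*` I) derivative_density p q r t < +oo)%E.
Proof.
move=> r1 rk; have [B B0 HB] := inner_integral_le r1.
have mF := measurable_derivative_density q tau_zeros r.
have F0 t : (0 <= derivative_density p q r t)%E by rewrite lee_fin powR_ge0.
rewrite tonelli_rectangle //.
pose b j := (K j)%:R - (k j)%:R * r.
have fin j : (\int[mu]_(x in I) (cdist (tau j).1 x `^ b j)%:E < +oo)%E.
  by apply: cdist_power => //; have := rk j; rewrite /b -natr1; lra.
pose Bj j := fine (\int[mu]_(x in I) (cdist (tau j).1 x `^ b j)%:E)%E.
have mk j : measurable_fun I (fun x => cdist (tau j).1 x `^ b j).
  by apply: (measurableT_comp (measurable_powR (b j))); exact: measurable_cdist.
apply: (@le_lt_trans _ _ (\int[mu]_(x in I) (B + \sum_j B * cdist (tau j).1 x `^ b j)%R%:E)%E).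
  apply: ae_ge0_le_integral => //.
  - by move=> x _; apply: integral_ge0.
  - exact: measurable_fun_section_integral.
  - move=> x _; rewrite lee_fin addr_ge0 // sumr_ge0 // => j _.
    by rewrite mulr_ge0 // powR_ge0.
  - apply/measurable_EFinP; apply: measurable_funD; first exact: measurable_cst.
    apply: measurable_sum => j; apply: measurable_funM => //; exact: measurable_cst.
  (* The bound on the inner integral is available only where exp(ix) is no first coordinate of a
     zero; the remaining angles are finite in number, hence null. *)
  pose Z : set (measurableTypeR R) := \bigcup_(j in [set: 'I_m])
    [set s : R | 0 <= s <= 2 * pi /\ expi s = (tau j).1].
  have fZ : finite_set Z.
    apply: bigcup_finite; first exact: finite_finset.
    by move=> j _; exact: expi_fiber_finite.
  exists Z; split.
  - by apply: countable_measurable; [move=> t; exact: measurable_set1|exact: finite_set_countable].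
  - exact: countable_lebesgue_measure0 (finite_set_countable fZ).
  move=> x /= nx; apply: contrapT => nZ; apply: nx => Ix; apply: HB => // j.
  apply/eqP => xj; apply: nZ; exists j => //; split=> //.
apply: (le_lt_trans (@integral_affine_le _ _ _ mu I m B (2 * pi) (fun _ => B) Bj
  (fun j x => cdist (tau j).1 x `^ b j) mI B0 (fun _ => B0) mk _ muI _)).
- by move=> j x; exact: powR_ge0.
- move=> j; rewrite /Bj fineK // ge0_fin_numE //.
  by apply: integral_ge0 => x _; rewrite lee_fin powR_ge0.
by rewrite ltry.
Qed.


End Integrability.

(** * Divergence above the threshold *)

Section Divergence.
Variable R : realType.
Local Notation C := (R[i]).
Local Notation N := (@ComplexField.Normc.normc R).
Local Notation mu := (@lebesgue_measure R).
Local Notation I := (`[0%R, (2 * pi)%R]%classic : set (measurableTypeR R)).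
Local Notation T2 := (measurableTypeR R * measurableTypeR R)%type.

Lemma powR_unbounded (a b V : R) : 0 < a -> b < 0 -> exists2 s : R, 0 < s <= a &
  forall t, 0 < t <= s -> V < t `^ b.
Proof.
move=> a0 b0; pose W := `|V| + 1; have W0 : 0 < W by rewrite ltr_wpDl.
pose s0 := W `^ (b^-1); have s00 : 0 < s0 by exact: powR_gt0.
exists (Num.min a s0); first by rewrite lt_min a0 s00 ge_min lexx.
move=> t /andP[t0]; rewrite le_min => /andP[_ ts].
apply: (@lt_le_trans _ _ W); first by have := ler_norm V; rewrite /W; lra.
have -> : W = s0 `^ b by rewrite /s0 -powRrM mulVf ?lt_eqF // powRr1 // ltW.
have bE x : x `^ b = (x `^ (- b))^-1 by rewrite -powRN opprK.
rewrite !bE lef_pV2 ?posrE ?powR_gt0 //.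
by rewrite ge0_ler_powR ?nnegrE ?oppr_ge0 // ltW.
Qed.

Lemma lebesgue_measure_oo (a r : R) : 0 < r ->
  mu (`]a, (a + r)%R[%classic : set (measurableTypeR R)) = r%:E.
Proof.
by move=> r0; rewrite lebesgue_measure_itv /= lte_fin ltrDl r0 -EFinB addrAC subrr add0r.
Qed.

Variables (p q : {poly {poly C}}) (m : nat) (tau : 'I_m -> C * C).
Variables (K e : 'I_m -> nat) (g : 'I_m -> {poly C}).
Hypothesis tau_zeros : forall z : C * C, (torus z /\ p.[z.1, z.2] = 0) <-> exists j, z = tau j.
Hypothesis branch_g : forall j, branch p (tau j).1 (tau j).2 (K j) (g j).
Hypothesis qp : forall x y : C, N x = 1 -> N y = 1 -> N q.[x, y] <= N p.[x, y].
Hypothesis order_e : forall j, branch_order q (tau j).1 (K j) (g j) (e j).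

Local Notation k j := (2 * K j - e j)%N.

Let mI : measurable I. Proof. exact: measurable_itv. Qed.

(** Only an arc of length h^K beside phase g(x) is kept. There |W / p^2| is at least a multiple of
    h^(-k), and the length of the arc contributes the K in the exponent. *)
Lemma inner_integral_ge j (r : R) : (e j < 2 * K j)%N -> 0 < r ->
  exists d c : R, [/\ 0 < d <= 1, 0 < c & forall x : R, I x -> 0 < cdist (tau j).1 x < d ->
  ((c * cdist (tau j).1 x `^ ((K j)%:R - (k j)%:R * r))%R%:E <= \int[mu]_(y in I) derivative_density p q r (x, y))%E].
Proof.
move=> eK r0; have [t1 t2] := tau_torus tau_zeros j.
have [d [c [d0 c0 H]]] := local_lower t1 t2 (branch_g j) qp (order_e j) eK.
exists d, (c `^ r); split; rewrite ?powR_gt0 // => x Ix xd.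
have [/andP[h0 hd] /andP[dpos d1]] := (xd, d0).
have [w1 Hy] := H (expi x) (N_expi x) xd.
set h := cdist (tau j).1 x in h0 hd *.
have hK0 : 0 < h ^+ K j by rewrite exprn_gt0.
have hK1 : h ^+ K j <= 1 by rewrite exprn_ile1 ?ltW // (lt_le_trans hd).
have [|b [b0 b2 arcb]] := arc (w := phase (g j).[expi x]) (r := h ^+ K j) w1.
  by rewrite hK0 hK1.
pose S : set (measurableTypeR R) := `]b, (b + h ^+ K j)%R[%classic.
have SI : S `<=` I.
  move=> y; rewrite /S /= !in_itv /= => /andP[u v].
  by apply/andP; split; [exact/ltW/(le_lt_trans b0)|apply: ltW; exact: lt_le_trans v b2].
have lb y : S y -> (((c / h ^+ k j) `^ r)%R%:E <= derivative_density p q r (x, y))%E.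
  rewrite /S /= in_itv /= => /arcb /andP[_ yh].
  have [p0 W] := Hy (expi y) (N_expi y) yh.
  rewrite /derivative_density lee_fin /torus_derivative /= dz1_quotientE // ge0_ler_powR ?nnegrE ?(ltW r0) ?Nge0 //.
    by rewrite divr_ge0 ?exprn_ge0 ?ltW.
  have P0 : 0 < N p.[expi x, expi y] ^+ 2 by rewrite exprn_gt0 // N_gt0.
  rewrite Nf NX ler_pdivlMr // mulrAC ler_pdivrMr ?exprn_gt0 //.
  have he0 : 0 < h ^+ e j by rewrite exprn_gt0.
  rewrite -(ler_pM2r he0) -[X in _ <= X]mulrA -exprD subnK; last exact: ltnW.
  by apply: le_trans W; rewrite -/h mulrAC.
apply: (@le_trans _ _ (((c / h ^+ k j) `^ r)%R%:E * mu S)%E); last first.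
  apply: integral_ge_cst => //.
  - exact: measurable_itv.
  - exact: (measurable_derivative_density_section q tau_zeros r Ix).
  - by move=> y _; rewrite lee_fin powR_ge0.
  - exact: powR_ge0.
rewrite lebesgue_measure_oo // -EFinM lee_fin; apply: eqW_le.
rewrite powRM ?invr_ge0 ?exprn_ge0 ?(ltW c0) ?(ltW h0) // -mulrA; congr (_ * _).
rewrite -!powR_mulrn ?(ltW h0) // -powRN -powRrM -powRD ?(gt_eqF h0) ?implybT //.
by congr (_ `^ _); ring.
Qed.

(** A single arc of length s already contributes at least c s^b s, because b < 0 and the distance to
    the zero is at most s on it. Letting s tend to 0 with b + 1 < 0 exceeds any finite value. *)
Lemma derivative_density_integral_infty j (r : R) : (e j < 2 * K j)%N -> 0 < r -> (K j).+1%:R < (k j)%:R * r ->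
  ~ (\int[(mu \x mu)%E]_(t in I `*` I) derivative_density p q r t < +oo)%E.
Proof.
move=> eK r0 rk; have mF := measurable_derivative_density q tau_zeros r.
have F0 t : (0 <= derivative_density p q r t)%E by rewrite lee_fin powR_ge0.
rewrite tonelli_rectangle //.
have [d [c [/andP[d0 d1] c0 H]]] := inner_integral_ge eK r0.
pose J x := (\int[mu]_(y in I) derivative_density p q r (x, y))%E.
have mJ : measurable_fun I J by exact: measurable_fun_section_integral.
have J0 x : (0 <= J x)%E by exact: integral_ge0.
pose b := (K j)%:R - (k j)%:R * r.
have b1 : b + 1 < 0 by rewrite /b; move: rk; rewrite -natr1; lra.
have lb (s : R) : 0 < s -> s <= d / 2 -> ((c * s `^ (b + 1))%R%:E <= \int[mu]_(x in I) J x)%E.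
  move=> s0 sd; have [t1 _] := tau_torus tau_zeros j.
  have [|a [a0 a2 arca]] := arc (w := (tau j).1) (r := s) t1; first by rewrite s0; lra.
  pose S : set (measurableTypeR R) := `]a, (a + s)%R[%classic.
  have SI : S `<=` I.
    move=> y; rewrite /S /= !in_itv /= => /andP[u v].
    by apply/andP; split; [exact/ltW/(le_lt_trans a0)|apply: ltW; exact: lt_le_trans v a2].
  apply: (@le_trans _ _ ((c * s `^ b)%R%:E * mu S)%E).
    rewrite lebesgue_measure_oo // -EFinM lee_fin; apply: eqW_le.
    by rewrite powRD ?(gt_eqF s0) ?implybT // powRr1 ?mulrA // ltW.
  apply: integral_ge_cst => //.
  - exact: measurable_itv.
  - by rewrite mulr_ge0 ?powR_ge0 // ltW.
  move=> x Sx; have /andP[h0 hs] : 0 < cdist (tau j).1 x <= s.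
    by apply: arca; move: Sx; rewrite /S /= in_itv.
  apply: le_trans (H x (SI x Sx) _); last by rewrite h0; lra.
  rewrite lee_fin ler_pM2l // -/b.
  have bE u : u `^ b = (u `^ (- b))^-1 by rewrite -powRN opprK.
  rewrite !bE lef_pV2 ?posrE ?powR_gt0 // ge0_ler_powR ?nnegrE //; try exact: ltW.
  by rewrite oppr_ge0; lra.
move=> fin.
pose V := fine (\int[mu]_(x in I) J x)%E.
have VE : (\int[mu]_(x in I) J x)%E = V%:E.
  by rewrite /V fineK // ge0_fin_numE // integral_ge0.
have d20 : 0 < d / 2 by rewrite divr_gt0.
have [s /andP[s0 sd] HV] := powR_unbounded (V / c) d20 b1.
have := lb s s0 sd; rewrite VE lee_fin leNgt => /negP; apply.
by rewrite mulrC -ltr_pdivrMr // HV // s0 lexx.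
Qed.

End Divergence.

(** * Realizing the indices *)

Section ReflectionOrder.
Variable R : realType.
Local Notation C := (R[i]).
Local Notation N := (@ComplexField.Normc.normc R).

Lemma reflection_torus (p : {poly {poly C}}) (x y : C) : N x = 1 -> N y = 1 ->
  N (reflection p).[x, y] = N p.[x, y].
Proof.
move=> x1 y1; rewrite reflection_horner -?N_gt0 ?x1 ?y1 // !inv_conj_unit //.
by rewrite !NM !NX x1 y1 !expr1n !mul1r Nconj.
Qed.

(* If the order were larger than K, then p~(x, g(x)) = o(|x - t1|^K); but it has the
   size of p at the reflected point 1/conj g(x), whose distance to the zero set of p
   is at least of order |x - t1|^K. *)
Lemma branch_order_reflection (p : {poly {poly C}}) (t1 t2 : C) K g :
  N t1 = 1 -> N t2 = 1 -> branch p t1 t2 K g -> branch_order (reflection p) t1 K g K.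
Proof.
move=> t11 t21 gp; have [e eo] := branch_order_exists (reflection p) t1 K g.
have Ke : (K <= e)%N.
  by apply: branch_order_ge t11 t21 gp _ eo => x y x1 y1; rewrite reflection_torus.
move: Ke; rewrite leq_eqVlt => /orP[/eqP KE|Ke]; first by move: eo; rewrite -KE.
exfalso.
have [gt1 [s [Q [sE pE Qt]]] _ K2 [d [a [b [/andP[d0 d1] a0 b0 H]]]]] := gp.
have [_ [u [uE _]]] := eo.
have [dQ [c [/andP[dQ0 dQ1] c0 HQ]]] := poly2_lower t11 t21 Qt.
have [mu mu0 Hu] := poly_bound 2 u; have [ms ms0 Hs] := poly_bound 2 s.
have [L L0 HL] := poly_factor_lip g t11.
have pE2 := poly2_division_horner pE.
pose r := Num.min (Num.min d dQ) (Num.min (dQ / L) (c * a / (ms + mu))).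
have r0 : 0 < r by rewrite !lt_min d0 dQ0 !divr_gt0 ?mulr_gt0 ?addr_gt0.
have [w [w1 wn1 wr]] := unit_near1 r0.
pose x := t1 * w; have x1 : N x = 1 by rewrite NM t11 w1 mulr1.
have hE : x - t1 = t1 * (w - 1) by rewrite /x; ring.
set h := N (x - t1); have hw : h = N (w - 1) by rewrite /h hE NM t11 mul1r.
have h0 : 0 < h by rewrite hw N_gt0 subr_eq0.
rewrite -hw in wr.
have hd : h < d by rewrite (lt_le_trans wr) // !ge_min lexx.
have hdQ : h < dQ by rewrite (lt_le_trans wr) // !ge_min lexx !orbT.
have hL : h * L < dQ by rewrite -ltr_pdivlMr // (lt_le_trans wr) // !ge_min lexx !orbT.
have hca : h * (ms + mu) < c * a.
  by rewrite -ltr_pdivlMr ?addr_gt0 // (lt_le_trans wr) // !ge_min lexx !orbT.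
have [|glo _ _] := H x x1; first by rewrite -/h h0 hd.
rewrite -/h in glo; set G := g.[x] in glo.
have hK0 : 0 < h ^+ K by rewrite exprn_gt0.
have NG : 1 < N G by have := mulr_gt0 a0 hK0; lra.
have NG0 : 0 < N G by lra.
have G0 : G != 0 by rewrite -N_gt0.
have x2 : N x <= 2 by lra.
have Gt : N (G - t2) <= L * h by rewrite -gt1; exact: HL.
pose y := 1 / G^*.
(* The distance is |1/conj(G) - G| = (|G|^2 - 1) / |G|, which is at least |G| - 1. *)
have yG : a * h ^+ K <= N (y - G).
  have -> : y - G = (1 - G * G^*) / G^* by rewrite /y mulrBl mulfK // fmorph_eq0.
  rewrite mulcC -(rmorph1 (real_complex R)) -rmorphB Nf Nreal Nconj.
  rewrite ler0_norm; last by rewrite subr_le0 exprn_ege1 // ltW.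
  by rewrite ler_pdivlMr //; nra.
have yt : N (y - t2) < dQ.
  have t20 : t2 != 0 by rewrite -N_gt0 t21.
  rewrite -[X in _ - X](inv_conj_unit t21).
  have -> : 1 / G^* - 1 / t2^* = (t2 - G)^* / (G^* * t2^*).
    by rewrite rmorphB /=; field; rewrite !fmorph_eq0 G0 t20.
  rewrite Nf NM !Nconj t21 mulr1 ltr_pdivrMr // NBC; nra.
have Qlb : c <= N Q.[x, y] by exact: HQ.
have up : N (reflection p).[x, G] <= mu * h ^+ e.
  rewrite -horner2_swapXY -horner_horner uE hornerM horner_exp hornerXsubC NM NX -/h mulrC.
  by rewrite ler_wpM2r ?Hu // exprn_ge0 // ltW.
(* On |x| = 1, |p~(x, G)| equals |G|^(n2) |p(x, 1/conj(G))| with |G| > 1, and p at the reflected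
   point is (y - G) Q up to the remainder of order 2K. *)
have lo : c * (a * h ^+ K) - ms * h ^+ (2 * K) <= N (reflection p).[x, G].
  have x0 : x != 0 by rewrite -N_gt0 x1.
  rewrite reflection_horner // inv_conj_unit // -/y !NM !NX x1 expr1n mul1r Nconj.
  have : N p.[x, y] <= N G ^+ (sizeY p).-1 * N p.[x, y].
    by rewrite ler_peMl ?Nge0 // exprn_ege1 // ltW.
  apply: le_trans.
  rewrite pE2 sE hornerM horner_exp hornerXsubC [X in N X]addrC.
  apply: le_trans _ (NDge _ _); rewrite !NM NX -/h; apply: lerB.
    by rewrite mulrC; apply: ler_pM => //; rewrite ltW // mulr_gt0.
  by rewrite mulrC ler_wpM2r ?Hs // exprn_ge0 // ltW.
have h1 : h <= 1 by lra.
have he : h ^+ e <= h * h ^+ K by rewrite -exprS ler_wiXn2l // ltW.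
have h2K : h ^+ (2 * K) <= h * h ^+ K.
  by rewrite -exprS ler_wiXn2l // ?ltW // mul2n -addnn -addn1 leq_add2l ltnW.
have := le_trans lo up; apply/negP; rewrite -ltNge.
have u1 := ler_wpM2l (ltW mu0) he; have u2 := ler_wpM2l (ltW ms0) h2K.
have : h * (ms + mu) * h ^+ K < c * a * h ^+ K by rewrite ltr_pM2r.
lra.
Qed.

End ReflectionOrder.

Section Holomorphy.
Variable F : numFieldType.

Lemma differentiable_fst (z : F^o * F^o) : differentiable (fun w : F^o * F^o => w.1) z.
Proof.
have cont : continuous (fun w : F^o * F^o => w.1) by move=> w; exact: cvg_fst.
exact: (@linear_differentiable F (F^o * F^o)%type F^o (fst : {linear (F^o * F^o)%type -> F^o}) z cont).
Qed.

Lemma differentiable_snd (z : F^o * F^o) : differentiable (fun w : F^o * F^o => w.2) z.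
Proof.
have cont : continuous (fun w : F^o * F^o => w.2) by move=> w; exact: cvg_snd.
exact: (@linear_differentiable F (F^o * F^o)%type F^o (snd : {linear (F^o * F^o)%type -> F^o}) z cont).
Qed.

Lemma differentiable_horner2 (p : {poly {poly F}}) (z : F^o * F^o) :
  differentiable (fun w : F^o * F^o => p.[w.1, w.2] : F^o) z.
Proof.
have d1 (a : {poly F}) : differentiable (fun w : F^o * F^o => a.[w.2] : F^o) z.
  elim/poly_ind: a => [|a c IH].
    rewrite (_ : (fun _ => _) = cst (0 : F^o)); first exact: differentiable_cst.
    by apply/funext => w; rewrite horner0.
  rewrite (_ : (fun _ => _) = (fun w : F^o * F^o => a.[w.2] : F^o) * (fun w : F^o * F^o => w.2)
     + cst (c : F^o)); last by apply/funext => w; rewrite hornerMXaddC.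
  apply: differentiableD; last exact: differentiable_cst.
  by apply: differentiableM => //; exact: differentiable_snd.
elim/poly_ind: p => [|p c IH].
  rewrite (_ : (fun _ => _) = cst (0 : F^o)); first exact: differentiable_cst.
  by apply/funext => w; rewrite !horner0.
rewrite (_ : (fun _ => _) = (fun w : F^o * F^o => p.[w.1, w.2] : F^o) * (fun w : F^o * F^o => w.1)
   + (fun w : F^o * F^o => c.[w.2] : F^o)); last first.
  by apply/funext => w; rewrite hornerMXaddC hornerD hornerM hornerC.
by apply: differentiableD => //; apply: differentiableM => //; exact: differentiable_fst.
Qed.

Lemma differentiable_quotient2 (p q : {poly {poly F}}) (z : F^o * F^o) : p.[z.1, z.2] != 0 ->
  differentiable (fun w : F^o * F^o => q.[w.1, w.2] / p.[w.1, w.2] : F^o) z.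
Proof.
move=> p0.
apply: (@differentiableM _ _ (fun w : F^o * F^o => q.[w.1, w.2] : F^o)
  (fun w : F^o * F^o => (p.[w.1, w.2])^-1 : F^o)).
  exact: differentiable_horner2.
by apply: differentiableV => //; exact: differentiable_horner2.
Qed.

End Holomorphy.

(** * The index belonging to a given numerator *)

Section Index.
Variable R : realType.
Local Notation C := (R[i]).
Local Notation N := (@ComplexField.Normc.normc R).

Lemma schur_torus (p q : {poly {poly C}}) : quotient_is_rational_schur q p ->
  forall x y : C, N x = 1 -> N y = 1 -> N q.[x, y] <= N p.[x, y].
Proof. by move=> H x y x1 y1; apply: schur_le_torus; rewrite ?x1 ?y1. Qed.

Variables (p q : {poly {poly C}}) (m : nat) (tau : 'I_m -> C * C).
Variables (K e : 'I_m -> nat) (g : 'I_m -> {poly C}).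
Hypothesis tau_zeros : forall z : C * C, (torus z /\ p.[z.1, z.2] = 0) <-> exists j, z = tau j.
Hypothesis branch_g : forall j, branch p (tau j).1 (tau j).2 (K j) (g j).
Hypothesis qp : forall x y : C, N x = 1 -> N y = 1 -> N q.[x, y] <= N p.[x, y].
Hypothesis order_e : forall j, branch_order q (tau j).1 (K j) (g j) (e j).

Let S := [set r : R | 0 < r /\ in_Lp_torus r (dz1_quotient q p)].

Lemma in_Lp_torus_lt (r : R) : 1 <= r ->
  (forall j, (2 * K j - e j)%:R * r < (K j).+1%:R) -> S r.
Proof.
move=> r1 H; split; first exact: lt_le_trans r1.
apply/(in_Lp_torusE q tau_zeros).
exact (derivative_density_integral_lty tau_zeros branch_g qp order_e r1 H).
Qed.

Lemma index_infinite : (forall j, e j = (2 * K j)%N) -> ereal_sup [set r%:E | r in S] = +oo%E.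
Proof.
move=> eK; have inS r : 1 <= r -> S r.
  by move=> r1; apply: in_Lp_torus_lt => // j; rewrite eK subnn mul0r ltr0n.
apply: hasNub_ereal_sup; last by exists 1; exact: inS.
move=> [M HM]; have := HM (Num.max 1 (M + 1)) (inS _ _).
by rewrite le_max lexx ge_max => /(_ isT) /andP[_]; lra.
Qed.

Lemma index_finite j0 : (e j0 < 2 * K j0)%N ->
  (forall j, (e j < 2 * K j)%N ->
     (K j0).+1%:R / (2 * K j0 - e j0)%:R <= (K j).+1%:R / (2 * K j - e j)%:R :> R) ->
  ereal_sup [set r%:E | r in S] = ((K j0).+1%:R / (2 * K j0 - e j0)%:R : R)%:E.
Proof.
move=> e0 emin; set x := _ / _ in emin *.
have k0 j : (e j < 2 * K j)%N -> 0 < (2 * K j - e j)%:R :> R by rewrite ltr0n subn_gt0.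
(* K <= e gives 2K - e <= K < K + 1, so the supremum can be approached through exponents r >= 1. *)
have x1 : 1 < x.
  have [t1 t2] := tau_torus tau_zeros j0.
  have := branch_order_ge t1 t2 (branch_g j0) qp (order_e j0).
  by rewrite /x ltr_pdivlMr ?k0 // mul1r ltr_nat; lia.
have inS r : 1 <= r -> r < x -> S r.
  move=> r1 rx; apply: in_Lp_torus_lt => // j.
  have [ej|ej] := ltnP (e j) (2 * K j).
    by rewrite mulrC -ltr_pdivlMr ?k0 // (lt_le_trans rx) // emin.
  by have /eqP -> : (2 * K j - e j)%N == 0%N by []; rewrite mul0r ltr0n.
apply/eqP; rewrite eq_le; apply/andP; split.
  apply: ge_ereal_sup => _ [r [r0 rS] <-]; rewrite lee_fin leNgt; apply/negP => rx.
  move/(in_Lp_torusE q tau_zeros): rS.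
  apply: (derivative_density_integral_infty tau_zeros branch_g qp order_e e0 r0).
  by rewrite mulrC -ltr_pdivrMr // k0.
rewrite leNgt; apply/negP => sx.
have S1 : (1%:E <= ereal_sup [set r%:E | r in S])%E.
  by apply: ereal_sup_ubound; exists 1 => //; exact: inS.
(* If the supremum were some s < x, then the midpoint of s and x, which is at least 1, would be a
   larger admissible exponent. *)
case E : (ereal_sup [set r%:E | r in S]) sx S1 => [s| |] //; rewrite lte_fin lee_fin => sx s1.
have : (((s + x) / 2)%:E <= s%:E)%E.
  by rewrite -E; apply: ereal_sup_ubound; exists ((s + x) / 2) => //; apply: inS; lra.
by rewrite lee_fin; lra.
Qed.

End Index.

(** * Numerators with prescribed orders along the curves *)

Section SwapFactors.
Variable F : fieldType.

Lemma swapXY_X_horner (a : F) g : (swapXY ('X - a%:P%:P)).[g] = 'X - a%:P.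
Proof.
by rewrite raddfB /= swapXY_X swapXY_polyC map_polyC /= hornerD hornerN !hornerC.
Qed.

Lemma swapXY_Y_horner (a : F) g : (swapXY ('Y - a%:P%:P)).[g] = g - a%:P.
Proof.
by rewrite raddfB /= swapXY_Y swapXY_polyC map_polyC /= hornerD hornerN hornerX hornerC.
Qed.

End SwapFactors.

Section Construction.
Variable R : realType.
Local Notation C := (R[i]).
Local Notation N := (@ComplexField.Normc.normc R).

Lemma quotient_schur (p q : {poly {poly C}}) : (forall z, bidisk z -> p.[z.1, z.2] <> 0) ->
  (forall x y : C, N x < 1 -> N y < 1 -> N q.[x, y] <= N p.[x, y]) ->
  quotient_is_rational_schur q p.
Proof.
move=> p0 qp; split.
  move=> pE; apply: (p0 (0, 0)); first by split; rewrite /= normr0 ltr01.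
  by rewrite pE !horner0.
exists (fun z => q.[z.1, z.2] / p.[z.1, z.2]); split => z zD.
- by rewrite divfK //; apply/eqP/p0.
- by apply: differentiable_quotient2; apply/eqP/p0.
- have pz : p.[z.1, z.2] != 0 by apply/eqP/p0.
  have [z1 z2] := zD; rewrite norm_le1.
  by rewrite Nf ler_pdivrMr ?N_gt0 // mul1r qp // -norm_lt1.
Qed.

Lemma branch_orderM (q A : {poly {poly C}}) (t : C) (K : nat) g (d e : nat) (v : {poly C}) :
  (swapXY A).[g] = ('X - t%:P) ^+ d * v -> v.[t] != 0 -> (d + e <= 2 * K)%N ->
  branch_order q t K g e -> branch_order (A * q) t K g (d + e).
Proof.
move=> AE v0 deK [eK [u [uE u0]]]; split => //; exists (v * u).
rewrite rmorphM /= hornerM AE uE exprD; split; first by rewrite mulrACA.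
by move=> deK'; rewrite hornerM mulf_neq0 // u0 // (leq_ltn_trans _ deK') // leq_addl.
Qed.

Lemma branch_order_full (q : {poly {poly C}}) (t : C) (K : nat) g (u : {poly C}) :
  (swapXY q).[g] = ('X - t%:P) ^+ (2 * K) * u -> branch_order q t K g (2 * K).
Proof. by move=> uE; split => //; exists u; rewrite ltnn. Qed.

Section Factors.
Variables (p : {poly {poly C}}) (m : nat) (tau : 'I_m -> C * C) (j0 : 'I_m).
Variables (K : 'I_m -> nat) (g : 'I_m -> {poly C}).
Hypothesis tau_inj : injective tau.
Hypothesis branch_g : forall j, branch p (tau j).1 (tau j).2 (K j) (g j).

(** A coordinate line through tau i that avoids tau j0 when i <> j0: the first coordinates are used
    to separate the two points unless they coincide, in which case the second ones differ. *)
Definition line (i : 'I_m) : {poly {poly C}} :=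
  if (tau i).1 == (tau j0).1 then 'Y - (tau i).2%:P%:P else 'X - (tau i).1%:P%:P.

Lemma line_neq0 i : i != j0 -> (swapXY (line i)).[g j0].[(tau j0).1] != 0.
Proof.
move=> ij; rewrite /line; case: ifPn => [/eqP e1|n1].
  rewrite swapXY_Y_horner hornerD hornerN hornerC; have [-> _ _ _ _] := branch_g j0.
  rewrite subr_eq0; apply: contra_neq ij => e2; apply: tau_inj.
  by rewrite [tau i]surjective_pairing [tau j0]surjective_pairing e1 e2.
by rewrite swapXY_X_horner hornerXsubC subr_eq0 eq_sym.
Qed.

Lemma line_root i : exists w, (swapXY (line i)).[g i] = ('X - (tau i).1%:P) * w.
Proof.
have : root (swapXY (line i)).[g i] (tau i).1.
  rewrite /root /line; case: ifP => _; last by rewrite swapXY_X_horner hornerXsubC subrr.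
  by rewrite swapXY_Y_horner hornerD hornerN hornerC; have [-> _ _ _ _] := branch_g i; rewrite subrr.
by move=> /factor_theorem[w ->]; exists w; rewrite mulrC.
Qed.

Let M := (2 * \sum_i K i)%N.
(** The exponent [M] is at least 2 K i for every i, so this factor makes the order full at all zeros
    other than tau j0, where it does not vanish. *)
Definition flat_factor : {poly {poly C}} := \prod_(i | i != j0) line i ^+ M.

Lemma flat_factor_neq0 : (swapXY flat_factor).[g j0].[(tau j0).1] != 0.
Proof.
rewrite /flat_factor rmorph_prod /= !horner_prod; apply/prodf_neq0 => i ij.
by rewrite rmorphXn /= !horner_exp expf_neq0 // line_neq0.
Qed.

Lemma flat_factor_order i : i != j0 ->
  exists w, (swapXY flat_factor).[g i] = ('X - (tau i).1%:P) ^+ (2 * K i) * w.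
Proof.
move=> ij; have [w wE] := line_root i.
have MK : (2 * K i <= M)%N by rewrite leq_mul2l /= (bigD1 i) //= leq_addr.
exists (('X - (tau i).1%:P) ^+ (M - 2 * K i) * (w ^+ M *
  (swapXY (\prod_(l | (l != j0) && (l != i)) line l ^+ M)).[g i])).
rewrite mulrA -exprD subnKC // mulrA -exprMn -wE /flat_factor (bigD1 i) //=.
by rewrite rmorphM /= hornerM rmorphXn /= horner_exp.
Qed.

End Factors.

(** At tau j0 the power of z1 - t1 contributes K - k and p~ contributes exactly K, in total 2K - k;
    at the other zeros [flat_factor] alone reaches 2K. The Schur bound comes from |p~| <= |p| in the
    bidisk. *)
Lemma index_polynomial (p : {poly {poly C}}) (m : nat) (tau : 'I_m -> C * C)
    (K : 'I_m -> nat) (g : 'I_m -> {poly C}) (j0 : 'I_m) (k : nat) :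
  (forall z, bidisk z -> p.[z.1, z.2] <> 0) -> injective tau ->
  (forall j, N (tau j).1 = 1 /\ N (tau j).2 = 1) ->
  (forall j, branch p (tau j).1 (tau j).2 (K j) (g j)) -> (k <= K j0)%N ->
  exists q, quotient_is_rational_schur q p /\
    forall j, branch_order q (tau j).1 (K j) (g j) (2 * K j - (if j == j0 then k else 0)).
Proof.
move=> p0 tau_inj tau1 branch_g kK.
pose A0 := ('X - (tau j0).1%:P%:P) ^+ (K j0 - k) * flat_factor tau j0 K.
(* Scaling by 1/B makes the cofactor of p~ at most 1 in modulus on the bidisk. *)
have [B B0 HB] := poly2_bound 1 A0.
pose b : C := (B^-1)%:C%C; exists (b%:P%:P * A0 * reflection p); split.
  apply: quotient_schur => // x y x1 y1; rewrite hornerM hornerM NM.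
  apply: (@le_trans _ _ (1 * N (reflection p).[x, y])); last by rewrite mul1r reflection_le.
  apply: ler_wpM2r; first exact: Nge0.
  rewrite hornerM hornerM !hornerC NM Nreal ger0_norm ?invr_ge0 ?(ltW B0) //.
  by rewrite mulrC ler_pdivrMr // mul1r HB // ltW.
have bE l : (swapXY (b%:P%:P)).[g l] = b%:P by rewrite swapXY_polyC map_polyC /= hornerC.
move=> j; case: eqP => [->|/eqP jj0].
  have -> : (2 * K j0 - k = (K j0 - k) + K j0)%N by lia.
  apply: (branch_orderM (v := b%:P * (swapXY (flat_factor tau j0 K)).[g j0])).
  - rewrite !rmorphM /= !hornerM bE rmorphXn /= horner_exp swapXY_X_horner mulrCA; by [].
  - rewrite hornerM hornerC mulf_neq0 //; last exact: flat_factor_neq0.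
    by rewrite -N_gt0 Nreal ger0_norm ?invr_gt0 ?invr_ge0 // ltW.
  - by lia.
  - by have [t1 t2] := tau1 j0; exact: (branch_order_reflection t1 t2 (branch_g j0)).
rewrite subn0; have [w wE] := flat_factor_order branch_g jj0.
apply: branch_order_full (b%:P * ('X - (tau j0).1%:P) ^+ (K j0 - k) * w *
  (swapXY (reflection p)).[g j]) _.
rewrite !rmorphM /= !hornerM bE rmorphXn /= horner_exp swapXY_X_horner wE.
by rewrite !mulrA; congr (_ * _ * _); rewrite mulrC mulrA.
Qed.

End Construction.

Theorem theorem6p11 (R : realType) (p : {poly {poly R[i]}})
    (m : nat) (tau : 'I_m -> R[i] * R[i]) (K : 'I_m -> nat)
    (p_stable : atoral_stable p)
    (tau_inj : injective tau)
    (tau_zeros : forall z : R[i] * R[i],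
       (torus z /\ p.[z.1, z.2] = 0) <-> exists j, z = tau j)
    (K_contact : forall j, is_contact_order p (tau j) (K j))
    (p_order1 : forall j, vanishes_to_order p (tau j) 1) :
  forall x : \bar R,
    is_z1_derivative_index p x <->
    x = +oo%E \/
    exists (j : 'I_m) (k : nat),
      (1 <= k <= K j)%N /\ x = ((K j).+1%:R / k%:R : R)%:E.
Proof.
have [p0 _] := p_stable; have tau1 := tau_torus tau_zeros.
have exg j : exists g, branch p (tau j).1 (tau j).2 (K j) g.
  have [t1 t2] := tau1 j; apply: (branch_exists t1 t2 p0).
    by rewrite -surjective_pairing.
  by rewrite -surjective_pairing.
have {exg} [g branch_g] := choice exg.
move=> x; split => [[_ [q [q_schur ->]]]|].
  have qp := schur_torus q_schur.
  have [e order_e] := choice (fun j => branch_order_exists q (tau j).1 (K j) (g j)).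
  have e2K j : (e j <= 2 * K j)%N by case: (order_e j).
  have [[j1 ej1]|nj] := pselect (exists j, (e j < 2 * K j)%N); last first.
    left; apply: (index_infinite tau_zeros branch_g qp order_e) => j.
    by apply/eqP; rewrite eqn_leq e2K leqNgt; apply/negP => ej; apply: nj; exists j.
  right; pose idx j : R := (K j).+1%:R / (2 * K j - e j)%:R.
  (* Zeros with e = 2K impose no constraint; among the others, the smallest threshold decides
     integrability of the whole derivative. *)
  have [j ej jmin] := @arg_minP _ R 'I_m j1 (fun j => e j < 2 * K j)%N idx ej1.
  exists j, (2 * K j - e j)%N; split.
    have [t1 t2] := tau1 j.
    have := branch_order_ge t1 t2 (branch_g j) qp (order_e j).
    lia.
  exact: (index_finite tau_zeros branch_g qp order_e ej).
case=> [->|[j [k [/andP[k0 kK] ->]]]].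
  split; first exact: ltry.
  (* The zero numerator vanishes along every curve, so all its truncated orders are 2K and no zero
     limits integrability. *)
  exists 0; have q_schur : quotient_is_rational_schur 0 p.
    by apply: quotient_schur => // y z _ _; rewrite !horner0 N0 Nge0.
  split => //; have qp := schur_torus q_schur.
  have order_e j : branch_order 0 (tau j).1 (K j) (g j) (2 * K j).
    by apply: (branch_order_full (u := 0)); rewrite raddf0 horner0 mulr0.
  by rewrite (index_infinite tau_zeros branch_g qp order_e).
split; first by rewrite lte_fin divr_gt0 ?ltr0n.
have [q [q_schur order_e]] := index_polynomial p0 tau_inj tau1 branch_g kK.
exists q; split=> //; have qp := schur_torus q_schur.
have eE : (2 * K j - (2 * K j - (if j == j then k else 0)) = k)%N by rewrite eqxx; lia.
rewrite -[in LHS]eE.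
symmetry; apply: (index_finite (j0 := j) tau_zeros branch_g qp order_e) => [|i].
  by rewrite eqxx; lia.
case: eqP => [->|_]; first by rewrite eqxx.
by rewrite subn0 ltnn.
Qed.
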